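(* Let $X$ be a quasicompact scheme. Then the following are equivalent: (i) $H^p(X,F)=0$ for every abelian sheaf $F$ on $X$ and every $p\geq 1$, where cohomology is taken with respect to the Zariski topology. (ii) Every surjective local isomorphism $U\to X$ admits a section. (iii) The scheme $X$ is affine, and each connected component of $X$ is local. (iv) The scheme $X$ is affine, each irreducible component of $X$ is local, and the space of closed points $\operatorname{Max}(X)$ is at most zero-dimensional. (v) The scheme $X$ is affine, and every element in $R=\Gamma(X,\mathcal{O}_X)$ is the sum of an idempotent and a unit.
   Context: A local isomorphism $U\to X$ is a morphism of schemes such that every point of $U$ has an open neighborhood that is mapped isomorphically onto an open subscheme of $X$. A scheme is local if it is quasicompact and contains precisely one closed point (equivalently, it is the spectrum of a local ring). $\operatorname{Max}(X)\subset X$ denotes the set of closed points with the subspace topology. A topological space is at most zero-dimensional if its topology has a basis consisting of open-and-closed subsets. *)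

(* Defs.v *)
From HB Require Import structures.
From mathcomp Require Import all_boot all_algebra generic_quotient ring.
From mathcomp Require Import all_classical topology.

Set Implicit Arguments.
Unset Strict Implicit.
Unset Printing Implicit Defensive.

Import GRing.Theory.
Local Open Scope classical_set_scope.
Local Open Scope ring_scope.
Local Open Scope quotient_scope.

Definition quasicompact (T : topologicalType) := cover_compact [set: T].

Definition closed_points (T : topologicalType) : set T :=
  [set x | closed [set x]].
Arguments closed_points : clear implicits.

(* A scheme is local when its underlying space satisfies this predicate; for
   a subset [C] of a space, [C] as a type carries the subspace topology. *)
Definition local_space (T : topologicalType) :=
  quasicompact T /\ exists! x : T, closed [set x].

(* Not [zero_dimensional], which only asks that distinct points be separated
   by a clopen set. *)
Definition at_most_zero_dimensional (T : topologicalType) :=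
  exists2 B : set (set T), basis B & B `<=` clopen.

Definition irreducible (T : topologicalType) (A : set T) :=
  A !=set0 /\ forall Z1 Z2 : set T, closed Z1 -> closed Z2 ->
    A `<=` Z1 `|` Z2 -> A `<=` Z1 \/ A `<=` Z2.

Definition irreducible_component (T : topologicalType) (A : set T) :=
  irreducible A /\ forall B : set T, irreducible B -> A `<=` B -> B = A.

Record opens (T : topologicalType) :=
  Opens { opens_set :> set T; opens_open : open opens_set }.

Definition opens_setT (T : topologicalType) : opens T := Opens openT.

Definition opens_setI (T : topologicalType) (U V : opens T) : opens T :=
  Opens (openI (opens_open U) (opens_open V)).

Lemma open_preimage (S T : topologicalType) (f : S -> T) (cf : continuous f)
  (V : opens T) : open (f @^-1` V).
Proof. by move/continuousP: cf; apply; exact: opens_open. Qed.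

Definition opens_preimage (S T : topologicalType) (f : S -> T)
  (cf : continuous f) (V : opens T) : opens S := Opens (open_preimage cf V).

Definition is_sheaf (T : topologicalType) (F : opens T -> Type)
    (res : forall U V : opens T, V `<=` U -> F U -> F V) :=
  forall (U : opens T) (I : Type) (W : I -> opens T)
    (WU : forall i, W i `<=` U) (s : forall i, F (W i)),
  U `<=` \bigcup_i W i ->
  (forall i j (O : opens T) (Oi : O `<=` W i) (Oj : O `<=` W j),
     res (W i) O Oi (s i) = res (W j) O Oj (s j)) ->
  exists! t : F U, forall i, res U (W i) (WU i) t = s i.

Record ab_sheaf (T : topologicalType) := AbSheaf {
  ab_sec :> opens T -> zmodType;
  ab_res : forall U V : opens T, V `<=` U -> {additive ab_sec U -> ab_sec V};
  ab_res_id : forall (U : opens T) (h : U `<=` U) s, ab_res h s = s;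
  ab_res_comp : forall (U V W : opens T) (VU : V `<=` U) (WV : W `<=` V)
    (WU : W `<=` U) s, ab_res WV (ab_res VU s) = ab_res WU s;
  ab_is_sheaf : is_sheaf (fun U V h => ab_res h)
}.

Record ab_mor (T : topologicalType) (F G : ab_sheaf T) := AbMor {
  ab_app :> forall U : opens T, {additive F U -> G U};
  ab_nat : forall (U V : opens T) (h : V `<=` U) s,
    ab_app V (ab_res F h s) = ab_res G h (ab_app U s)
}.

(* For sheaves, the monomorphisms are the maps injective on all sections. *)
Definition ab_mono (T : topologicalType) (F G : ab_sheaf T) (f : ab_mor F G) :=
  forall U : opens T, injective (f U).

Definition ab_exact (T : topologicalType) (F G H : ab_sheaf T)
    (f : ab_mor F G) (g : ab_mor G H) :=
  (forall (U : opens T) s, g U (f U s) = 0) /\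
  (forall (U : opens T) s, g U s = 0 -> forall x, opens_set U x ->
     exists (V : opens T) (VU : V `<=` U) (t : F V),
       opens_set V x /\ f V t = ab_res G VU s).

Definition ab_injective (T : topologicalType) (J : ab_sheaf T) :=
  forall (F G : ab_sheaf T) (i : ab_mor F G) (f : ab_mor F J), ab_mono i ->
  exists g : ab_mor G J, forall (U : opens T) s, g U (i U s) = f U s.

Record injective_resolution (T : topologicalType) (F : ab_sheaf T) := InjRes {
  ir_obj :> nat -> ab_sheaf T;
  ir_injective : forall n, ab_injective (ir_obj n);
  ir_aug : ab_mor F (ir_obj 0);
  ir_d : forall n, ab_mor (ir_obj n) (ir_obj n.+1);
  ir_aug_mono : ab_mono ir_aug;
  ir_aug_exact : ab_exact ir_aug (ir_d 0);
  ir_exact : forall n, ab_exact (ir_d n) (ir_d n.+1)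
}.

(* The p-th cohomology group of the complex of global sections of [J]
   vanishes: every p-cocycle is a p-coboundary. *)
Definition global_cohomology_zero (T : topologicalType) (F : ab_sheaf T)
    (J : injective_resolution F) (p : nat) :=
  forall s : J p (opens_setT T), ir_d J p _ s = 0 ->
  match p return J p (opens_setT T) -> Prop with
  | 0 => fun s => s = 0
  | q.+1 => fun s => exists t : J q (opens_setT T), ir_d J q _ t = s
  end s.

(* H^p(T, F) = 0, for H^p the right derived functors of global sections; they
   do not depend on the chosen injective resolution. *)
Definition cohomology_zero (T : topologicalType) (F : ab_sheaf T) (p : nat) :=
  exists J : injective_resolution F, global_cohomology_zero J p.

(* [GRing.unit] is not available over a [comPzRingType]; the zero ring has to be
   allowed, being the ring of sections over the empty set. *)
Definition ring_unit (R : comPzRingType) (x : R) := exists y : R, x * y = 1.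

Record ringed_space := RingedSpace {
  rs_top :> topologicalType;
  rs_sec : opens rs_top -> comPzRingType;
  rs_res : forall U V : opens rs_top, V `<=` U ->
    {rmorphism rs_sec U -> rs_sec V};
  rs_res_id : forall (U : opens rs_top) (h : U `<=` U) s, rs_res h s = s;
  rs_res_comp : forall (U V W : opens rs_top) (VU : V `<=` U) (WV : W `<=` V)
    (WU : W `<=` U) s, rs_res WV (rs_res VU s) = rs_res WU s;
  rs_is_sheaf : is_sheaf (fun U V h => rs_res h)
}.
Arguments rs_sec : clear implicits.
Arguments rs_res _ {U V}.

Definition global_sections (X : ringed_space) : comPzRingType :=
  rs_sec X (opens_setT X).

Record rs_mor (X Y : ringed_space) := RSMor {
  rs_fun :> X -> Y;
  rs_continuous : continuous rs_fun;
  rs_comap : forall V : opens Y,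
    {rmorphism rs_sec Y V -> rs_sec X (opens_preimage rs_continuous V)};
  rs_natural : forall (V V' : opens Y) (h : V' `<=` V)
    (h' : opens_preimage rs_continuous V' `<=` opens_preimage rs_continuous V)
    s, rs_comap V' (rs_res Y h s) = rs_res X h' (rs_comap V s)
}.

Definition rs_preimage (X Y : ringed_space) (f : rs_mor X Y) (V : opens Y) :
  opens X := opens_preimage (@rs_continuous X Y f) V.

(* The identity f o g = id of morphisms of ringed spaces.  The opens [V] and
   g^-1 (f^-1 V) are equal but not convertible, so that sections over them are
   compared after restriction to open subsets [W]. *)
Definition is_section (X Y : ringed_space) (f : rs_mor Y X) (g : rs_mor X Y) :=
  (forall x, f (g x) = x) /\
  (forall (V W : opens X) (h : W `<=` V)
     (h' : W `<=` rs_preimage g (rs_preimage f V)) (s : rs_sec X V),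
     rs_res X h' (rs_comap g (rs_preimage f V) (rs_comap f V s)) =
     rs_res X h s).

(* [f] induces an isomorphism of ringed spaces from the open subspace [W] of
   [Y] onto the open subspace [V] of [X]: a homeomorphism [W] -> [V], with
   O_X(V') -> O_Y(W `&` f^-1 V') bijective for all open [V'] inside [V]. *)
Definition maps_iso (Y X : ringed_space) (f : rs_mor Y X) (W : opens Y)
    (V : opens X) :=
  [/\ set_bij W V f,
      forall W' : opens Y, W' `<=` W -> open (f @` W') &
      forall V' : opens X, V' `<=` V -> bijective
        (fun s : rs_sec X V' =>
           rs_res Y (@subIsetr _ W (rs_preimage f V') :
                       opens_setI W (rs_preimage f V') `<=` rs_preimage f V')
             (rs_comap f V' s))].

(* The germ at [x] of [s] is a unit of the stalk. *)
Definition germ_unit (X : ringed_space) (x : X) (V : opens X)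
    (s : rs_sec X V) :=
  exists (W : opens X) (h : W `<=` V), opens_set W x /\ ring_unit (rs_res X h s).

(* The homomorphisms O_{Y, f x} -> O_{X, x} reflect units. *)
Definition local_on_stalks (X Y : ringed_space) (f : rs_mor X Y) :=
  forall (x : X) (V : opens Y) (s : rs_sec Y V),
  opens_set V (f x) ->
  germ_unit x (rs_comap f V s) -> germ_unit (f x) s.

Section ProductRing.
Variables (I : Type) (R : I -> comPzRingType).

Definition prod_ring : Type := forall i, R i.
HB.instance Definition _ := Choice.on prod_ring.

Implicit Types f g h : prod_ring.

Let extP f g : (forall i, f i = g i) -> f = g.
Proof. exact: functional_extensionality_dep. Qed.

Definition prod_zero : prod_ring := fun=> 0.
Definition prod_one : prod_ring := fun=> 1.
Definition prod_opp f : prod_ring := fun i => - f i.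
Definition prod_add f g : prod_ring := fun i => f i + g i.
Definition prod_mul f g : prod_ring := fun i => f i * g i.

Fact prod_addA : associative prod_add.
Proof. by move=> f g h; apply: extP => i; exact: addrA. Qed.
Fact prod_addC : commutative prod_add.
Proof. by move=> f g; apply: extP => i; exact: addrC. Qed.
Fact prod_add0 : left_id prod_zero prod_add.
Proof. by move=> f; apply: extP => i; exact: add0r. Qed.
Fact prod_addN : left_inverse prod_zero prod_opp prod_add.
Proof. by move=> f; apply: extP => i; exact: addNr. Qed.

HB.instance Definition _ := GRing.isZmodule.Build prod_ring
  prod_addA prod_addC prod_add0 prod_addN.

Fact prod_mulA : associative prod_mul.
Proof. by move=> f g h; apply: extP => i; exact: mulrA. Qed.
Fact prod_mulC : commutative prod_mul.
Proof. by move=> f g; apply: extP => i; exact: mulrC. Qed.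
Fact prod_mul1 : left_id prod_one prod_mul.
Proof. by move=> f; apply: extP => i; exact: mul1r. Qed.
Fact prod_mulDl : left_distributive prod_mul prod_add.
Proof. by move=> f g h; apply: extP => i; exact: mulrDl. Qed.

HB.instance Definition _ := GRing.Zmodule_isComPzRing.Build prod_ring
  prod_mulA prod_mulC prod_mul1 prod_mulDl.

End ProductRing.

Definition is_prime (A : comPzRingType) (p : set A) :=
  [/\ p 0, forall x y, p x -> p y -> p (x + y),
      forall a x, p x -> p (a * x), ~ p 1 &
      forall x y, p (x * y) -> p x \/ p y].

Record spec (A : comPzRingType) :=
  Spec { spec_ideal :> set A; spec_is_prime : is_prime spec_ideal }.

HB.instance Definition _ (A : comPzRingType) := gen_eqMixin (spec A).
HB.instance Definition _ (A : comPzRingType) := gen_choiceMixin (spec A).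

Section Localization.
Variables (A : comPzRingType) (p : spec A).

Definition denominators : set A := ~` p.

Fact denominators1 : denominators 1.
Proof. by case: (spec_is_prime p). Qed.

Fact denominatorsM s t : denominators s -> denominators t ->
  denominators (s * t).
Proof. by case: (spec_is_prime p) => _ _ _ _ h Ss St /h[]. Qed.

Definition fracs : Type := A * set_type denominators.
HB.instance Definition _ := Choice.on fracs.

Definition mk_fracs (a s : A) (h : denominators s) : fracs :=
  (a, SigSub (mem_set h)).

Definition num (x : fracs) : A := x.1.
Definition den (x : fracs) : A := set_val x.2.

Fact den_denominators x : denominators (den x).
Proof. by case: x => a [s /= h]; exact: set_mem. Qed.
Arguments den_denominators : clear implicits.

Definition fracs_eq (x y : fracs) : bool :=
  `[< exists2 u, denominators u & u * (num x * den y) = u * (num y * den x) >].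

Fact fracs_eq_refl : reflexive fracs_eq.
Proof. by move=> x; apply/asboolP; exists 1 => //; exact: denominators1. Qed.

Fact fracs_eq_sym : symmetric fracs_eq.
Proof. by move=> x y; apply/asboolP/asboolP => -[u Su e]; exists u. Qed.

Fact fracs_eq_trans : transitive fracs_eq.
Proof.
move=> y x z /asboolP[u Su e] /asboolP[v Sv e']; apply/asboolP.
exists (u * v * den y).
  apply: denominatorsM; last exact: den_denominators.
  exact: denominatorsM.
transitivity (v * den z * (u * (num x * den y))); first by ring.
rewrite e; transitivity (u * den x * (v * (num y * den z))); first by ring.
by rewrite e'; ring.
Qed.

Canonical fracs_eq_equiv :=
  EquivRel fracs_eq fracs_eq_refl fracs_eq_sym fracs_eq_trans.

Definition localization : Type := {eq_quot fracs_eq}.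
HB.instance Definition _ := Choice.on localization.
HB.instance Definition _ := EqQuotient.on localization.

Implicit Types x y z : localization.

(* The class of a / s. *)
Definition frac (a s : A) (h : denominators s) : localization :=
  \pi_localization (mk_fracs a h).

Fact frac_eqP (a b s t : A) (hs : denominators s) (ht : denominators t) :
  (exists2 u, denominators u & u * (a * t) = u * (b * s)) <->
  frac a hs = frac b ht.
Proof.
split=> [[u Su e]|/eqP]; last by rewrite eqquotE => /asboolP.
by apply/eqP; rewrite eqquotE; apply/asboolP; exists u.
Qed.

Fact fracP x : exists a s (h : denominators s), x = frac a h.
Proof.
exists (num (repr x)), (den (repr x)), (den_denominators (repr x)).
rewrite -{1}[x]reprK; apply/eqP; rewrite eqquotE; apply/asboolP.
by exists 1; [exact: denominators1|].
Qed.

Definition loc_zero : localization := frac 0 denominators1.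
Definition loc_one : localization := frac 1 denominators1.
Definition loc_opp x : localization :=
  frac (- num (repr x)) (den_denominators (repr x)).
Definition loc_add x y : localization :=
  frac (num (repr x) * den (repr y) + num (repr y) * den (repr x))
    (denominatorsM (den_denominators (repr x)) (den_denominators (repr y))).
Definition loc_mul x y : localization :=
  frac (num (repr x) * num (repr y))
    (denominatorsM (den_denominators (repr x)) (den_denominators (repr y))).

Let repr_frac (a s : A) (hs : denominators s) : exists2 u, denominators u &
  u * (num (repr (frac a hs)) * s) = u * (a * den (repr (frac a hs))).
Proof.
have /eqP : \pi_localization (repr (frac a hs)) =
    \pi_localization (mk_fracs a hs).
  by rewrite reprK.
by rewrite eqquotE => /asboolP.
Qed.

Fact loc_oppE (a s : A) (hs : denominators s) :
  loc_opp (frac a hs) = frac (- a) hs.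
Proof.
have [u Su e] := repr_frac a hs; apply/frac_eqP; exists u => //.
by rewrite !mulNr !mulrN e.
Qed.

Fact loc_addE (a b s t : A) (hs : denominators s) (ht : denominators t) :
  loc_add (frac a hs) (frac b ht) = frac (a * t + b * s) (denominatorsM hs ht).
Proof.
have [u Su e] := repr_frac a hs; have [v Sv e'] := repr_frac b ht.
apply/frac_eqP; exists (u * v); first exact: denominatorsM.
set n := num _ in e *; set d := den _ in e *.
set n' := num _ in e' *; set d' := den _ in e' *.
transitivity (u * (n * s) * (v * (d' * t)) + v * (n' * t) * (u * (d * s))).
  by ring.
by rewrite e e'; ring.
Qed.

Fact loc_mulE (a b s t : A) (hs : denominators s) (ht : denominators t) :
  loc_mul (frac a hs) (frac b ht) = frac (a * b) (denominatorsM hs ht).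
Proof.
have [u Su e] := repr_frac a hs; have [v Sv e'] := repr_frac b ht.
apply/frac_eqP; exists (u * v); first exact: denominatorsM.
set n := num _ in e *; set d := den _ in e *.
set n' := num _ in e' *; set d' := den _ in e' *.
transitivity (u * (n * s) * (v * (n' * t))); first by ring.
by rewrite e e'; ring.
Qed.

Let frac_eq (a b s t : A) (hs : denominators s) (ht : denominators t) :
  a * t = b * s -> frac a hs = frac b ht.
Proof.
by move=> e; apply/frac_eqP; exists 1; [exact: denominators1|rewrite e].
Qed.

Fact loc_addA : associative loc_add.
Proof.
move=> x y z; have [a [s [hs ->]]] := fracP x.
have [b [t [ht ->]]] := fracP y; have [c [r [hr ->]]] := fracP z.
by rewrite !loc_addE; apply: frac_eq; ring.
Qed.
Fact loc_addC : commutative loc_add.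
Proof.
move=> x y; have [a [s [hs ->]]] := fracP x; have [b [t [ht ->]]] := fracP y.
by rewrite !loc_addE; apply: frac_eq; ring.
Qed.
Fact loc_add0 : left_id loc_zero loc_add.
Proof.
move=> x; have [a [s [hs ->]]] := fracP x.
by rewrite loc_addE; apply: frac_eq; ring.
Qed.
Fact loc_addN : left_inverse loc_zero loc_opp loc_add.
Proof.
move=> x; have [a [s [hs ->]]] := fracP x.
by rewrite loc_oppE loc_addE; apply: frac_eq; ring.
Qed.

HB.instance Definition _ := GRing.isZmodule.Build localization
  loc_addA loc_addC loc_add0 loc_addN.

Fact loc_mulA : associative loc_mul.
Proof.
move=> x y z; have [a [s [hs ->]]] := fracP x.
have [b [t [ht ->]]] := fracP y; have [c [r [hr ->]]] := fracP z.
by rewrite !loc_mulE; apply: frac_eq; ring.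
Qed.
Fact loc_mulC : commutative loc_mul.
Proof.
move=> x y; have [a [s [hs ->]]] := fracP x; have [b [t [ht ->]]] := fracP y.
by rewrite !loc_mulE; apply: frac_eq; ring.
Qed.
Fact loc_mul1 : left_id loc_one loc_mul.
Proof.
move=> x; have [a [s [hs ->]]] := fracP x.
by rewrite loc_mulE; apply: frac_eq; ring.
Qed.
Fact loc_mulDl : left_distributive loc_mul loc_add.
Proof.
move=> x y z; have [a [s [hs ->]]] := fracP x.
have [b [t [ht ->]]] := fracP y; have [c [r [hr ->]]] := fracP z.
by rewrite (loc_addE a b) !loc_mulE loc_addE; apply: frac_eq; ring.
Qed.

HB.instance Definition _ := GRing.Zmodule_isComPzRing.Build localization
  loc_mulA loc_mulC loc_mul1 loc_mulDl.

End Localization.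

Section ZariskiTopology.
Variable A : comPzRingType.

(* The complements of the sets V(E) of primes containing E. *)
Definition zariski_open : set (set (spec A)) :=
  [set U | exists E : set A, U = [set p : spec A | ~ (E `<=` p)]].

Fact zariski_openT : zariski_open setT.
Proof.
exists setT; apply/seteqP; split=> // p _ /(_ 1 I).
by case: (spec_is_prime p).
Qed.

Fact zariski_openI : setI_closed zariski_open.
Proof.
move=> _ _ [E ->] [F ->]; exists [set z | exists x y, [/\ E x, F y & z = x * y]].
apply/seteqP; split=> p /=.
  move=> [/existsNP[x /not_implyP[Ex px]] /existsNP[y /not_implyP[Fy py]]] h.
  have [_ _ _ _ /(_ x y)] := spec_is_prime p.
  by case; [apply: h; exists x, y|exact: px|exact: py].
have [_ _ pM _ _] := spec_is_prime p.
move=> h; split=> hE; apply: h => _ [x [y [Ex Fy ->]]].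
  by rewrite mulrC; apply: pM; exact: hE.
by apply: pM; exact: hE.
Qed.

Fact zariski_open_bigU (I : Type) (f : I -> set (spec A)) :
  (forall i, zariski_open (f i)) -> zariski_open (\bigcup_i f i).
Proof.
move=> fo; exists [set x | exists i (E : set A),
  f i = [set p : spec A | ~ (E `<=` p)] /\ E x].
apply/seteqP; split=> p /=.
  move=> [i _]; have [E fE] := fo i; rewrite fE => pE h; apply: pE => x Ex.
  by apply: h; exists i, E.
move=> /existsNP[x /not_implyP[[i [E [fE Ex]]] px]].
by exists i => //; rewrite fE => /(_ x Ex).
Qed.

HB.instance Definition _ := isOpenTopological.Build (spec A)
  zariski_openT zariski_openI zariski_open_bigU.

End ZariskiTopology.

Section StructureSheaf.
Variable A : comPzRingType.
Implicit Types U V W : opens [the topologicalType of spec A].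

(* The product of the local rings A_q for q in U. *)
Definition spec_stalks U : Type :=
  prod_ring (fun q : set_type U => localization (set_val q)).
HB.instance Definition _ U := GRing.ComPzRing.on (spec_stalks U).

(* Locally on [U], the function [s] is given by a single fraction a / f. *)
Definition locally_fraction U (s : spec_stalks U) :=
  forall q : set_type U, exists V (a f : A), opens_set V (set_val q) /\
    forall r : set_type U, opens_set V (set_val r) ->
    exists h : denominators (set_val r) f, s r = frac a h.

Definition regular U : {pred spec_stalks U} :=
  fun s => `[< locally_fraction s >].

Fact regular_subring U : subring_closed (regular (U := U)).
Proof.
split.
- apply/asboolP => q; exists (opens_setT _), 1, 1; split=> // r _.
  by exists (@denominators1 _ _).
- move=> s t /asboolP hs /asboolP ht; apply/asboolP => q.
  have [V [a [f [Vq sE]]]] := hs q; have [W [b [g [Wq tE]]]] := ht q.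
  exists (opens_setI V W), (a * g + - b * f), (f * g); split=> // r [Vr Wr].
  have [hf sr] := sE r Vr; have [hg tr] := tE r Wr.
  exists (denominatorsM hf hg).
  transitivity (loc_add (s r) (loc_opp (t r))) => //.
  by rewrite sr tr loc_oppE loc_addE.
- move=> s t /asboolP hs /asboolP ht; apply/asboolP => q.
  have [V [a [f [Vq sE]]]] := hs q; have [W [b [g [Wq tE]]]] := ht q.
  exists (opens_setI V W), (a * b), (f * g); split=> // r [Vr Wr].
  have [hf sr] := sE r Vr; have [hg tr] := tE r Wr.
  exists (denominatorsM hf hg).
  transitivity (loc_mul (s r) (t r)) => //.
  by rewrite sr tr loc_mulE.
Qed.

Record spec_sec U := SpecSec {
  spec_sec_fun :> spec_stalks U;
  spec_sec_regular : spec_sec_fun \in regular (U := U)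
}.

HB.instance Definition _ U := [isSub for @spec_sec_fun U].
HB.instance Definition _ U := [Choice of spec_sec U by <:].
HB.instance Definition _ U := GRing.SubChoice_isSubComPzRing.Build
  (spec_stalks U) (regular (U := U)) (spec_sec U) (regular_subring U).

Definition incl U V (h : V `<=` U) (q : set_type V) : set_type U :=
  SigSub (mem_set (h _ (set_valP q))).

Fact spec_res_subproof U V (h : V `<=` U) (s : spec_sec U) :
  ((fun q => spec_sec_fun s (incl h q)) : spec_stalks V) \in regular (U := V).
Proof.
apply/asboolP => q; have /asboolP/(_ (incl h q)) := spec_sec_regular s.
by move=> [W [a [f [Wq sE]]]]; exists W, a, f; split=> // r Wr; exact: (sE (incl h r) Wr).
Qed.

Definition spec_res U V (h : V `<=` U) (s : spec_sec U) : spec_sec V :=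
  SpecSec (spec_res_subproof h s).

Fact spec_res_zmod U V (h : V `<=` U) : zmod_morphism (spec_res h).
Proof. by move=> s t; apply: val_inj. Qed.

Fact spec_res_monoid U V (h : V `<=` U) : monoid_morphism (spec_res h).
Proof. by split=> [|s t]; apply: val_inj. Qed.

HB.instance Definition _ U V (h : V `<=` U) :=
  GRing.isZmodMorphism.Build _ _ (spec_res h) (spec_res_zmod h).
HB.instance Definition _ U V (h : V `<=` U) :=
  GRing.isMonoidMorphism.Build _ _ (spec_res h) (spec_res_monoid h).

Let at_irr U (s : spec_sec U) (x : spec A) (h h' : x \in opens_set U) :
  spec_sec_fun s (SigSub h) = spec_sec_fun s (SigSub h').
Proof. by rewrite (bool_irrelevance h h'). Qed.

Let at_incl U V (s : spec_sec U) (h : V `<=` U) (x : spec A)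
    (hV : x \in opens_set V) (hU : x \in opens_set U) :
  spec_sec_fun s (incl h (SigSub hV)) = spec_sec_fun s (SigSub hU).
Proof. exact: at_irr. Qed.

Fact spec_is_sheaf : is_sheaf (fun U V h => @spec_res U V h).
Proof.
move=> U I W WU s cov compat.
have agree i j x (hi : x \in opens_set (W i)) (hj : x \in opens_set (W j)) :
    spec_sec_fun (s i) (SigSub hi) = spec_sec_fun (s j) (SigSub hj).
  pose O := opens_setI (W i) (W j).
  have Oi : O `<=` W i by exact: subIsetl.
  have Oj : O `<=` W j by exact: subIsetr.
  have hx : x \in opens_set O by apply/mem_set; split; exact: set_mem.
  have := compat i j O Oi Oj.
  move=> /(congr1 (fun t => spec_sec_fun t (SigSub hx))) /= e.
  exact (etrans (esym (at_incl (s i) Oi hx hi))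
    (etrans e (at_incl (s j) Oj hx hj))).
have ch (q : set_type U) : {i | set_val q \in opens_set (W i)}.
  apply: cid; have [i _ Wq] := cov _ (set_valP q).
  by exists i; exact: mem_set.
pose t : spec_stalks U := fun q => spec_sec_fun (s (sval (ch q)))
  (SigSub (svalP (ch q))).
have tE i x (hU : x \in opens_set U) (hi : x \in opens_set (W i)) :
  t (SigSub hU) = spec_sec_fun (s i) (SigSub hi) by exact: agree.
have treg : t \in regular (U := U).
  apply/asboolP => q; have /asboolP := spec_sec_regular (s (sval (ch q))).
  move=> /(_ (SigSub (svalP (ch q)))) [V [a [f [Vq sE]]]].
  exists (opens_setI V (W (sval (ch q)))), a, f; split.
    by split=> //; exact: set_mem (svalP (ch q)).
  move=> [r hr] [Vr Wr]; have [h e] := sE (SigSub (mem_set Wr)) Vr.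
  by exists h; rewrite (tE _ _ _ (mem_set Wr)).
exists (SpecSec treg); split=> [i|t' ht'].
  apply: val_inj; apply: functional_extensionality_dep => -[x hx] /=.
  exact: tE.
apply: val_inj; apply: functional_extensionality_dep => -[x hx] /=.
have [i _ Wx] := cov _ (set_mem hx).
rewrite (tE i x hx (mem_set Wx)) -ht' /=.
exact (at_incl t' (WU i) (mem_set Wx) hx).
Qed.

Fact spec_res_id U (h : U `<=` U) (s : spec_sec U) : spec_res h s = s.
Proof.
apply: val_inj; apply: functional_extensionality_dep => -[x hx].
exact (at_incl s h hx hx).
Qed.

Fact spec_res_comp U V W (VU : V `<=` U) (WV : W `<=` V) (WU : W `<=` U)
  (s : spec_sec U) : spec_res WV (spec_res VU s) = spec_res WU s.
Proof.
apply: val_inj; apply: functional_extensionality_dep => -[x hx].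
pose q : set_type W := SigSub hx.
exact (at_irr s (mem_set (VU _ (set_valP (incl WV q))))
  (mem_set (WU _ (set_valP q)))).
Qed.

Definition Spec_space : ringed_space := @RingedSpace (spec A)
  (fun U => spec_sec U : comPzRingType)
  (fun U V h => @spec_res U V h : {rmorphism _ -> _})
  spec_res_id spec_res_comp spec_is_sheaf.

End StructureSheaf.

Definition affine (X : ringed_space) :=
  exists (A : comPzRingType) (f : rs_mor (Spec_space A) X),
    maps_iso f (opens_setT _) (opens_setT X).

(* No condition on stalks is needed: they are local rings, because those of
   [Spec_space A] are. *)
Record scheme := Scheme {
  sch_space :> ringed_space;
  sch_locally_affine : forall x : sch_space,
    exists (A : comPzRingType) (f : rs_mor (Spec_space A) sch_space)
           (U : opens sch_space),
      opens_set U x /\ maps_iso f (opens_setT _) U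
}.

Record scheme_mor (X Y : scheme) := SchemeMor {
  sch_mor :> rs_mor X Y;
  sch_local : local_on_stalks sch_mor
}.

Definition local_isomorphism (Y X : scheme) (f : scheme_mor Y X) :=
  forall y : Y, exists (W : opens Y) (V : opens X),
    opens_set W y /\ maps_iso f W V.

(* Main.v *)
Require Import Defs.
From HB Require Import structures.
From mathcomp Require Import all_boot all_algebra generic_quotient finmap ring.
From mathcomp Require Import all_classical topology.

Set Implicit Arguments.
Unset Strict Implicit.
Unset Printing Implicit Defensive.

Import GRing.Theory.
Local Open Scope classical_set_scope.
Local Open Scope ring_scope.
Local Open Scope quotient_scope.

(** All five conditions are equivalent to one topological property of [X],
    [clopen_separation]: disjoint closed sets are separated by a clopen set. For
    a quasi-compact space it says that every open cover is refined by a finite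
    clopen partition ([clopen_labelling]), and each condition is compared with
    it separately.

    Cohomology. Over a clopen partition local lifts glue, since there are no
    overlaps; so global sections are exact and the cohomology of any injective
    resolution vanishes ([separation_exact_lift]). Injective resolutions are
    built from sheaves of functions with values in Q/Z, indexed by the
    characters of stalks ([coker_exact], [fun_sheaf_injective]). Conversely, two
    disjoint closed sets define a torsor under the sheaf of locally constant
    integral functions vanishing on both; it is trivial when [H^1] vanishes, and
    a trivialization is a locally constant function that separates the two sets
    ([separation_from_cohomology]).

    Local isomorphisms. Over a fine enough clopen partition local sections exist
    and glue ([sections_from_separation]). Conversely, the disjoint union of
    affine open sets, each missing one of the two closed sets, maps onto [X] by
    a local isomorphism, and a section of it cuts [X] into two clopen parts
    ([separation_from_sections]). The members of a clopen partition subordinate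
    to an affine cover are basic open sets of affine schemes, hence affine, and
    so is their finite disjoint union; this makes [X] affine
    ([affine_from_separation]).

    Components. By Zorn's lemma every point specializes to a closed point, and
    it suffices to find clopen neighbourhoods of closed points inside given open
    ones ([clopen_separation_from_closed_points]). In an affine scheme connected
    components are intersections of clopen sets; if they are local, a clopen set
    slightly larger than the component of a closed point works
    ([separation_from_local_components]). If the irreducible components are
    local, every point specializes to exactly one closed point, and preimages of
    clopen sets under this retraction onto the closed points are clopen
    ([separation_from_local_irreducibles], [chart_generizations]). Conversely, a
    connected or irreducible closed set cannot contain two closed points that a
    clopen set separates ([separation_local]).

    Idempotents. If [a] vanishes on one of two disjoint closed sets and [a - 1]
    on the other, and [a = e + u] with [e] idempotent and [u] a unit, then [e]
    separates the two sets ([separation_from_clean]). Conversely, a clopen set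
    separating the points where [r] is not a unit from those where [r - 1] is
    not one defines an idempotent [e] such that [r - e] is a unit
    ([clean_from_separation]). *)

(** * Specialization and closed points *)

Section Specialization.
Variable T : topologicalType.
Implicit Types (x y z m : T) (U Z : set T).

Lemma specialization_open x z U :
  closure [set x] z -> open U -> U z -> U x.
Proof.
move=> xz oU Uz; have [|y [/= -> //]] := xz U.
exact: open_nbhs_nbhs.
Qed.

Lemma specialization_closed x z Z :
  closure [set x] z -> closed Z -> Z x -> Z z.
Proof.
by move=> xz cZ Zx; apply: cZ; apply: closure_subset xz => _ ->.
Qed.

Lemma specialization_trans x y z :
  closure [set x] y -> closure [set y] z -> closure [set x] z.
Proof.
by move=> xy yz; apply: (specialization_closed yz) => //; exact: closed_closure.
Qed.

Lemma specialization_refl x : closure [set x] x.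
Proof. exact: subset_closure. Qed.

(** By quasi-compactness finitely many members of the chain cover [Z], and the
    largest of them does. *)
Lemma chain_cover (Z : set T) (F : set (set T)) :
  cover_compact Z -> Z !=set0 -> (forall U, F U -> open U) ->
  total_on F subset -> Z `<=` \bigcup_(U in F) U -> exists2 U, F U & Z `<=` U.
Proof.
move=> Zc [z Zz] oF totF ZF.
have [D DF ZD] := Zc _ F id oF ZF.
have {}DF U : U \in (D : seq _) -> F U by move=> /DF; exact: set_mem.
have {}ZD x : Z x -> exists2 U, U \in (D : seq _) & U x.
  by move=> /ZD[U /= UD Ux]; exists U.
suff [U FU UD] : exists2 U, F U & forall V, V \in (D : seq _) -> V `<=` U.
  by exists U => // x /ZD[V VD Vx]; exact: UD Vx.
have [U0 U0D _] := ZD z Zz.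
have {U0D} FU0 : F U0 by exact: DF.
elim: (D : seq _) DF {ZD} => [|V s IH] sF; first by exists U0.
have [U FU UD] : exists2 U, F U & forall V, V \in s -> V `<=` U.
  by apply: IH => W Ws; apply: sF; rewrite inE Ws orbT.
have FV : F V by apply: sF; rewrite inE eqxx.
have [UV|VU] := totF _ _ FU FV.
  by exists V => // W; rewrite inE => /predU1P[-> //|/UD WU];
    exact: subset_trans UV.
by exists U => // W; rewrite inE => /predU1P[-> //|/UD].
Qed.

Hypothesis T_qc : quasicompact T.

Lemma closed_cover_compact Z : closed Z -> cover_compact Z.
Proof.
move=> cZ I D f fo cov.
pose g (i : option I) : set T := if i is Some j then f j else ~` Z.
pose D' (i : option I) := if i is Some j then D j else True.
have [||s sD sg] := T_qc (D := D') (f := g).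
- by case=> [i /fo//|_]; exact: closed_openC.
- move=> x _; have [Zx|Zx] := pselect (Z x); last by exists None.
  by have [i Di fx] := cov x Zx; exists (Some i).
have inD i : i \in [fset j in pmap id (s : seq _)]%fset -> Some i \in s.
  by rewrite in_fset /= mem_pmap map_id.
exists [fset j in pmap id (s : seq _)]%fset.
  by move=> i /inD/sD/set_mem Di; exact: mem_set.
move=> x Zx; have [[i|] si gx] := sg x Logic.I => //; exists i => //=.
by rewrite in_fset /= mem_pmap map_id.
Qed.

Hypothesis T_kolmogorov : kolmogorov_space T.

(** A minimal nonempty closed subset, which exists by quasi-compactness, is a
    point in a Kolmogorov space. *)
Lemma closed_point_exists Z : closed Z -> Z !=set0 ->
  exists2 m, Z m & closed [set m].
Proof.
move=> cZ Z0.
have [|U [[oU ZU] Umax]] :=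
    @Zorn_bigcup _ [set U : set T | open U /\ ~ (Z `<=` U)].
  move=> F FP totF; split.
    by apply: bigcup_open => U /FP[].
  have Fo U : F U -> open U by move=> /FP[].
  move=> /(chain_cover (closed_cover_compact cZ) Z0 Fo totF)[U FU].
  by case: (FP U FU).
have Zmax V : open V -> U `<=` V -> (exists2 z, Z z & ~ V z) -> V `<=` U.
  move=> oV UV [z Zz Vz] x Vx; apply: contrapT => Ux; apply: (Umax V).
    by split=> // /(_ x Vx).
  by split=> // /(_ z Zz).
have /existsNP[m /not_implyP[Zm Um]] := ZU.
exists m => //.
have mE : [set m] = Z `\` U.
  apply/seteqP; split=> [_ -> //|x [Zx Ux]] /=.
  apply: contrapT => /eqP /T_kolmogorov[A xA].
  pose V := A°; have oV : open V by exact: open_interior.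
  have H : V x /\ ~ V m \/ V m /\ ~ V x.
    by case: xA => -[/set_mem VA /set_mem nA]; [left|right];
      split=> // /interior_subset.
  have oUV : open (U `|` V) by exact: openU.
  have UUV : U `<=` U `|` V by move=> ?; left.
  case: H => [[Vx Vm]|[Vm Vx]]; [apply: Ux|apply: Um].
    by apply: (Zmax _ oUV UUV); [exists m => // -[]|right].
  by apply: (Zmax _ oUV UUV); [exists x => // -[]|right].
rewrite mE setDE; apply: closedI => //; exact: open_closedC.
Qed.

Lemma closed_specialization x : exists2 m, closure [set x] m & closed [set m].
Proof.
apply: closed_point_exists; first exact: closed_closure.
by exists x; exact: specialization_refl.
Qed.

(** Closed points of a closed subspace are closed in the whole space, and
    quasi-compactness is inherited. *)
Lemma local_subspaceP Z : closed Z -> local_space (set_type Z) <->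
  exists m, [/\ Z m, closed [set m] &
    forall m', Z m' -> closed [set m'] -> m' = m].
Proof.
move=> cZ.
have closedE (m : set_type Z) : closed [set m] <-> closed [set set_val m].
  split=> [|cm]; last first.
    have -> : [set m] = set_val @^-1` [set set_val m].
      by apply/seteqP; split=> [_ -> //|x /= /val_inj].
    by rewrite -openC; exists (~` [set set_val m]) => //; exact: closed_openC.
  move=> /closed_openC[O oO Oe].
  have -> : [set set_val m] = Z `\` O.
    apply/seteqP; split=> [_ ->|x [Zx Ox]] /=.
      split; first exact: set_valP.
      move=> Om; have : (~` [set m]) m by rewrite -Oe.
      exact.
    apply: contrapT => xm.
    have : (~` [set m]) (SigSub (mem_set Zx)).
      by move=> /= e; apply: xm; rewrite -e.
    by rewrite -Oe => /Ox.
  by rewrite setDE; apply: closedI => //; exact: open_closedC.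
split=> [[_ [m [cm um]]]|[m [Zm cm um]]].
  exists (set_val m); split; [exact: set_valP|exact/closedE|].
  move=> m' Zm' cm'; have : closed [set SigSub (mem_set Zm') : set_type Z].
    exact/closedE.
  by move=> /um ->.
split.
  move=> I D f fo cov.
  have fO i : exists O, D i -> open O /\ set_val @^-1` O = f i.
    have [/fo[O oO Oe]|nD] := pselect (D i); last by exists set0.
    by exists O.
  have [g gP] := choice fO.
  have [||s sD sg] := closed_cover_compact cZ (I := I) (D := D) (f := g).
  - by move=> i /gP[].
  - move=> x Zx; have [//|i Di] := cov (SigSub (mem_set Zx)).
    have [_ <-] := gP i Di; by exists i.
  - exists s => // x _; have [i si gi] := sg _ (set_valP x).
    have Di : D i by have := sD i si; move/set_mem.
    by exists i => //; have [_ <-] := gP i Di.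
exists (SigSub (mem_set Zm)); split; first exact/closedE.
move=> m' /closedE cm'; apply: val_inj => /=.
exact/esym/(um (set_val m') (set_valP m') cm').
Qed.

(** [x] can be added to every member of a chain of irreducible sets, so that
    the empty chain needs no special treatment. *)
Lemma irreducible_component_exists x :
  exists2 C, irreducible_component C & C x.
Proof.
have [|C [irrC Cmax]] :=
    @Zorn_bigcup _ [set A : set T | irreducible (A `|` [set x])].
  move=> F Firr totF; split; first by exists x; right.
  move=> Z1 Z2 cZ1 cZ2 FZ; apply: contrapT => /not_orP[].
  move=> /existsNP[a /not_implyP[Fa Z1a]] /existsNP[b /not_implyP[Fb Z2b]].
  have sub A : F A -> A `|` [set x] `<=` Z1 `|` Z2.
    move=> FA y Ay; apply: FZ; case: Ay => [Ay|->]; last by right.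
    by left; exists A.
  have key A : F A -> (A `|` [set x]) a -> (A `|` [set x]) b -> False.
    move=> FA Aa Ab; have [_ /(_ _ _ cZ1 cZ2 (sub A FA))] := Firr A FA.
    by case=> h; [apply: Z1a; exact: h|apply: Z2b; exact: h].
  case: Fa Fb => [[A FA Aa]|xa] [[B FB Bb]|xb].
  - have [AB|BA] := totF _ _ FA FB.
      by apply: (key B FB); left; [exact: AB|].
    by apply: (key A FA); left; [|exact: BA].
  - by apply: (key A FA); [left|right].
  - by apply: (key B FB); [right|left].
  - have : (Z1 `|` Z2) x by apply: FZ; right.
    by case; [rewrite -xa|rewrite -xb].
have CE : C `|` [set x] = C.
  apply: contrapT => CN; apply: (Cmax (C `|` [set x])); last first.
    by rewrite /= -setUA setUid.
  by split=> [? ?|h]; [left|apply: CN; apply/seteqP; split=> // ? ?; left].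
exists C; last by rewrite -CE; right.
split; first by rewrite /= CE in irrC.
move=> B irrB CB; apply: contrapT => BC; apply: (Cmax B).
  by split=> // BC'; apply: BC; apply/seteqP.
rewrite /=; have -> // : B `|` [set x] = B.
apply/seteqP; split=> [y [//|->]|? ?]; last by left.
by apply: CB; rewrite -CE; right.
Qed.

Lemma irreducible_component_closed (C : set T) :
  irreducible_component C -> closed C.
Proof.
move=> [[C0 irrC] Cmax]; apply/closure_id; apply: esym.
apply: Cmax; last exact: subset_closure.
split; first by case: C0 => x Cx; exists x; exact: subset_closure.
move=> Z1 Z2 cZ1 cZ2 CZ.
have [|/closureS h|/closureS h] := irrC Z1 Z2 cZ1 cZ2.
- by apply: subset_trans CZ; exact: subset_closure.
- by left; move: h; rewrite -((closure_id Z1).1 cZ1).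
- by right; move: h; rewrite -((closure_id Z2).1 cZ2).
Qed.

End Specialization.

(** * Separation by clopen sets *)

Definition clopen_separation (T : topologicalType) :=
  forall A B : set T, closed A -> closed B -> A `&` B = set0 ->
  exists W, [/\ clopen W, A `<=` W & W `&` B = set0].

Section ClopenSeparation.
Variable T : topologicalType.
Implicit Types (x y z m : T) (U W Z : set T).

(** Induction on the number of members: what the first open set misses and
    what the others miss are disjoint closed sets. *)
Lemma clopen_labelling_seq (I : choiceType) (i0 : I) (U : I -> set T)
    (s : seq I) (Y : set T) :
  clopen_separation T -> (forall i, open (U i)) -> clopen Y ->
  Y `<=` [set x | exists2 i, i \in s & U i x] ->
  exists c : T -> I, (forall i, open (c @^-1` [set i])) /\
    forall x, Y x -> c x \in s /\ U (c x) x.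
Proof.
move=> sepT oU; elim: s Y => [|i s IH] Y cY YU.
  exists (fun=> i0); split=> [i|x /YU[]//].
  rewrite preimage_cst; case: ifP => _; [exact: openT|exact: open0].
pose V := [set x | exists2 i, i \in s & U i x].
have oV : open V.
  have -> : V = \bigcup_(j in [set j | j \in s]) U j by [].
  exact: bigcup_open.
have [||| W [[oW cW] AW WB]] := sepT (Y `\` U i) (Y `\` V).
- by rewrite setDE; apply: closedI; [case: cY|exact: open_closedC].
- by rewrite setDE; apply: closedI; [case: cY|exact: open_closedC].
- apply/seteqP; split=> // x [[Yx Ux] [_ Vx]].
  have [j] := YU x Yx; rewrite inE => /predU1P[-> //|js Uj].
  by apply: Vx; exists j.
have [||c [oc cP]] := IH (Y `&` W).
- exact: clopenI.
- move=> x [Yx Wx]; apply: contrapT => Vx.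
  by have : (W `&` (Y `\` V)) x by []; rewrite WB.
exists (fun x => if pselect (W x) then c x else i); split=> [j|x Yx].
  have -> : (fun x => if pselect (W x) then c x else i) @^-1` [set j] =
      (W `&` c @^-1` [set j]) `|` (~` W `&` (fun=> i) @^-1` [set j]).
    by apply/seteqP; split=> x /=; case: pselect => Wx;
      intuition.
  apply: openU; apply: openI => //; first exact: closed_openC.
  rewrite preimage_cst; case: ifP => _; [exact: openT|exact: open0].
case: pselect => Wx.
  by have [//|cs Ucx] := cP x; split=> //; rewrite inE cs orbT.
split; first by rewrite inE eqxx.
by apply: contrapT => Ux; apply/Wx/AW.
Qed.

Lemma clopen_labelling (I : choiceType) (U : I -> set T) :
  quasicompact T -> clopen_separation T -> (forall i, open (U i)) ->
  (forall x, exists i, U i x) ->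
  exists (s : seq I) (c : T -> I), (forall i, open (c @^-1` [set i])) /\
    forall x, c x \in s /\ U (c x) x.
Proof.
move=> T_qc sepT oU cov.
have [[x]|T0] := pselect (inhabited T); last first.
  exists [::], (fun x => False_rect _ (T0 (inhabits x))); split=> [i|x].
    by rewrite openE => x; case: T0.
  by case: T0.
have [i0 _] := cov x.
have [i _//||s _ sU] := T_qc _ setT U.
  by move=> y _; have [i] := cov y; exists i.
have [|c [oc cP]] := clopen_labelling_seq i0 (s := s) sepT oU (@clopenT T).
  by move=> y _; have [i] := sU y Logic.I; exists i.
by exists s, c; split=> // y; exact: cP.
Qed.

Definition clopen_basis_at_closed_points := forall m U,
  closed [set m] -> open U -> U m -> exists W, [/\ clopen W, W m & W `<=` U].

Hypotheses (T_qc : quasicompact T) (T_kolmogorov : kolmogorov_space T).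

(** Clopen neighbourhoods of closed points that miss one of the two closed sets
    cover the space, because every point specializes to a closed one. *)
Lemma clopen_separation_from_closed_points :
  clopen_basis_at_closed_points -> clopen_separation T.
Proof.
move=> basT A B cA cB AB.
have /choice[N NP] m : exists W, closed [set m] ->
    [/\ clopen W, W m & W `&` A = set0 \/ W `&` B = set0].
  have [cm|ncm] := pselect (closed [set m]); last by exists set0.
  have [Am|Am] := pselect (A m).
    have Bm : ~ B m by move=> Bm; have : (A `&` B) m by []; rewrite AB.
    have [W [cW Wm WB]] := basT m (~` B) cm (closed_openC cB) Bm.
    exists W => _; split=> //; right; exact/disjoints_subset.
  have [W [cW Wm WA]] := basT m (~` A) cm (closed_openC cA) Am.
  exists W => _; split=> //; left; exact/disjoints_subset.
have [||s sD sN] := T_qc (D := [set m | closed [set m]]) (f := N).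
- by move=> m /= /NP[[]].
- move=> x _; have [m xm cm] := closed_specialization T_qc T_kolmogorov x.
  have [[oN _] Nm _] := NP m cm.
  by exists m => //; exact: specialization_open xm oN Nm.
have sP m : m \in s -> clopen (N m).
  by move=> /sD/set_mem /NP[].
pose W := \bigcup_(m in [set m | m \in s /\ N m `&` B = set0]) N m.
exists W; split.
- split; first by apply: bigcup_open => m [/sP[]].
  apply: closed_bigcup => [|m [/sP[]//]].
  by apply: sub_finite_set (finite_fset s) => m [].
- move=> x Ax; have [m /= sm Nx] := sN x Logic.I; exists m => //; split=> //.
  have [_ _ []//] := NP m (set_mem (sD m sm)).
  by move=> NA; have : (N m `&` A) x by []; rewrite NA.
- apply/disjoints_subset => x [m [_ NB] Nx] Bx.
  by have : (N m `&` B) x by []; rewrite NB.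
Qed.

Lemma clopen_basis_from_separation :
  clopen_separation T -> clopen_basis_at_closed_points.
Proof.
move=> sepT m U cm oU Um.
have [|W [cW mW WU]] := sepT _ _ cm (open_closedC oU).
  by apply/disjoints_subset => _ ->; rewrite setCK.
exists W; split=> //; first exact: mW.
by move/disjoints_subset: WU; rewrite setCK.
Qed.

(** Two closed points in [C] would be separated by a clopen set, which cannot
    cut [C]. *)
Lemma separation_local (C : set T) : clopen_separation T -> closed C ->
  C !=set0 ->
  (forall W, clopen W -> C `<=` W \/ C `<=` ~` W) -> local_space (set_type C).
Proof.
move=> sepT cC C0 Cc; apply/(local_subspaceP T_qc cC).
have [m Cm cm] := closed_point_exists T_qc T_kolmogorov cC C0.
exists m; split=> // m' Cm' cm'; apply: contrapT => mm'.
have [W [cW Wm Wm']] := clopen_basis_from_separation sepT cm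
  (closed_openC cm') (fun e => mm' (esym e)).
by case: (Cc W cW) => h; [apply: (Wm' _ (h _ Cm'))|apply: (h _ Cm)].
Qed.

Lemma separation_local_component x :
  clopen_separation T -> local_space (set_type (connected_component setT x)).
Proof.
move=> sepT; apply: separation_local => //.
- exact: component_closed.
- by exists x; exact: connected_component_refl.
move=> W cW; have [/disjoints_subset h|/set0P[y [Cy Wy]]] :=
  eqVneq (connected_component setT x `&` W) set0; first by right.
left; suff <- : connected_component setT x `&` W = connected_component setT x.
  exact: subIsetr.
apply: component_connected; first by exists y.
  by exists W => //; case: cW.
by exists W => //; case: cW.
Qed.

Lemma separation_local_irreducible (C : set T) :
  clopen_separation T -> irreducible_component C -> local_space (set_type C).
Proof.
move=> sepT irrC; have [[C0 Ci] _] := irrC.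
apply: separation_local => //; first exact: irreducible_component_closed.
move=> W cW; apply: Ci; [by case: cW|by case: (clopenC W cW)|].
by rewrite setUCr.
Qed.

Lemma separation_zero_dimensional :
  clopen_separation T -> at_most_zero_dimensional (set_type (closed_points T)).
Proof.
move=> sepT; pose v : set_type (closed_points T) -> T := set_val.
exists [set v @^-1` W | W in clopen].
  split; first by move=> _ [W [oW _] <-]; exists W.
  move=> m U; rewrite /= nbhsE => -[O [[V oV <-] Vm] OU].
  have cm : closed [set v m] := set_valP m.
  have [W [cW Wm WV]] := clopen_basis_from_separation sepT cm oV Vm.
  exists (v @^-1` W); first by split=> //; exists W.
  by apply: subset_trans OU => y /WV.
move=> _ [W [oW cW] <-]; split; first by exists W.
by rewrite -openC; exists (~` W) => //; exact: closed_openC.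
Qed.

(** * Connected components *)

(** By quasi-compactness finitely many clopen neighbourhoods suffice, and their
    intersection is clopen. *)
Lemma quasicomponent_compact (m : T) (C : set T) : cover_compact C ->
  \bigcap_(W in [set W | clopen W /\ W m]) W `&` C = set0 ->
  exists W, [/\ clopen W, W m & W `&` C = set0].
Proof.
move=> Cc QC.
have [W [[_ cW] _]||s sD sC] := Cc _ [set W | clopen W /\ W m] setC.
- exact: closed_openC.
- move=> x Cx; apply: contrapT => xs.
  suff : (\bigcap_(W in [set W | clopen W /\ W m]) W `&` C) x by rewrite QC.
  split=> // W Wm; apply: contrapT => Wx; apply: xs; by exists W.
exists (\bigcap_(W in [set W | W \in s]) W); split.
- split; last first.
    by apply: closed_bigI => W /= /sD/set_mem[[]].
  rewrite -closedC setC_bigcap; apply: closed_bigcup; first exact: finite_fset.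
  by move=> W /= /sD/set_mem[[oW _] _]; exact: open_closedC.
- by move=> W /sD/set_mem[].
apply/disjoints_subset => x sx /sC[W sW]; apply.
exact: sx.
Qed.

(** The intersection [Q] of the clopen neighbourhoods of a closed point [m] is
    connected: a splitting of [Q] into two closed sets thickens, by the first
    hypothesis and quasi-compactness, to a splitting of a clopen neighbourhood.
    So [Q] lies in the component of [m], which lies in every neighbourhood of
    its only closed point [m]. *)
Lemma separation_from_local_components :
  (forall F G : set T, closed F -> closed G -> F `&` G = set0 ->
     exists F' G', [/\ closed F', closed G', F' `&` G' = set0,
       F `<=` F' /\ G `<=` G' & cover_compact (~` (F' `|` G'))]) ->
  (forall x, local_space (set_type (connected_component [set: T] x))) ->
  clopen_separation T.
Proof.
move=> fatten locT; apply: clopen_separation_from_closed_points => m U cm oU Um.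
pose Q := \bigcap_(W in [set W | clopen W /\ W m]) W.
have cQ : closed Q by apply: closed_bigI => W [[]].
have Qm : Q m by move=> W [].
have splitQ F G : closed F -> closed G -> F `&` G = set0 -> Q `<=` F `|` G ->
    F m -> Q `<=` F.
  move=> cF cG FG QFG Fm.
  have [F' [G' [cF' cG' FG' [FF' GG'] cp]]] := fatten F G cF cG FG.
  have [|D [[oD cD] Dm DC]] := quasicomponent_compact (m := m) cp.
    by apply/disjoints_subset; rewrite setCK => x /QFG[/FF'|/GG']; [left|right].
  move/disjoints_subset: DC; rewrite setCK => DFG.
  have DE : D `&` F' = D `\` G'.
    apply/seteqP; split=> x [Dx h]; split=> //.
      by move=> Gx; have : (F' `&` G') x by []; rewrite FG'.
    by have [] := DFG x Dx.
  have cN : clopen (D `&` F').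
    split; last exact: closedI.
    by rewrite DE setDE; apply: openI => //; exact: closed_openC.
  have QN : Q `<=` D `&` F' by move=> x Qx; apply: Qx; split=> //; split=> //;
    exact: FF'.
  move=> x Qx; have [//|/GG' Gx] := QFG x Qx.
  by have [_ Fx] := QN x Qx; have : (F' `&` G') x by []; rewrite FG'.
have Qc : connected Q.
  move=> B [b Bb] [O oO BO] [F cF BF].
  have cB : closed B by rewrite BF; exact: closedI.
  have cB' : closed (Q `\` O) by rewrite setDE; apply: closedI => //;
    exact: open_closedC.
  have BB' : B `&` (Q `\` O) = set0.
    by rewrite BO; apply/disjoints_subset => x [_ Ox] [].
  have QB : Q `<=` B `|` (Q `\` O).
    by move=> x Qx; rewrite BO; have [Ox|Ox] := pselect (O x); [left|right].
  have [Bm|B'm] := QB m Qm.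
    apply/seteqP; split; last exact: (splitQ _ _ cB cB' BB' QB Bm).
    by rewrite BF => x [].
  have h : Q `<=` Q `\` O.
    by apply: (splitQ _ B) => //; [rewrite setIC|rewrite setUC].
  have Qb : Q b by move: Bb; rewrite BF => -[].
  have [_ Ob] := h b Qb; by move: Bb; rewrite BO => -[_ /Ob].
have cK : closed (connected_component setT m) by exact: component_closed.
have QU : Q `<=` U.
  move=> x Qx; have Kx : connected_component setT m x by exists Q.
  have [k [Kk ck uk]] := (local_subspaceP T_qc cK).1 (locT m).
  have [l xl cl] := closed_specialization T_qc T_kolmogorov x.
  apply: (specialization_open xl oU).
  rewrite (uk l) //; last exact: specialization_closed xl cK Kx.
  by rewrite -(uk m) //; exact: connected_component_refl.
have [||W [cW Wm WU]] := @quasicomponent_compact m (~` U).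
- exact (closed_cover_compact T_qc (open_closedC oU)).
- by apply/disjoints_subset; rewrite setCK.
by exists W; split=> //; move/disjoints_subset: WU; rewrite setCK.
Qed.

(** * Irreducible components *)

Definition generizations (Z : set T) : set T :=
  [set x | exists2 z, Z z & closure [set x] z].

(** Sending a point to the unique closed point that it specializes to is a
    continuous retraction onto the closed points; the proof shows directly that
    the preimage of a clopen set is clopen. *)
Lemma separation_from_local_irreducibles :
  (forall (Z : set T) y, closed Z -> closure (generizations Z) y ->
     exists2 x, generizations Z x & closure [set x] y) ->
  (forall C : set T, irreducible_component C -> local_space (set_type C)) ->
  at_most_zero_dimensional (set_type (closed_points T)) ->
  clopen_separation T.
Proof.
move=> genP locT [bas [_ basP] basC].
have cspec := closed_specialization T_qc T_kolmogorov.
have uniq_closed x k l : closure [set x] k -> closed [set k] ->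
    closure [set x] l -> closed [set l] -> k = l.
  move=> xk ck xl cl; have [C irrC Cx] := irreducible_component_exists x.
  have cC := irreducible_component_closed irrC.
  have [m [_ _ um]] := (local_subspaceP T_qc cC).1 (locT C irrC).
  have Ck : C k by exact: specialization_closed xk cC Cx.
  have Cl : C l by exact: specialization_closed xl cC Cx.
  by rewrite (um k Ck ck) (um l Cl cl).
have gen_closed Z : closed Z -> forall x, generizations Z x ->
    exists m, [/\ Z m, closed [set m] & closure [set x] m].
  move=> cZ x [z Zz xz]; have [m zm cm] := cspec z.
  exists m; split=> //; first exact: specialization_closed zm cZ Zz.
  exact: specialization_trans xz zm.
have closed_gen Z : closed Z -> closed (generizations Z).
  move=> cZ y /(genP Z y cZ)[x /(gen_closed Z cZ)[m [Zm cm xm]] xy].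
  have [l yl cl] := cspec y; exists l => //.
  by rewrite (uniq_closed x l m) //; exact: specialization_trans xy yl.
apply: clopen_separation_from_closed_points => m U cm oU Um.
pose v : set_type (closed_points T) -> T := set_val.
pose m' : set_type (closed_points T) :=
  SigSub (mem_set (cm : closed_points T m)).
have : nbhs m' (v @^-1` U).
  by apply: open_nbhs_nbhs; split=> //; exists U.
move=> /(basP m')[S [basS Sm] SU].
have [[O oO SO] /closed_openC[O' oO' SO']] := basC S basS.
have clP k (ck : closed [set k]) : (O k <-> ~ O' k) /\ (O k -> U k).
  pose k' : set_type (closed_points T) :=
    SigSub (mem_set (ck : closed_points T k)).
  have Ok : O k = S k' by rewrite -SO.
  have Ok' : O' k = (~` S) k' by rewrite -SO'.
  rewrite Ok Ok'; split=> [|/SU//]; split=> [? []//|]; exact: contrapT.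
have cgO := closed_gen _ (open_closedC oO).
have cgO' := closed_gen _ (open_closedC oO').
have gE : generizations (~` O') = ~` generizations (~` O).
  apply/seteqP; split=> x.
    move=> /(gen_closed _ (open_closedC oO'))[k [O'k ck xk]].
    move=> /(gen_closed _ (open_closedC oO))[l [Ol cl xl]].
    by apply: Ol; rewrite -(uniq_closed x k l) //; apply/(clP k ck).1.
  move=> gx; have [k xk ck] := cspec x; exists k => //.
  apply/(clP k ck).1; apply: contrapT => Ok; apply: gx; by exists k.
exists (generizations (~` O')); split.
- by split=> //; rewrite gE; exact: closed_openC.
- exists m; last exact: specialization_refl.
  by apply/(clP m cm).1; rewrite -[O m]/((v @^-1` O) m') SO.
- move=> x /(gen_closed _ (open_closedC oO'))[k [O'k ck xk]].
  apply: (specialization_open xk oU).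
  by apply: (clP k ck).2; apply/(clP k ck).1.
Qed.

End ClopenSeparation.

(** * Prime ideals *)

Identity Coercion set_to_fun : set >-> Funclass.

Section Primes.
Variable A : comPzRingType.
Implicit Types (p q : spec A) (a b : A).

Lemma spec_inj p q : p = q :> set A -> p = q.
Proof.
case: p q => [p hp] [q hq] /= e; move: hp hq; rewrite e => hp hq.
by rewrite (Prop_irrelevance hp hq).
Qed.

Lemma prime0 p : p 0. Proof. by case: (spec_is_prime p). Qed.
Lemma primeD p a b : p a -> p b -> p (a + b).
Proof. by case: (spec_is_prime p) => _ h _ _ _; exact: h. Qed.
Lemma primeMr p a b : p b -> p (a * b).
Proof. by case: (spec_is_prime p) => _ _ h _ _; exact: h. Qed.
Lemma primeMl p a b : p a -> p (a * b).
Proof. by rewrite mulrC; exact: primeMr. Qed.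
Lemma primeN p a : p a -> p (- a).
Proof. by rewrite -mulN1r; exact: primeMr. Qed.
Lemma primeB p a b : p a -> p b -> p (a - b).
Proof. by move=> pa pb; apply: primeD => //; exact: primeN. Qed.
Lemma prime1 p : ~ p 1. Proof. by case: (spec_is_prime p). Qed.
Lemma primeM p a b : p (a * b) -> p a \/ p b.
Proof. by case: (spec_is_prime p) => _ _ _ _; apply. Qed.
Lemma primeX p a n : p (a ^+ n) -> p a.
Proof.
elim: n => [|n IH]; first by rewrite expr0 => /prime1.
by rewrite exprS => /primeM[].
Qed.

Definition is_ideal (I : set A) :=
  [/\ I 0, forall a b, I a -> I b -> I (a + b) & forall a b, I b -> I (a * b)].

(** An ideal maximal among those that contain [I] and avoid [M] is prime. As in
    the case of irreducible sets, [I] is added to every member of a chain, which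
    takes care of the empty chain. *)
Lemma prime_avoiding (I M : set A) : is_ideal I ->
  M 1 -> (forall a b, M a -> M b -> M (a * b)) -> I `&` M = set0 ->
  exists2 p : spec A, I `<=` p & p `&` M = set0.
Proof.
move=> idI M1 MM IM.
have [|J [[idJ JM] Jmax]] := @Zorn_bigcup _ [set J : set A |
    is_ideal (I `|` J) /\ (I `|` J) `&` M = set0].
  move=> F FP totF; have [I0 ID IMl] := idI.
  have subF J : F J -> I `|` J `<=` I `|` \bigcup_(K in F) K.
    by move=> FJ x [|]; [left|right; exists J].
  split; [split|].
  - by left.
  - have addF J K a b : F J -> F K -> J a -> K b -> (I `|` \bigcup_(K in F) K)
    (a + b).
      move=> FJ FK Ja Kb; have [JK|KJ] := totF _ _ FJ FK.
        have [[_ add _] _] := FP K FK; apply: (subF K FK); apply: add;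
          right=> //.
        exact: JK.
      have [[_ add _] _] := FP J FJ; apply: (subF J FJ); apply: add; right=> //.
      exact: KJ.
    move=> a b [Ia|[J FJ Ja]] [Ib|[K FK Kb]].
    + by left; exact: ID.
    + have [[_ add _] _] := FP K FK; apply: (subF K FK); apply: add;
      [by left|by right].
    + have [[_ add _] _] := FP J FJ; apply: (subF J FJ); apply: add;
      [by right|by left].
    + exact: addF FJ FK Ja Kb.
  - move=> a b [Ib|[J FJ Jb]]; first by left; exact: IMl.
    by have [[_ _ mul] _] := FP J FJ; apply: (subF J FJ); apply: mul; right.
  - apply/disjoints_subset => x [Ix|[J FJ Jx]] Mx.
      by have : (I `&` M) x by []; rewrite IM.
    have [_ JM] := FP J FJ.
    have : ((I `|` J) `&` M) x by split=> //; right.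
    by rewrite JM.
pose P := I `|` J; have [P0 PD PMl] := idJ.
(* Otherwise [P] and [x] would generate a larger ideal avoiding [M]. *)
have meetM x : ~ P x -> exists a b, P a /\ M (a + b * x).
  move=> Px; apply: contrapT => nM.
  pose K : set A := [set y | exists a b, P a /\ y = a + b * x].
  have PK : P `<=` K by move=> y Py; exists y, 0; split=> //; ring.
  have IK : I `|` K = K by apply/seteqP; split=> [y []//|y]; [move=> Iy;
    apply: PK; left|right].
  apply: (Jmax K).
    split; first by move=> y Jy; apply: PK; right.
    move=> KJ; apply: Px; right; apply: KJ; exists 0, 1; split=> //; ring.
  rewrite /= IK; split; [split|].
  - exact: PK.
  - move=> _ _ [a [b [Pa ->]]] [a' [b' [Pa' ->]]]; exists (a + a'), (b + b').
    by split; [exact: PD|ring].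
  - move=> c _ [a [b [Pa ->]]]; exists (c * a), (c * b).
    by split; [exact: PMl|ring].
  - apply/disjoints_subset => _ [a [b [Pa ->]]] Mab; apply: nM; by exists a, b.
have prP : is_prime P.
  split=> //.
    by move=> P1; have : ((I `|` J) `&` M) 1 by []; rewrite JM.
  move=> x y Pxy; apply: contrapT => /not_orP[/meetM[a [b [Pa Ma]]]].
  move=> /meetM[c [d [Pc Mc]]].
  have : ((I `|` J) `&` M) ((a + b * x) * (c + d * y)).
    split; last exact: MM.
    have -> : (a + b * x) * (c + d * y) =
      c * a + ((d * y) * a + ((b * x) * c + (b * d) * (x * y))) by ring.
    by apply: (PD); [|apply: (PD); [|apply: (PD)]]; exact: PMl.
  by rewrite JM.
by exists (Spec prP) => // x; left.
Qed.

Lemma prime_containing (I : set A) : is_ideal I -> ~ I 1 ->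
  exists p : spec A, I `<=` p.
Proof.
move=> idI I1; have [|||p Ip _] := @prime_avoiding I [set 1] idI => //.
- by move=> _ _ -> ->; rewrite mulr1.
- by apply/disjoints_subset => x Ix; apply: contra_not I1 => <-.
by exists p.
Qed.

End Primes.

(** * Spaces homeomorphic to a spectrum *)

(** Charts, rather than spectra themselves, are used below so that the results
    apply to the underlying space of any scheme isomorphic to a spectrum. *)
Record spectral_chart (T : topologicalType) (A : comPzRingType) :=
  SpectralChart {
  chart :> T -> spec A;
  chart_inj : injective chart;
  chart_surj : forall p, exists x, chart x = p;
  chart_closedP : forall Z : set T,
    closed Z <-> exists E : set A, Z = [set x | E `<=` chart x]
}.

Section Chart.
Variables (T : topologicalType) (A : comPzRingType) (rho : spectral_chart T A).
Implicit Types (x y z : T) (Z : set T).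

Definition vanishing_ideal Z : set A := [set a | forall z, Z z -> rho z a].

Lemma vanishing_ideal_ideal Z : is_ideal (vanishing_ideal Z).
Proof.
split=> [z _|a b Za Zb z Zz|a b Zb z Zz]; first exact: prime0.
  by apply: primeD; [exact: Za|exact: Zb].
by apply: primeMr; exact: Zb.
Qed.

Lemma closure_chartP Z y :
  closure Z y <-> forall a, vanishing_ideal Z a -> rho y a.
Proof.
split=> [clZ a Za|h].
  have cV : closed [set x | [set a] `<=` rho x].
    by apply/(chart_closedP rho); exists [set a].
  have ZV : Z `<=` [set x | [set a] `<=` rho x].
    by move=> x Zx _ ->; exact: Za.
  by have := cV _ (closure_subset ZV clZ); apply.
have /(chart_closedP rho)[E clE] := @closed_closure _ Z.
rewrite clE => a Ea; apply: h => z Zz.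
have : closure Z z by exact: subset_closure.
by rewrite clE; apply.
Qed.

Lemma closed_chartP Z y : closed Z ->
  Z y <-> forall a, vanishing_ideal Z a -> rho y a.
Proof. by move=> cZ; rewrite -closure_chartP -((closure_id Z).1 cZ). Qed.

Lemma specialization_chartP x y : closure [set x] y <-> rho x `<=` rho y.
Proof.
split=> [/closure_chartP h a xa|xy]; first by apply: h => _ ->.
by apply/closure_chartP => a h; apply/xy/h.
Qed.

Lemma basic_closed a : closed [set x | rho x a].
Proof.
apply/(chart_closedP rho); exists [set a]; apply/seteqP.
by split=> [x xa _ -> //|x]; apply.
Qed.

Lemma basic_open a : open (~` [set x | rho x a]).
Proof. exact/closed_openC/basic_closed. Qed.

(** The functions that vanish outside a finite union of members of the cover form
    an ideal. If it contained no power of [f], some prime containing it but no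
    power of [f] would be an uncovered point where [f] does not vanish. *)
Lemma basic_open_compact f : cover_compact (~` [set x | rho x f]).
Proof.
move=> I D U oU cov.
pose J : set A := [set a | exists2 s : {fset I}, {subset s <= D} &
  forall x, (forall i, i \in s -> ~ U i x) -> rho x a].
have idJ : is_ideal J.
  split.
  - by exists fset0 => // x _; exact: prime0.
  - move=> a b [s sD sa] [t tD tb]; exists (s `|` t)%fset.
      by move=> i; rewrite in_fsetU => /orP[/sD|/tD].
    move=> x h; apply: primeD; [apply: sa|apply: tb] => i si;
      by apply: h; rewrite in_fsetU si ?orbT.
  - by move=> a b [s sD sb]; exists s => // x /sb; exact: primeMr.
have [[n [s sD sf]]|nf] := pselect (exists n, J (f ^+ n)).
  exists s => // x fx; apply: contrapT => ns; apply/fx/primeX/sf => i si Ux.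
  by apply: ns; exists i.
have [||| p Jp pf] := @prime_avoiding _ J [set f ^+ n | n in setT] idJ.
- by exists 0%N; rewrite // expr0.
- by move=> _ _ [n _ <-] [m _ <-]; exists (n + m)%N; rewrite // exprD.
- by apply/disjoints_subset => c Jc [n _ an]; apply: nf; exists n; rewrite an.
have [x xp] := chart_surj rho p.
have [|i Di Uix] := cov x.
  move=> xf; have : (p `&` [set f ^+ n | n in setT]) f.
    by split; [rewrite -xp|exists 1%N; rewrite // expr1].
  by rewrite pf.
have cU := open_closedC (oU i Di).
have : (~` U i) x.
  apply/(closed_chartP _ cU) => a Ua; rewrite xp; apply: Jp.
  exists [fset i]%fset; first by move=> j; rewrite in_fset1 => /eqP ->;
    exact: mem_set.
  by move=> y h; apply: Ua; apply: h; rewrite in_fset1.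
exact.
Qed.

(** The sum of the two vanishing ideals lies in no prime ideal. *)
Lemma closed_disjoint_comaximal F G : closed F -> closed G -> F `&` G = set0 ->
  exists a b, [/\ vanishing_ideal F a, vanishing_ideal G b & a + b = 1].
Proof.
move=> cF cG FG; apply: contrapT => nab.
have [F0 FD FM] := vanishing_ideal_ideal F.
have [G0 GD GM] := vanishing_ideal_ideal G.
have [||p h] := @prime_containing _
    [set c | exists a b, [/\ vanishing_ideal F a,
      vanishing_ideal G b & c = a + b]].
- split.
  + by exists 0, 0; split=> //; rewrite addr0.
  + move=> _ _ [a [b [Fa Gb ->]]] [a' [b' [Fa' Gb' ->]]].
    by exists (a + a'), (b + b'); split; [exact: FD|exact: GD|ring].
  + move=> c _ [a [b [Fa Gb ->]]].
    by exists (c * a), (c * b); split; [exact: FM|exact: GM|ring].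
- by move=> [a [b [Fa Gb ab]]]; apply: nab; exists a, b.
have [x xp] := chart_surj rho p.
suff : (F `&` G) x by rewrite FG.
split.
  apply/(closed_chartP _ cF) => a Fa; rewrite xp; apply: h.
  by exists a, 0; split=> //; rewrite addr0.
apply/(closed_chartP _ cG) => a Ga; rewrite xp; apply: h.
by exists 0, a; split=> //; rewrite add0r.
Qed.

(** With [a + b = 1] for functions [a] and [b] vanishing on the two sets, the
    zero loci of [a] and [b] are disjoint, and outside both is the basic open
    set of [a * b]. *)
Lemma chart_fatten F G : closed F -> closed G -> F `&` G = set0 ->
  exists F' G' : set T, [/\ closed F', closed G', F' `&` G' = set0,
    F `<=` F' /\ G `<=` G' & cover_compact (~` (F' `|` G'))].
Proof.
move=> cF cG FG; have [a [b [Fa Gb ab]]] := closed_disjoint_comaximal cF cG FG.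
exists [set x | rho x a], [set x | rho x b]; split.
- exact: basic_closed.
- exact: basic_closed.
- apply/disjoints_subset => x xa xb; apply: (@prime1 _ (rho x)).
  by rewrite -ab; exact: primeD.
- by split=> x; [exact: Fa|exact: Gb].
- have -> : [set x | rho x a] `|` [set x | rho x b] = [set x | rho x (a * b)].
    apply/seteqP; split=> x /=; last exact: primeM.
    by case; [exact: primeMl|exact: primeMr].
  exact: basic_open_compact.
Qed.

(** The generizations of [Z = V(I)] are the primes avoiding [1 + I]. If [y] is
    in their closure, then the complement of the prime [y] and [1 + I] generate
    a multiplicative set without [0], which some prime avoids. *)
Lemma chart_generizations (Z : set T) y :
  closed Z -> closure (generizations Z) y ->
  exists2 x, generizations Z x & closure [set x] y.
Proof.
move=> cZ /closure_chartP gy; pose I := vanishing_ideal Z.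
have [I0 ID IM] := vanishing_ideal_ideal Z.
pose M : set A := [set m | exists b i, [/\ ~ rho y b, I i & m = b * (1 + i)]].
have id0 : is_ideal ([set 0] : set A).
  by split=> [|_ _ -> ->|a _ ->]; rewrite ?addr0 ?mulr0.
have [|||p _ pM] := prime_avoiding id0 (M := M).
- by exists 1, 0; split=> //; [exact: prime1|ring].
- move=> _ _ [b [i [yb Ii ->]]] [c [j [yc Ij ->]]].
  exists (b * c), (i + (j + i * j)); split; last ring.
    by move=> /primeM[].
  by apply: (ID) => //; apply: (ID) => //; exact: IM.
- apply/disjoints_subset => _ -> [b [i [yb Ii /esym bi]]].
  apply/yb/gy => x [z Zz /specialization_chartP xz].
  have : rho x (b * (1 + i)) by rewrite bi; exact: prime0.
  move=> /primeM[//|/xz zi]; case: (@prime1 _ (rho z)).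
  by rewrite -[1](addrK i); apply: primeB => //; exact: Ii.
have avoid a : M a -> ~ p a.
  by move=> Ma pa; have : (p `&` M) a by []; rewrite pM.
have [x xp] := chart_surj rho p.
exists x; last first.
  apply/specialization_chartP => a; rewrite xp => pa; apply: contrapT => ya.
  by apply: (avoid a) => //; exists a, 0; split=> //; ring.
have [||q h] := @prime_containing _
    [set c | exists a i, [/\ p a, I i & c = a + i]].
- split.
  + by exists 0, 0; split=> //; [exact: prime0|rewrite addr0].
  + move=> _ _ [a [b [Fa Gb ->]]] [a' [b' [Fa' Gb' ->]]].
    by exists (a + a'), (b + b'); split; [exact: primeD|exact: ID|ring].
  + move=> c _ [a [b [Fa Gb ->]]].
    by exists (c * a), (c * b); split; [exact: primeMr|exact: IM|ring].
- move=> [a [i [pa Ii ai]]]; apply: (avoid a) => //.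
  exists 1, (- i); split; [exact: prime1| |by rewrite mul1r ai addrK].
  by rewrite -mulN1r; exact: IM.
have [z zq] := chart_surj rho q; exists z.
  apply/(closed_chartP _ cZ) => a Ia; rewrite zq; apply: h.
  by exists 0, a; split=> //; [exact: prime0|rewrite add0r].
apply/specialization_chartP => a; rewrite xp zq => pa; apply: h.
by exists a, 0; split=> //; rewrite addr0.
Qed.

(** If [a] and [b] vanish on [P] and on its complement, and [a + b = 1], then
    [b] vanishes nowhere on [P]. *)
Lemma clopen_basic (P : set T) : clopen P ->
  exists b, P = ~` [set x | rho x b].
Proof.
move=> [oP cP].
have [|a [b [Pa Pb ab]]] := closed_disjoint_comaximal cP (open_closedC oP).
  exact: setICr.
exists b; apply/seteqP; split=> x.
  move=> Px /= xb; apply: (@prime1 _ (rho x)); rewrite -ab.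
  by apply: primeD => //; exact: Pa.
by move=> /= xb; apply: contrapT => Px; apply/xb/Pb.
Qed.

End Chart.

(** * Sections and morphisms of ringed spaces *)

Lemma opens_inj (T : topologicalType) (U V : opens T) :
  U = V :> set T -> U = V.
Proof.
case: U V => [U oU] [V oV] /= e; move: oU oV; rewrite e => oU oV.
by rewrite (Prop_irrelevance oU oV).
Qed.

Definition rmorphism_of (A B : pzRingType) (f : A -> B)
    (fB : zmod_morphism f) (fM : monoid_morphism f) : {rmorphism A -> B} :=
  HB.pack f (GRing.isZmodMorphism.Build A B f fB)
    (GRing.isMonoidMorphism.Build A B f fM).

Section RingedSpace.
Variable X : ringed_space.
Implicit Types (U V W O : opens X).

Lemma res_irr U V (h h' : V `<=` U) s : rs_res X h s = rs_res X h' s.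
Proof. by rewrite (Prop_irrelevance h h'). Qed.

Lemma sec_eq U (I : Type) (W : I -> opens X) (WU : forall i, W i `<=` U) s t :
  U `<=` \bigcup_i W i ->
  (forall i, rs_res X (WU i) s = rs_res X (WU i) t) -> s = t.
Proof.
move=> cov st.
have [|v [_ vuniq]] := rs_is_sheaf WU (s := fun i => rs_res X (WU i) s) cov.
  by move=> i j O Oi Oj; rewrite !(rs_res_comp _ _ (subset_trans Oi (WU i))).
by rewrite -(vuniq s) // -(vuniq t) // => i; rewrite st.
Qed.

Lemma sec_glue U (I : Type) (W : I -> opens X) (WU : forall i, W i `<=` U)
    (s : forall i, rs_sec X (W i)) :
  U `<=` \bigcup_i W i ->
  (forall i j O (Oi : O `<=` W i) (Oj : O `<=` W j),
     rs_res X Oi (s i) = rs_res X Oj (s j)) ->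
  exists t, forall i, rs_res X (WU i) t = s i.
Proof.
by move=> cov /(rs_is_sheaf WU cov)[t [tP _]]; exists t.
Qed.

Lemma sec_eq_empty U (s t : rs_sec X U) : U `<=` set0 -> s = t.
Proof.
move=> U0; pose W (i : void) : opens X := match i with end.
have WU i : W i `<=` U by case: i.
by apply: (sec_eq (WU := WU)) => [x /U0|[]].
Qed.

(** Inverses are unique, hence glue. *)
Lemma ring_unit_local U (s : rs_sec X U) :
  (forall x, U x -> germ_unit x s) -> ring_unit s.
Proof.
move=> loc.
have /choice[d dP] (x : set_type U) : exists d : {W : opens X & rs_sec X W},
    exists h : projT1 d `<=` U,
      opens_set (projT1 d) (set_val x) /\ rs_res X h s * projT2 d = 1.
  have [W [h [Wx [y e]]]] := loc _ (set_valP x).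
  by exists (existT _ W y), h.
pose W x := projT1 (d x); pose y x : rs_sec X (W x) := projT2 (d x).
have WU x : W x `<=` U by have [h _] := dP x.
have sy x : rs_res X (WU x) s * y x = 1.
  by have [h [_ <-]] := dP x; rewrite (res_irr (WU x) h).
have cov : U `<=` \bigcup_x W x.
  move=> x Ux; exists (SigSub (mem_set Ux)) => //.
  by have [_ [+ _]] := dP (SigSub (mem_set Ux)).
have [|t tP] := sec_glue WU (s := y) cov.
  move=> i j O Oi Oj.
  have OU := subset_trans Oi (WU i).
  have si : rs_res X OU s * rs_res X Oi (y i) = 1.
    by rewrite -(rs_res_comp (WU i) Oi OU) -rmorphM sy rmorph1.
  have sj : rs_res X OU s * rs_res X Oj (y j) = 1.
    by rewrite -(rs_res_comp (WU j) Oj OU) -rmorphM sy rmorph1.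
  by rewrite -[LHS]mulr1 -sj mulrA [_ * rs_res X OU s]mulrC si mul1r.
exists t; apply: (sec_eq (WU := WU)) => // i.
by rewrite rmorphM tP sy rmorph1.
Qed.

End RingedSpace.

Section Pull.
Variables (Y X : ringed_space) (f : rs_mor Y X).

(** The pullback of a section along [f], restricted to an open set [O]. Equal
    open sets are not convertible in general, so that statements about pullbacks
    leave [O] free. *)
Definition pull (V : opens X) (O : opens Y) (h : O `<=` f @^-1` V) :
    {rmorphism rs_sec X V -> rs_sec Y O} :=
  rs_res Y (h : O `<=` rs_preimage f V) \o rs_comap f V.

Lemma pullE (V : opens X) (O : opens Y) (h : O `<=` f @^-1` V) s :
  pull h s = rs_res Y (h : O `<=` rs_preimage f V) (rs_comap f V s).
Proof. by []. Qed.

Lemma res_pull (V : opens X) (O O' : opens Y) (h : O `<=` f @^-1` V)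
    (g : O' `<=` O) (h' : O' `<=` f @^-1` V) s :
  rs_res Y g (pull h s) = pull h' s.
Proof. exact: rs_res_comp. Qed.

Lemma pull_res (V V' : opens X) (O : opens Y) (g : V' `<=` V)
    (h : O `<=` f @^-1` V') (h' : O `<=` f @^-1` V) s :
  pull h (rs_res X g s) = pull h' s.
Proof.
have g' : rs_preimage f V' `<=` rs_preimage f V by move=> x; exact: g.
by rewrite !pullE (rs_natural (r :=
  f) g g') (rs_res_comp _ _ (h' : O `<=` rs_preimage f V)).
Qed.

Lemma maps_isoP (W : opens Y) (V : opens X) : maps_iso f W V <->
  [/\ set_bij W V f,
      forall O : opens Y, O `<=` W -> open (f @` O) &
      forall (V' : opens X) (O : opens Y) (h : O `<=` f @^-1` V'),
        V' `<=` V -> O = W `&` f @^-1` V' :> set Y ->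
        injective (pull h) /\ forall u, exists s, pull h s = u].
Proof.
split=> [[bijf openf isof]|[bijf openf isof]]; split=> //.
  move=> V' O h V'V OE; have [g fK gK] := isof V' V'V.
  have E : O = opens_setI W (rs_preimage f V') by exact: opens_inj.
  move: h OE; rewrite E => h _.
  have pE s : pull h s = rs_res Y (@subIsetr _ W (rs_preimage f V') :
    opens_setI W (rs_preimage f V') `<=` rs_preimage f V') (rs_comap f V' s).
    exact: res_irr.
  split; first by move=> s t; rewrite !pE; exact: (can_inj fK).
  by move=> u; exists (g u); rewrite pE; exact: gK.
move=> V' V'V.
pose h : opens_setI W (rs_preimage f V') `<=` f @^-1` V' := @subIsetr _ W _.
have [injp surjp] := isof V' (opens_setI W (rs_preimage f V')) h V'V erefl.
have /choice[g gK] := surjp.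
by exists g => // s; apply: injp; exact: gK.
Qed.

End Pull.
Arguments pull {Y X} f {V O} h : simpl never.

Section OpenImmersion.
Variables (Y X : ringed_space) (f : rs_mor Y X) (W : opens Y) (V : opens X).
Hypothesis fiso : maps_iso f W V.

Lemma maps_iso_fun y : W y -> V (f y).
Proof. by case: fiso => -[+ _ _] _ _; apply. Qed.

Lemma maps_iso_surj x : V x -> exists2 y, W y & f y = x.
Proof. by case: fiso => -[_ _ h] _ _ /h. Qed.

Lemma maps_iso_inj y y' : W y -> W y' -> f y = f y' -> y = y'.
Proof.
by case: fiso => -[_ h _] _ _ Wy Wy'; apply: h; exact: mem_set.
Qed.

Lemma maps_iso_open (O : set Y) : open O -> O `<=` W -> open (f @` O).
Proof. by case: fiso => _ h _ oO OW; exact: (h (Opens oO) OW). Qed.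

Lemma maps_iso_pull_inj (V' : opens X) (O : opens Y) (h : O `<=` f @^-1` V') :
  V' `<=` V -> O = W `&` f @^-1` V' :> set Y -> injective (pull f h).
Proof. by case/maps_isoP: fiso => _ _ h' V'V /(h' _ _ h V'V)[]. Qed.

Lemma maps_iso_pull_surj (V' : opens X) (O : opens Y) (h : O `<=` f @^-1` V') u
  :
  V' `<=` V -> O = W `&` f @^-1` V' :> set Y -> exists s, pull f h s = u.
Proof. by case/maps_isoP: fiso => _ _ h' V'V /(h' _ _ h V'V)[]. Qed.

Lemma maps_iso_preimage (O : set Y) :
  O `<=` W -> O = W `&` f @^-1` (f @` O).
Proof.
move=> OW; apply/seteqP; split=> [y Oy|y [Wy [z Oz zy]]].
  by split; [exact: OW|exists y].
by rewrite -(maps_iso_inj (OW z Oz) Wy zy).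
Qed.

Lemma maps_iso_restrict (W' : opens Y) (V' : opens X) : V' `<=` V ->
  W' = W `&` f @^-1` V' :> set Y -> maps_iso f W' V'.
Proof.
move=> V'V W'E; have W'W : W' `<=` W by rewrite W'E => y [].
apply/maps_isoP; split.
- split.
  + by move=> y; rewrite W'E => -[].
  + by move=> y y' /set_mem/W'W Wy /set_mem/W'W Wy'; exact: maps_iso_inj.
  + move=> x V'x; have [y Wy yx] := maps_iso_surj (V'V x V'x).
    by exists y => //; rewrite W'E; split=> //=; rewrite yx.
- by move=> O OW'; apply: maps_iso_open;
  [exact: opens_open|exact: subset_trans W'W].
- move=> V2 O h V2V' OE.
  have V2V := subset_trans V2V' V'V.
  have OE' : O = W `&` f @^-1` V2 :> set Y.
    rewrite OE W'E; apply/seteqP; split=> y; first by case=> -[].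
    by case=> Wy V2y; do 2!split=> //; exact: V2V'.
  by split; [exact: maps_iso_pull_inj|move=> u; exact: maps_iso_pull_surj].
Qed.

End OpenImmersion.

(** Over each [Vi i] sections correspond uniquely; injectivity of [f] makes the
    pieces of [W] over an overlap of two [Vi] coincide, so that the local
    correspondences agree there and glue. *)
Lemma maps_iso_glue (Y X : ringed_space) (f : rs_mor Y X) (I : Type)
    (Wi : I -> opens Y) (Vi : I -> opens X) (W : opens Y) (V : opens X) :
  (forall i, maps_iso f (Wi i) (Vi i)) ->
  W = \bigcup_i Wi i :> set Y -> V = \bigcup_i Vi i :> set X ->
  (forall y y', W y -> W y' -> f y = f y' -> y = y') -> maps_iso f W V.
Proof.
move=> isoi WE VE finj.
have WiW i : Wi i `<=` W by rewrite WE => y Wy; exists i.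
have ViV i : Vi i `<=` V by rewrite VE => y Vy; exists i.
apply/maps_isoP; split.
- split=> //.
    by move=> y; rewrite WE VE => -[i _ /(maps_iso_fun (isoi i)) ?]; exists i.
    by move=> y y' /set_mem Wy /set_mem Wy'; exact: finj.
  move=> x; rewrite VE => -[i _ /(maps_iso_surj (isoi i))[y Wy <-]].
  by exists y => //; exact: WiW Wy.
- move=> O OW.
  have -> : f @` O = \bigcup_i (f @` (O `&` Wi i)).
    apply/seteqP; split=> [_ [y Oy <-]|_ [i _ [y [Oy Wy] <-]]];
      last by exists y.
    by have := OW y Oy; rewrite WE => -[i _ Wy]; exists i => //; exists y.
  apply: bigcup_open => i _; apply: (maps_iso_open (isoi i)).
    by apply: openI; exact: opens_open.
  by move=> y [].
move=> V' O h V'V OE.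
pose Vi' i := opens_setI V' (Vi i).
pose Oi i := opens_setI (Wi i) (rs_preimage f (Vi' i)).
have Vi'V' i : Vi' i `<=` V' by move=> x [].
have Vi'Vi i : Vi' i `<=` Vi i by move=> x [].
have covV : V' `<=` \bigcup_i Vi' i.
  by move=> x V'x; have := V'V x V'x; rewrite VE => -[i _ Vx]; exists i.
have OiO i : Oi i `<=` O.
  by rewrite OE => y [Wy [V'y _]]; split=> //; exact: WiW Wy.
have covO : O `<=` \bigcup_i Oi i.
  rewrite OE => y [Wy V'y]; have : (\bigcup_i Wi i) y by rewrite -WE.
  by move=> [i _ Wiy]; exists i => //; do !split=> //;
    exact: (maps_iso_fun (isoi i)).
have hi i : Oi i `<=` f @^-1` Vi' i by move=> y [].
have hi' i : Oi i `<=` f @^-1` V' by move=> y [_ []].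
split.
  move=> s t st; apply: (sec_eq (WU := Vi'V')) => // i.
  apply: (maps_iso_pull_inj (isoi i) (h := hi i)) => //.
  rewrite !(pull_res _ _ (hi' i)) -!(res_pull h (OiO i)).
  by rewrite st.
move=> u.
have sS i : {s : rs_sec X (Vi' i) | pull f (hi i) s = rs_res Y (OiO i) u}.
  by apply: cid; exact: (maps_iso_pull_surj (isoi i)).
pose s i := sval (sS i).
have sP i : pull f (hi i) (s i) = rs_res Y (OiO i) u := svalP (sS i).
have [|t tP] := sec_glue Vi'V' (s := s) covV.
  move=> i j N Ni Nj.
  pose ON := opens_setI (Wi i) (rs_preimage f N).
  have hN : ON `<=` f @^-1` N by move=> y [].
  apply: (maps_iso_pull_inj (isoi i) (h := hN)) => //.
    exact: subset_trans Ni (Vi'Vi i).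
  have Oni : ON `<=` Oi i by move=> y [Wy /Ni].
  have Onj : ON `<=` Oi j.
    move=> y [Wy /Nj[V'y Vjy]]; split=> //.
    have [z Wz zy] := maps_iso_surj (isoi j) Vjy.
    by rewrite -(finj z y (WiW _ _ Wz) (WiW _ _ Wy) zy).
  rewrite (pull_res Ni hN (subset_trans Oni (hi i))).
  rewrite (pull_res Nj hN (subset_trans Onj (hi j))).
  rewrite -(res_pull (hi i) Oni) -(res_pull (hi j) Onj) !sP.
  by rewrite !(rs_res_comp _ _ (subset_trans Oni (OiO i))).
exists t; apply: (sec_eq (WU := OiO)) => // i.
by rewrite -sP -tP (pull_res _ _ (hi' i)) (res_pull _ _ (hi' i)).
Qed.

(** Around a point, a section that becomes a unit upstairs is already a unit,
    because the two rings of sections are isomorphic. *)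
Lemma local_on_stalks_of_maps_iso (Y X : ringed_space) (f : rs_mor Y X) :
  (forall y, exists W V, opens_set W y /\ maps_iso f W V) -> local_on_stalks f.
Proof.
move=> locf y V0 s Vy [O [OV0 [Oy [r sr]]]].
have [W [V [Wy isof]]] := locf y.
pose O' := opens_setI O W.
have O'W : O' `<=` W by move=> z [].
pose V' := Opens (maps_iso_open isof (opens_open O') O'W).
have V'V0 : V' `<=` V0 by move=> _ [z [/OV0 Oz _] <-].
have V'V : V' `<=` V by move=> _ [z [_ Wz] <-]; exact: (maps_iso_fun isof).
have O'E : O' = W `&` f @^-1` V' :> set Y by exact: (maps_iso_preimage isof).
have h : O' `<=` f @^-1` V' by move=> z O'z; exists z.
have O'O : O' `<=` O by move=> z [].
have [t tP] := maps_iso_pull_surj isof h (rs_res Y O'O r) V'V O'E.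
exists V', V'V0; split; first by exists y.
exists t; apply: (maps_iso_pull_inj isof (h := h)) => //.
rewrite rmorphM tP rmorph1 (pull_res _ _ (subset_trans O'O OV0)).
by rewrite -[in RHS](rmorph1 (rs_res Y O'O)) -sr rmorphM (rs_res_comp _ _
  (subset_trans O'O OV0)).
Qed.

(** * Composition and inverses *)

Section Composition.
Variables (Z Y X : ringed_space) (f : rs_mor Y X) (g : rs_mor Z Y).

Fact comp_continuous : continuous (f \o g).
Proof.
by move=> z; apply: continuous_comp;
  [exact: rs_continuous|exact: rs_continuous].
Qed.

Definition comp_comap (V : opens X) :
    {rmorphism rs_sec X V -> rs_sec Z (opens_preimage comp_continuous V)} :=
  pull g (V := rs_preimage f V) (O := opens_preimage comp_continuous V)
    (@subset_refl _ (g @^-1` (f @^-1` V))) \o rs_comap f V.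

Fact comp_comapE (V : opens X) s : comp_comap V s =
  pull g (@subset_refl _ (g @^-1` (f @^-1` V)) :
    opens_preimage comp_continuous V `<=` g @^-1` (rs_preimage f V))
  (rs_comap f V s).
Proof. by []. Qed.

Fact comp_natural (V V' : opens X) (h : V' `<=` V)
    (h' : opens_preimage comp_continuous V' `<=` opens_preimage comp_continuous
      V)
    s : comp_comap V' (rs_res X h s) = rs_res Z h' (comp_comap V s).
Proof.
have h2 : rs_preimage f V' `<=` rs_preimage f V by move=> x; exact: h.
have k : opens_preimage comp_continuous V' `<=` g @^-1` rs_preimage f V by [].
by rewrite !comp_comapE (rs_natural h h2) (pull_res _ _ k) (res_pull _ _ k).
Qed.

Definition rs_comp : rs_mor Z X :=
  @RSMor Z X (f \o g) comp_continuous comp_comap comp_natural.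

Lemma pull_comp (V : opens X) (M : opens Y) (O : opens Z)
  (h : O `<=` rs_comp @^-1` V) (h1 : M `<=` f @^-1` V) (h2 : O `<=` g @^-1` M)
    s :
  pull rs_comp h s = pull g h2 (pull f h1 s).
Proof.
have k : O `<=` g @^-1` rs_preimage f V by [].
rewrite [pull f h1 s]pullE (pull_res _ _ k) pullE.
by rewrite -[rs_comap _ _ _]/(comp_comap V s) comp_comapE (res_pull _ _ k).
Qed.

Lemma maps_iso_comp (Q : opens Z) (W W' : opens Y) (V V' : opens X) :
  maps_iso g Q W' -> maps_iso f W V -> W' `<=` W -> V' = f @` W' :> set X ->
  maps_iso rs_comp Q V'.
Proof.
move=> isog isof W'W V'E.
have V'V : V' `<=` V by rewrite V'E => _ [y /W'W Wy <-];
  exact: (maps_iso_fun isof).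
apply/maps_isoP; split.
- split.
  + by move=> z Qz; rewrite V'E; exists (g z) => //; exact: (maps_iso_fun isog).
  + move=> z z' /set_mem Qz /set_mem Qz' /= e; apply: (maps_iso_inj isog) => //.
    by apply: (maps_iso_inj isof) => //; apply: W'W; exact: (maps_iso_fun isog).
  + rewrite V'E => _ [y /(maps_iso_surj isog)[z Qz <-] <-].
    by exists z.
- move=> O OQ; rewrite [_ @` _](_ : _ = f @` (g @` O)); last first.
    by rewrite -image_comp.
  apply: (maps_iso_open isof).
    by apply: (maps_iso_open isog) => //; exact: opens_open.
  by move=> _ [z /OQ Qz <-]; apply: W'W; exact: (maps_iso_fun isog).
move=> V1 O h V1V' OE.
pose M := opens_setI W (rs_preimage f V1).
have h1 : M `<=` f @^-1` V1 by move=> y [].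
have h2 : O `<=` g @^-1` M.
  by rewrite OE => z [Qz V1z]; split=> //; apply: W'W;
    exact: (maps_iso_fun isog).
have MW' : M `<=` W'.
  move=> y [Wy V1y]; have := V1V' _ V1y; rewrite V'E => -[y' W'y' e].
  by rewrite -(maps_iso_inj isof (W'W _ W'y') Wy e).
have OE2 : O = Q `&` g @^-1` M :> set Z.
  by apply/seteqP; split=> z; [move=> Oz; split; [move: Oz;
    rewrite OE => -[]|exact: h2]
    |rewrite OE => -[Qz [_ V1z]]].
have V1V := subset_trans V1V' V'V.
split.
  move=> s t; rewrite !(pull_comp h h1 h2) => st.
  apply: (maps_iso_pull_inj isof (h := h1)) => //.
  exact: (maps_iso_pull_inj isog (h := h2)).
move=> u; have [v vu] := maps_iso_pull_surj isog h2 u MW' OE2.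
have [s sv] := maps_iso_pull_surj isof h1 v V1V erefl.
by exists s; rewrite (pull_comp h h1 h2) sv.
Qed.

End Composition.

Section Inverse.
Variables (Y X : ringed_space) (f : rs_mor Y X) (W : opens Y).
Hypothesis fiso : maps_iso f W (opens_setT X).

Definition rs_inv_fun (x : X) : Y :=
  sval (cid2 (maps_iso_surj fiso (I : setT x))).

Lemma rs_inv_funW x : W (rs_inv_fun x).
Proof. by rewrite /rs_inv_fun; case: cid2. Qed.

Lemma rs_inv_funK x : f (rs_inv_fun x) = x.
Proof. by rewrite /rs_inv_fun; case: cid2. Qed.

Lemma rs_inv_funE y : W y -> rs_inv_fun (f y) = y.
Proof.
by move=> Wy; apply: (maps_iso_inj fiso) => //;
  [exact: rs_inv_funW|rewrite rs_inv_funK].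
Qed.

Fact inv_continuous : continuous rs_inv_fun.
Proof.
apply/continuousP => O oO.
have -> : rs_inv_fun @^-1` O = f @` (W `&` O).
  apply/seteqP; split=> [x Ox|_ [y [Wy Oy] <-]]; last by rewrite /= rs_inv_funE.
  by exists (rs_inv_fun x); [split=> //; exact: rs_inv_funW|exact: rs_inv_funK].
apply: (maps_iso_open fiso); last by move=> y [].
by apply: openI => //; exact: opens_open.
Qed.

Let piece (V : opens X) := opens_setI W (rs_preimage f V).

Let piece_sub (V : opens X) : piece V `<=` f @^-1` V.
Proof. by move=> y []. Qed.

Let piece_pull_inj (V : opens X) : injective (pull f (@piece_sub V)).
Proof. exact: (maps_iso_pull_inj fiso). Qed.

Let inv_piece_sub (O : opens Y) :
  piece (opens_preimage inv_continuous O) `<=` O.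
Proof. by move=> y [Wy]; rewrite /= rs_inv_funE. Qed.

(* A section over [O] is pulled back by [g = f^-1] to the unique section over
   [g^-1 O] whose pullback along [f] agrees with it on [W]. *)
Let inv_comap_exists (O : opens Y) (s : rs_sec Y O) :
  {t | pull f (@piece_sub (opens_preimage inv_continuous O)) t =
       rs_res Y (@inv_piece_sub O) s}.
Proof. by apply: cid; exact: (maps_iso_pull_surj fiso). Qed.

Let inv_comap0 O s := sval (@inv_comap_exists O s).

Let inv_comap0E O s :
  pull f (@piece_sub (opens_preimage inv_continuous O)) (@inv_comap0 O s) =
  rs_res Y (@inv_piece_sub O) s.
Proof. exact (svalP (@inv_comap_exists O s)). Qed.

Let inv_comap0B O : zmod_morphism (@inv_comap0 O).
Proof.
by move=> s t; apply: piece_pull_inj; rewrite rmorphB !inv_comap0E rmorphB.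
Qed.

Let inv_comap0M O : monoid_morphism (@inv_comap0 O).
Proof.
split; first by apply: piece_pull_inj; rewrite inv_comap0E !rmorph1.
by move=> s t; apply: piece_pull_inj; rewrite rmorphM !inv_comap0E rmorphM.
Qed.

Definition inv_comap (O : opens Y) :
    {rmorphism rs_sec Y O -> rs_sec X (opens_preimage inv_continuous O)} :=
  rmorphism_of (@inv_comap0B O) (@inv_comap0M O).

Fact inv_natural (O O' : opens Y) (h : O' `<=` O)
    (h' : opens_preimage inv_continuous O' `<=` opens_preimage inv_continuous
      O) s :
  inv_comap O' (rs_res Y h s) = rs_res X h' (inv_comap O s).
Proof.
have g : piece (opens_preimage inv_continuous O') `<=`
    piece (opens_preimage inv_continuous O).
  by move=> y [Wy /h' ?].
have k : piece (opens_preimage inv_continuous O') `<=`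
    f @^-1` (opens_preimage inv_continuous O).
  by move=> y [_ /h'].
apply: piece_pull_inj; rewrite inv_comap0E (pull_res _ _ k).
rewrite -(res_pull (@piece_sub _) g) inv_comap0E.
by rewrite !(rs_res_comp _ _ (subset_trans g (@inv_piece_sub O))).
Qed.

Definition rs_inv : rs_mor X Y :=
  @RSMor X Y rs_inv_fun inv_continuous inv_comap inv_natural.

Lemma pull_inv (O : opens Y) (V : opens X) (h : V `<=` rs_inv @^-1` O)
    (N : opens Y) (hN : N `<=` f @^-1` V) (hO : N `<=` O) s : N `<=` W ->
  pull f hN (pull rs_inv h s) = rs_res Y hO s.
Proof.
move=> NW; have k : N `<=` piece (opens_preimage inv_continuous O).
  by move=> y Ny; split; [exact: NW|rewrite /= rs_inv_funE;
    [exact: hO|exact: NW]].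
rewrite [pull rs_inv h s]pullE (pull_res _ _ (subset_trans k (@piece_sub _))).
by rewrite -(res_pull (@piece_sub _) k) inv_comap0E rs_res_comp.
Qed.

Lemma rs_inv_section : is_section f rs_inv.
Proof.
split; first exact: rs_inv_funK.
move=> V N h h' s.
apply: piece_pull_inj.
have e : rs_res X h' (rs_comap rs_inv (rs_preimage f V) (rs_comap f V s)) =
    pull rs_inv h' (rs_comap f V s) by [].
rewrite e.
have hO : piece N `<=` rs_preimage f V by move=> y [_ /h].
by rewrite (pull_inv _ _ hO) => [|y []//]; rewrite (pull_res _ _ hO).
Qed.

Lemma rs_inv_maps_iso : maps_iso rs_inv (opens_setT X) W.
Proof.
apply/maps_isoP; split.
- split.
  + by move=> x _; exact: rs_inv_funW.
  + by move=> x x' _ _ e; rewrite -[x]rs_inv_funK -[x']rs_inv_funK -[rs_inv_fun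
    x]/(rs_inv x) e.
  + by move=> y Wy; exists (f y) => //; exact: rs_inv_funE.
- move=> O _; have -> : rs_inv @` O = W `&` f @^-1` O.
    apply/seteqP; split=> [_ [x Ox <-]|y [Wy Oy]].
      by split; [exact: rs_inv_funW|rewrite /= rs_inv_funK].
    by exists (f y) => //; exact: rs_inv_funE.
  by apply: openI; [exact: opens_open|exact: (opens_open (rs_preimage f O))].
move=> O V h OW VE.
have hV : O `<=` f @^-1` V.
  by move=> y Oy; rewrite /= VE; split=> //=; rewrite rs_inv_funE //; exact: OW.
have OE : O = W `&` f @^-1` V :> set Y.
  apply/seteqP; split=> [y Oy|y [Wy]]; first by split; [exact: OW|exact: hV].
  by rewrite /= VE => -[_]; rewrite /= rs_inv_funE.
split.
  move=> s t /(congr1 (pull f hV)).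
  by rewrite !(pull_inv h hV (@subset_refl _ O)) // !rs_res_id.
move=> u; exists (pull f hV u).
apply: (maps_iso_pull_inj fiso (h := hV)) => //.
by rewrite (pull_inv h hV (@subset_refl _ O)) // rs_res_id.
Qed.

End Inverse.

(** * Coproducts of ringed spaces *)

Section Coproduct.
Variables (I : choiceType) (Z : I -> ringed_space).

Let sum_space : topologicalType := {i : I & Z i}.

Definition inj_fun (i : I) : Z i -> sum_space := existT (fun i => Z i : Type) i.

Fact inj_continuous i : continuous (@inj_fun i).
Proof. exact: existT_continuous. Qed.

Definition slice (O : opens sum_space) (i : I) : opens (Z i) :=
  opens_preimage (@inj_continuous i) O.

Lemma slice_sub (U V : opens sum_space) i : V `<=` U -> slice V i `<=` slice U
  i.
Proof. by move=> VU z; exact: VU. Qed.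

Definition sum_sec (O : opens sum_space) : comPzRingType :=
  prod_ring (fun i => rs_sec (Z i) (slice O i)).

Definition sum_res0 (U V : opens sum_space) (h : V `<=` U) (s : sum_sec U) :
  sum_sec V := fun i => rs_res (Z i) (slice_sub (i := i) h) (s i).

Lemma sum_sec_ext (U : opens sum_space) (s t : sum_sec U) :
  (forall i, s i = t i) -> s = t.
Proof. exact: functional_extensionality_dep. Qed.

Let sum_res0B U V h : zmod_morphism (@sum_res0 U V h).
Proof. by move=> s t; apply: sum_sec_ext => i; exact: rmorphB. Qed.

Let sum_res0M U V h : monoid_morphism (@sum_res0 U V h).
Proof.
split=> [|s t]; apply: sum_sec_ext => i; [exact: rmorph1|exact: rmorphM].
Qed.

Definition sum_res (U V : opens sum_space) (h : V `<=` U) :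
  {rmorphism sum_sec U -> sum_sec V} :=
  rmorphism_of (@sum_res0B U V h) (@sum_res0M U V h).

Fact sum_res_id (U : opens sum_space) (h : U `<=` U) s : sum_res h s = s.
Proof. by apply: sum_sec_ext => i; exact: rs_res_id. Qed.

Fact sum_res_comp (U V W : opens sum_space) (VU : V `<=` U) (WV : W `<=` V)
  (WU : W `<=` U) s : sum_res WV (sum_res VU s) = sum_res WU s.
Proof. by apply: sum_sec_ext => i; exact: rs_res_comp. Qed.

Fact sum_is_sheaf : is_sheaf (fun U V h => @sum_res U V h).
Proof.
move=> U J W WU s cov compat.
have covi i : slice U i `<=` \bigcup_j slice (W j) i.
  by move=> z /cov[j _ Wz]; exists j.
have tS i : {t | forall j, rs_res (Z i) (slice_sub (WU j)) t = s j i}.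
  apply: cid; apply: sec_glue => // j k N Nj Nk.
  have oN : open (@inj_fun i @` N) by apply: existT_open_map; exact: opens_open.
  have Mj : Opens oN `<=` W j by move=> _ [z /Nj ? <-].
  have Mk : Opens oN `<=` W k by move=> _ [z /Nk ? <-].
  have NM : N `<=` slice (Opens oN) i by move=> z Nz; exists z.
  have := congr1 (fun r : sum_sec (Opens oN) =>
    rs_res (Z i) NM (r i)) (compat j k _ Mj Mk).
  rewrite /sum_res /= /sum_res0.
  by rewrite (rs_res_comp _ _ Nj) (rs_res_comp _ _ Nk).
exists (fun i => sval (tS i)); split=> [j|t tP].
  by apply: sum_sec_ext => i; exact: (svalP (tS i) j).
apply: sum_sec_ext => i.
apply: (sec_eq (WU := fun j => slice_sub (i := i) (WU j))) => // j.
by rewrite (svalP (tS i)) -tP.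
Qed.

Definition rs_sum : ringed_space :=
  @RingedSpace sum_space sum_sec sum_res sum_res_id sum_res_comp sum_is_sheaf.

Definition inj_comap (i : I) (V : opens rs_sum) :
    rs_sec rs_sum V -> rs_sec (Z i) (opens_preimage (@inj_continuous i) V) :=
  fun s => s i.

Let inj_comapB i V : zmod_morphism (@inj_comap i V). Proof. by []. Qed.
Let inj_comapM i V : monoid_morphism (@inj_comap i V). Proof. by []. Qed.

Definition rs_inj (i : I) : rs_mor (Z i) rs_sum :=
  @RSMor (Z i) rs_sum (@inj_fun i) (@inj_continuous i)
    (fun V => rmorphism_of (@inj_comapB i V) (@inj_comapM i V))
    (fun V V' h h' s => res_irr _ _ _).

Definition summand (i : I) : opens rs_sum :=
  Opens (@existT_open_map I (fun i => Z i) i setT openT).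

Lemma in_summand i (x : rs_sum) : summand i x <-> projT1 x = i.
Proof.
split=> [[z _ <-] //|]; case: x => j z /= ji.
by subst j; exists z.
Qed.

Lemma sum_sec_summand i (O : opens rs_sum) (s t : rs_sec rs_sum O) :
  O `<=` summand i -> s i = t i -> s = t.
Proof.
move=> Oi sti; apply: sum_sec_ext => j.
have [ij|ij] := pselect (i = j); first by subst j.
apply: sec_eq_empty => z /= /Oi/in_summand /= ji.
by apply: ij.
Qed.

Lemma rs_inj_maps_iso i : maps_iso (rs_inj i) (opens_setT _) (summand i).
Proof.
apply/maps_isoP; split.
- split.
  + by move=> z _; exists z.
  + by move=> z z' _ _ /eqP;
    rewrite -tag_eqE /tag_eq eqxx /= tagged_asE => /eqP.
  + by move=> _ [z _ <-]; exists z.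
- by move=> O _; apply: existT_open_map; exact: opens_open.
move=> V O h Vi OE.
have VO : slice V i `<=` O by rewrite OE => z Vz; split.
split.
  have k : slice V i `<=` rs_inj i @^-1` V by [].
  move=> s t /(congr1 (rs_res (Z i) VO)).
  rewrite !(res_pull _ _ k) !pullE !rs_res_id.
  exact: sum_sec_summand.
move=> u; pose u' := rs_res (Z i) VO u.
pose s : rs_sec rs_sum V := fun j => match pselect (i = j) with
  | left e => eq_rect i (fun j => rs_sec (Z j) (slice V j)) u' j e
  | right _ => 0 end.
exists s; rewrite pullE /= /inj_comap /s; case: pselect => // e.
by rewrite (Prop_irrelevance e erefl) /= (rs_res_comp _ _ (@subset_refl _ O))
  rs_res_id.
Qed.

Section Copair.
Variables (Y : ringed_space) (h : forall i, rs_mor (Z i) Y).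

Definition copair_fun (x : rs_sum) : Y := h (projT1 x) (projT2 x).

Fact copair_continuous : continuous copair_fun.
Proof.
move=> [i z]; have := @sigT_continuous I (fun i => Z i) Y (fun i => h i)
  (fun i => @rs_continuous _ _ (h i)).
exact.
Qed.

Definition copair_comap (V : opens Y) :
    rs_sec Y V -> rs_sec rs_sum (opens_preimage copair_continuous V) :=
  fun s i => pull (h i) (@subset_refl _ (h i @^-1` V) :
    slice (opens_preimage copair_continuous V) i `<=` h i @^-1` V) s.

Let copair_comapB V : zmod_morphism (@copair_comap V).
Proof. by move=> s t; apply: sum_sec_ext => i; exact: rmorphB. Qed.

Let copair_comapM V : monoid_morphism (@copair_comap V).
Proof.
split=> [|s t]; apply: sum_sec_ext => i; [exact: rmorph1|exact: rmorphM].
Qed.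

Fact copair_natural (V V' : opens Y) (g : V' `<=` V)
  (g' : opens_preimage copair_continuous V' `<=` opens_preimage
    copair_continuous V)
  s : copair_comap (rs_res Y g s) = sum_res g' (copair_comap s).
Proof.
apply: sum_sec_ext => i.
rewrite -[RHS]/(rs_res (Z i) (slice_sub (i := i) g') (copair_comap s i)).
rewrite /copair_comap.
have k : slice (opens_preimage copair_continuous V') i `<=` h i @^-1` V.
  by move=> z; exact: g.
by rewrite (pull_res _ _ k) (res_pull _ _ k).
Qed.

Definition rs_copair : rs_mor rs_sum Y :=
  @RSMor rs_sum Y copair_fun copair_continuous
    (fun V => rmorphism_of (@copair_comapB V) (@copair_comapM V))
      copair_natural.

Lemma pull_copair (V : opens Y) (O : opens rs_sum) (k : O `<=` rs_copair @^-1`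
  V)
    i (ki : slice O i `<=` h i @^-1` V) s :
  (pull rs_copair k s : sum_sec O) i = pull (h i) ki s.
Proof. exact: res_pull. Qed.

Lemma rs_copair_maps_iso i (Q : opens Y) :
  maps_iso (h i) (opens_setT _) Q -> maps_iso rs_copair (summand i) Q.
Proof.
move=> isoh; apply/maps_isoP; split.
- split.
  + by move=> _ [z _ <-]; exact: (maps_iso_fun isoh).
  + move=> _ _ /set_mem[z _ <-] /set_mem[z' _ <-] e.
    by congr existT; exact: (maps_iso_inj isoh).
  + move=> y /(maps_iso_surj isoh)[z _ <-].
    by exists (inj_fun z) => //; exists z.
- move=> O Oi; have -> : rs_copair @` O = h i @` slice O i.
    apply/seteqP; split=> [_ [x Ox <-]|_ [z Oz <-]]; last by exists (inj_fun z).
    by have [z _ zx] := Oi x Ox; exists z; rewrite /= ?/inj_fun ?zx // -zx.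
  by apply: (maps_iso_open isoh) => //; exact: opens_open.
move=> V O k VQ OE.
have Oi : O `<=` summand i by rewrite OE => x [].
have ki : slice O i `<=` h i @^-1` V by move=> z /k.
have sE : slice O i = setT `&` h i @^-1` V :> set (Z i).
  apply/seteqP; split=> z; first by move=> Oz; split=> //; exact: ki.
  by case=> _ Vz; rewrite /= OE; split=> //; exists z.
split.
  move=> s t /(congr1 (fun r : sum_sec O => r i)).
  by rewrite !(pull_copair _ ki); exact: (maps_iso_pull_inj isoh).
move=> u; have [s su] := maps_iso_pull_surj isoh ki ((u : sum_sec O) i) VQ sE.
by exists s; apply: (sum_sec_summand Oi); rewrite (pull_copair _ ki).
Qed.

(** Disjointness of the images makes the map injective, so that the
    isomorphisms on the summands glue. *)
Lemma rs_copair_iso (Q : I -> opens Y) :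
  (forall i, maps_iso (h i) (opens_setT _) (Q i)) ->
  (forall i j y, Q i y -> Q j y -> i = j) -> [set: Y] `<=` \bigcup_i Q i ->
  maps_iso rs_copair (opens_setT _) (opens_setT _).
Proof.
move=> isoh disj cov.
apply: (@maps_iso_glue _ _ _ I summand Q) => [i|||x x' _ _ e].
- exact: rs_copair_maps_iso.
- by apply/seteqP; split=> // x _; exists (projT1 x) => //; exact/in_summand.
- by apply/seteqP; split=> // y _; exact: cov.
have mem (y : rs_sum) : Q (projT1 y) (rs_copair y) by exact: (maps_iso_fun
  (isoh _)).
have ij : projT1 x' = projT1 x.
  by apply: disj (mem x') _; rewrite -e; exact: mem.
apply: (maps_iso_inj (rs_copair_maps_iso (isoh (projT1 x)))) => //;
  exact/in_summand.
Qed.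

End Copair.

End Coproduct.

(** * Spectra *)

Local Notation frac := Defs.frac.

Identity Coercion prod_ring_to_fun : prod_ring >-> Funclass.
Identity Coercion spec_stalks_to_prod : spec_stalks >-> prod_ring.

Section SpecSpace.
Variable A : comPzRingType.

Lemma spec_openP (U : set (spec A)) :
  open U <-> exists E : set A, U = [set p : spec A | ~ (E `<=` p)].
Proof. by []. Qed.

Lemma spec_closedP (Z : set (spec A)) :
  closed Z <-> exists E : set A, Z = [set p : spec A | E `<=` p].
Proof.
rewrite -openC spec_openP; split=> -[E ZE]; exists E.
  rewrite -[Z]setCK ZE; apply/seteqP; split=> p /=; [exact: contrapT|].
  by move=> Ep; apply.
by rewrite ZE; apply/seteqP; split.
Qed.

Definition spec_chart : spectral_chart (spec A) A :=
  @SpectralChart (spec A) A id (fun _ _ => id) (fun p => ex_intro _ p erefl)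
    spec_closedP.

Definition basic (f : A) : opens (spec A) := Opens (basic_open spec_chart f).

Lemma spec_sec_ext (U : opens (spec A)) (s t : spec_sec U) :
  (forall q, s q = t q) -> s = t.
Proof. by move=> st; apply: val_inj; exact: functional_extensionality_dep. Qed.

Lemma spec_sec_irr (U : opens (spec A)) (s : spec_sec U) p
  (h h' : p \in opens_set U) : s (SigSub h) = s (SigSub h').
Proof. by rewrite (bool_irrelevance h h'). Qed.

Lemma frac_irr (p : spec A) a s (h h' : denominators p s) : frac a h = frac a
  h'.
Proof. by rewrite (Prop_irrelevance h h'). Qed.

Lemma frac_eq_mul (p : spec A) a b s t (hs : denominators p s)
  (ht : denominators p t) : a * t = b * s -> frac a hs = frac b ht.
Proof.
by move=> e; apply/frac_eqP; exists 1; [exact: denominators1|rewrite e].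
Qed.

Lemma fracM (p : spec A) a b s t (hs : denominators p s) (ht : denominators p
  t) :
  frac a hs * frac b ht = frac (a * b) (denominatorsM hs ht).
Proof. exact: loc_mulE. Qed.

Lemma fracB (p : spec A) a b s t (hs : denominators p s) (ht : denominators p
  t) :
  frac a hs - frac b ht = frac (a * t - b * s) (denominatorsM hs ht).
Proof.
transitivity (loc_add (frac a hs) (loc_opp (frac b ht))) => //.
by rewrite loc_oppE loc_addE mulNr.
Qed.

Lemma fracss (p : spec A) s (h : denominators p s) : frac s h = 1.
Proof. by apply: frac_eq_mul; rewrite mulr1 mul1r. Qed.

End SpecSpace.

Section SpecMap.
Variables (A B : comPzRingType) (phi : {rmorphism A -> B}).

Fact preimage_prime (q : spec B) : is_prime [set a | q (phi a)].
Proof.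
split=> /=.
- by rewrite rmorph0; exact: prime0.
- by move=> x y qx qy; rewrite rmorphD; exact: primeD.
- by move=> a x qx; rewrite rmorphM; exact: primeMr.
- by rewrite rmorph1; exact: prime1.
- by move=> x y; rewrite rmorphM; exact: primeM.
Qed.

Definition spec_fun (q : spec B) : spec A := Spec (preimage_prime q).

Fact spec_fun_continuous : continuous spec_fun.
Proof.
apply/continuousP => _ [E ->]; exists (phi @` E); apply/seteqP;
  split=> q /= nE h.
  by apply: nE => a Ea; apply: h; exists a.
by apply: nE => _ [a Ea <-]; exact: h.
Qed.

Section Stalk.
Variable q : spec B.

Definition loc_map (x : localization (spec_fun q)) : localization q :=
  @Defs.frac B q (phi (num (repr x))) (phi (den (repr x))) (@den_denominators _
    _ (repr x)).

Lemma loc_mapE a s (hs : denominators (spec_fun q) s)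
  (hs' : denominators q (phi s)) : loc_map (frac a hs) = frac (phi a) hs'.
Proof.
rewrite /loc_map; set x := frac a hs.
have : frac (num (repr x)) (@den_denominators _ _ (repr x)) = frac a hs.
  rewrite -[RHS]reprK /frac; congr (\pi_(localization (spec_fun q)) _).
  by rewrite /mk_fracs /num /den; case: (repr x) => n [d hd] /=; congr (_, _);
    exact: val_inj.
move=> /frac_eqP[u Su e]; apply/frac_eqP; exists (phi u) => //.
by rewrite -!rmorphM e.
Qed.

Lemma loc_mapB : zmod_morphism loc_map.
Proof.
move=> x y; have [a [s [hs ->]]] := fracP x; have [b [t [ht ->]]] := fracP y.
rewrite fracB !(loc_mapE _ _ hs) (loc_mapE _ _ ht) fracB.
rewrite (loc_mapE _ _ (_ : denominators q (phi (s * t)))).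
  by rewrite rmorphM; exact: (@denominatorsM _ q).
by move=> h; apply: frac_eq_mul; rewrite !(rmorphB, rmorphM).
Qed.

Lemma loc_mapM : monoid_morphism loc_map.
Proof.
split.
  rewrite -[1]/(frac 1 (@denominators1 _ (spec_fun q))) (loc_mapE _ _ (_ :
    denominators q (phi 1))).
    by rewrite rmorph1; exact: denominators1.
  by move=> h; apply: frac_eq_mul; rewrite rmorph1.
move=> x y; have [a [s [hs ->]]] := fracP x; have [b [t [ht ->]]] := fracP y.
rewrite fracM !(loc_mapE _ _ hs) (loc_mapE _ _ ht) fracM.
rewrite (loc_mapE _ _ (_ : denominators q (phi (s * t)))).
  by rewrite rmorphM; exact: (@denominatorsM _ q).
by move=> h; apply: frac_eq_mul; rewrite !rmorphM.
Qed.

End Stalk.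

Section Comap.
Variable V : opens (spec A).

Let fV := opens_preimage spec_fun_continuous V.

Definition over (q : set_type fV) : set_type V :=
  SigSub (mem_set (set_valP q : opens_set V (spec_fun (set_val q)))).

Fact spec_comap_subproof (s : spec_sec V) :
  ((fun q => @loc_map (set_val q) (s (over q))) : spec_stalks fV) \in
    regular (U := fV).
Proof.
apply/asboolP => q; have /asboolP/(_ (over q))[W [a [f [Wq sE]]]] :=
  spec_sec_regular s.
exists (opens_preimage spec_fun_continuous W), (phi a), (phi f);
  split=> // r Wr.
by have [h e] := sE (over r) Wr; exists h; rewrite e; exact: loc_mapE.
Qed.

Definition spec_comap0 (s : spec_sec V) : spec_sec fV :=
  SpecSec (spec_comap_subproof s).

Let spec_comap0B : zmod_morphism spec_comap0.
Proof. by move=> s t; apply: spec_sec_ext => q; exact: loc_mapB. Qed.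

Let spec_comap0M : monoid_morphism spec_comap0.
Proof.
split=> [|s t]; apply: spec_sec_ext => q;
  [exact: (loc_mapM _).1|exact: (loc_mapM _).2].
Qed.

Definition spec_comap : {rmorphism rs_sec (Spec_space A) V -> rs_sec
  (Spec_space B) fV} :=
  rmorphism_of spec_comap0B spec_comap0M.

End Comap.

Fact spec_natural (V V' : opens (Spec_space A)) (h : V' `<=` V)
  (h' : opens_preimage spec_fun_continuous V' `<=`
        opens_preimage spec_fun_continuous V) s :
  spec_comap V' (rs_res (Spec_space A) h s) =
  rs_res (Spec_space B) h' (spec_comap V s).
Proof.
apply: spec_sec_ext => q; rewrite /= ; congr (loc_map _).
exact: spec_sec_irr.
Qed.

Definition Spec_map : rs_mor (Spec_space B) (Spec_space A) :=
  @RSMor (Spec_space B) (Spec_space A) spec_fun spec_fun_continuous spec_comap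
    spec_natural.

Lemma pull_Spec (V : opens (Spec_space A)) (O : opens (Spec_space B))
    (h : O `<=` Spec_map @^-1` V) (s : spec_sec V) q (hq : q \in opens_set O)
    (hV : spec_fun q \in opens_set V) :
  (pull Spec_map h s : spec_sec O) (SigSub hq) = loc_map (s (SigSub hV)).
Proof. by congr (loc_map _); exact: spec_sec_irr. Qed.

(** * Localizations *)

Variable f : A.
(* These three hypotheses say that [phi] is the localization of [A] at [f];
   elements of the kernel need only be killed locally. *)
Hypothesis phi_unit : exists g, phi f * g = 1.
Hypothesis phi_surj : forall b, exists n a, phi a = phi f ^+ n * b.
Hypothesis phi_inj : forall (p : spec A) a, ~ p f -> phi a = 0 ->
  exists2 u, ~ p u & u * a = 0.

Let f_notin (q : spec B) n : ~ q (phi f ^+ n).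
Proof.
have [g fg] := phi_unit; move=> /primeX qf; apply: (@prime1 _ q).
by rewrite -fg; exact: primeMl.
Qed.

Lemma phi_eq (p : spec A) a b : ~ p f -> phi a = phi b ->
  exists2 u, ~ p u & u * a = u * b.
Proof.
move=> pf ab; have [|u pu uab] := @phi_inj p (a - b) pf.
  by rewrite rmorphB ab subrr.
by exists u => //; apply/eqP; rewrite -subr_eq0 -mulrBr uab.
Qed.

Lemma phi_eq_prime (p : spec A) a b : ~ p f -> phi a = phi b -> p a -> p b.
Proof.
move=> pf /esym /(phi_eq pf)[u pu uab] pa.
have pub : p (u * b) by rewrite uab; exact: primeMr.
by case/primeM: pub.
Qed.

Lemma spec_fun_basic (q : spec B) : ~ spec_fun q f.
Proof. by have := @f_notin q 1; rewrite expr1. Qed.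

Lemma spec_fun_inj : injective spec_fun.
Proof.
suff sub q q' : spec_fun q = spec_fun q' -> q `<=` q'.
  by move=> q q' e; apply: spec_inj; apply/seteqP; split; exact: sub.
move=> e b qb; have [n [a ab]] := phi_surj b.
have : spec_fun q a by rewrite /= ab; exact: primeMr.
by rewrite e /= ab => /primeM[/f_notin|].
Qed.

(** The prime of [B] above [p] consists of the fractions with numerator in
    [p]. *)
Lemma spec_fun_surj (p : spec A) : ~ p f -> exists q, spec_fun q = p.
Proof.
move=> pf; have pX n : ~ p (f ^+ n) by move=> /primeX.
pose Q : set B := [set b | exists n a, p a /\ phi a = phi f ^+ n * b].
have prQ : is_prime Q.
  split.
  - by exists 0, 0; split; [exact: prime0|rewrite rmorph0 mulr0].
  - move=> b c [n [a [pa ab]]] [m [d [pd dc]]].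
    exists (n + m)%N, (f ^+ m * a + f ^+ n * d).
    split; first by apply: primeD; exact: primeMr.
    by rewrite rmorphD !rmorphM !rmorphXn ab dc exprD; ring.
  - move=> c b [n [a [pa ab]]]; have [m [d dc]] := phi_surj c.
    exists (n + m)%N, (d * a); split; first exact: primeMr.
    by rewrite rmorphM ab dc exprD; ring.
  - move=> [n [a [pa]]]; rewrite mulr1 -rmorphXn => an.
    exact: pX (phi_eq_prime pf an pa).
  - move=> b c [n [a [pa ab]]].
    have [k [b' bb]] := phi_surj b; have [l [c' cc]] := phi_surj c.
    have e : phi (f ^+ (k + l) * a) = phi ((b' * c') * f ^+ n).
      by rewrite !rmorphM !rmorphXn ab bb cc exprD; ring.
    have := phi_eq_prime pf e (primeMr (f ^+ (k + l)) pa).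
    move=> /primeM[/primeM[pb|pc]|/pX//].
      by left; exists k, b'.
    by right; exists l, c'.
exists (Spec prQ); apply: spec_inj; apply/seteqP; split=> a /=.
  move=> [n [c [pc]]]; rewrite -rmorphXn -rmorphM => e.
  by have := phi_eq_prime pf e pc => /primeM[/pX|].
by move=> pa; exists 0%N, a; rewrite expr0 mul1r.
Qed.

Lemma spec_fun_open (O : set (spec B)) : open O -> open (spec_fun @` O).
Proof.
move=> [E ->].
have -> : spec_fun @` [set q : spec B | ~ (E `<=` q)] = basic f `&`
    [set p : spec A | ~ ([set a | exists n b,
      E b /\ phi a = phi f ^+ n * b] `<=` p)].
  apply/seteqP; split=> [_ [q nE <-]|p [pf nE]]; last first.
    have [q qp] : exists q, spec_fun q = p := spec_fun_surj pf; subst p.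
    exists q => //= h; apply: nE => a [n [b [Eb ab]]] /=.
    by rewrite ab; apply: primeMr; exact: h.
  split; first exact: spec_fun_basic.
  move=> h; apply: nE => b Eb; have [n [a ab]] := phi_surj b.
  have : spec_fun q a by apply: h; exists n, b.
  by rewrite /= ab => /primeM[/f_notin|].
apply: openI; first exact: (opens_open (basic f)).
by apply/spec_openP; eexists.
Qed.

Lemma loc_map_inj (q : spec B) : injective (@loc_map q).
Proof.
move=> x y; have [a [s [hs ->]]] := fracP x; have [b [t [ht ->]]] := fracP y.
rewrite (loc_mapE a (hs : denominators q (phi s))).
rewrite (loc_mapE b (ht : denominators q (phi t))).
move=> /frac_eqP[v qv e]; have [n [w wv]] := phi_surj v.
have [|u pu ue] := @phi_eq (spec_fun q) (w * (a * t)) (w * (b * s))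
  (@spec_fun_basic q).
  by rewrite !rmorphM wv -!mulrA e.
apply/frac_eqP; exists (u * w); last by rewrite -!mulrA.
by apply: denominatorsM => //;
  rewrite /denominators /= wv => /primeM[/f_notin|].
Qed.

Lemma loc_map_frac (q : spec B) b c (hc : denominators q c) :
  exists a d, forall (r : spec B) (hr : denominators r c),
    exists h : denominators (spec_fun r) d, loc_map (frac a h) = frac b hr.
Proof.
have [n [a ab]] := phi_surj b; have [m [d dc]] := phi_surj c.
exists (a * f ^+ m), (d * f ^+ n) => r hr.
have h : denominators (spec_fun r) (d * f ^+ n).
  rewrite /denominators /= rmorphM rmorphXn dc.
  by move=> /primeM[/primeM[/f_notin|]|/f_notin].
exists h; rewrite (loc_mapE _ (h : denominators r (phi _))).
by apply: frac_eq_mul; rewrite !rmorphM !rmorphXn ab dc; ring.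
Qed.

(** Sections descend because [b/c], with [b] and [c] multiples of images of
    elements of [A], is locally an image of a fraction of [A]. *)
Lemma Spec_map_maps_iso : maps_iso Spec_map (opens_setT _) (basic f).
Proof.
apply/maps_isoP; split.
- split; first by move=> q _; exact: spec_fun_basic.
    by move=> q q' _ _; exact: spec_fun_inj.
  by move=> p /spec_fun_surj[q qp]; exists q.
- by move=> O _; apply: spec_fun_open; exact: opens_open.
move=> V O h Vf OE.
have OV q : O q <-> V (spec_fun q).
  by split=> [/h//|Vq]; rewrite OE; split.
split.
  move=> s t st; apply: spec_sec_ext => -[p hp].
  have [q qp] : exists q, spec_fun q = p := spec_fun_surj (Vf p (set_mem hp)).
  subst p.
  have hq : q \in opens_set O by apply/mem_set/OV; exact: set_mem.
  apply: (@loc_map_inj q).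
  by rewrite -!(pull_Spec h _ hq) st.
move=> t.
have desc (p : set_type V) : {x : localization (set_val p) |
    forall q (hq : q \in opens_set O) (e : spec_fun q = set_val p),
    loc_map (eq_rect_r (@localization A) x e) = (t : spec_sec O) (SigSub hq)}.
  apply: cid; case: p => p hp /=.
  have [q qp] : exists q, spec_fun q = p := spec_fun_surj (Vf p (set_mem hp)).
  subst p.
  have hq : q \in opens_set O by apply/mem_set/OV; exact: set_mem.
  have [b [c [hc tq]]] := fracP ((t : spec_sec O) (SigSub hq)).
  have [a [d ad]] := loc_map_frac b hc; have [k adk] := ad q hc.
  exists (frac a k) => r hr e; have rq := spec_fun_inj e; subst r.
  rewrite (Prop_irrelevance e erefl) /= adk -tq.
  exact: spec_sec_irr.
pose s0 : spec_stalks V := fun p => sval (desc p).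
have s0P q (hq : q \in opens_set O) (hV : spec_fun q \in opens_set V) :
    loc_map (s0 (SigSub hV)) = (t : spec_sec O) (SigSub hq).
  exact: (svalP (desc (SigSub hV)) q hq erefl).
have sreg : s0 \in regular (U := V).
  apply/asboolP => -[p hp].
  have [q qp] : exists q, spec_fun q = p := spec_fun_surj (Vf p (set_mem hp)).
  subst p.
  have hq : q \in opens_set O by apply/mem_set/OV; exact: set_mem.
  have /asboolP/(_ (SigSub hq))[W [b [c [Wq tE]]]] :=
    spec_sec_regular (t : spec_sec O).
  have [hc _] := tE (SigSub hq) Wq.
  have [a [d ad]] := loc_map_frac b hc.
  exists (Opens (spec_fun_open (opens_open (opens_setI O W)))), a, d.
  split; first by exists q => //; split=> //; exact: set_mem.
  move=> [p hr] [r [Or Wr] rp]; have {}rp : spec_fun r = p := rp; subst p.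
  have [hcr tr] := tE (SigSub (mem_set Or)) Wr.
  have [k adk] := ad r hcr; exists k.
  by apply: (@loc_map_inj r); rewrite adk (s0P r (mem_set Or)).
exists (SpecSec sreg); apply: spec_sec_ext => -[q hq].
have hV : spec_fun q \in opens_set V by apply/mem_set/OV; exact: set_mem.
by rewrite (pull_Spec _ _ _ hV); exact: s0P.
Qed.

End SpecMap.

(** * Basic open sets and finite products *)

Section Away.
Variables (A : comPzRingType) (f : A).

Definition away_stalks : Type := spec_stalks (basic f).
HB.instance Definition _ := GRing.ComPzRing.on away_stalks.

(** The fractions [a / f ^+ n], as functions on the basic open set of [f]: the
    image of [A_f] in the product of the local rings. *)
Definition away_pred : {pred away_stalks} := fun s =>
  `[< exists a n, forall q : set_type (basic f),
      exists h : denominators (set_val q) (f ^+ n), s q = frac a h >].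

Let f_den (q : set_type (basic f)) n : denominators (set_val q) (f ^+ n).
Proof. by move=> /primeX; exact: (set_valP q). Qed.

Fact away_subring : subring_closed away_pred.
Proof.
split.
- apply/asboolP; exists 1, 0%N => q; exists (@f_den q 0).
  by rewrite -[LHS]/(1 : localization _) -(fracss (@f_den q 0)); congr frac;
    rewrite expr0.
- move=> s t /asboolP[a [n sE]] /asboolP[b [m tE]]; apply/asboolP.
  exists (a * f ^+ m - b * f ^+ n), (n + m)%N => q; exists (@f_den q _).
  have [h sq] := sE q; have [k tq] := tE q.
  transitivity (s q - t q) => //; rewrite sq tq fracB.
  by apply: frac_eq_mul; rewrite exprD.
- move=> s t /asboolP[a [n sE]] /asboolP[b [m tE]]; apply/asboolP.
  exists (a * b), (n + m)%N => q; exists (@f_den q _).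
  have [h sq] := sE q; have [k tq] := tE q.
  transitivity (s q * t q) => //; rewrite sq tq fracM.
  by apply: frac_eq_mul; rewrite exprD.
Qed.

Record away := Away {
  away_fun :> away_stalks;
  away_funP : away_fun \in away_pred
}.

HB.instance Definition _ := [isSub for away_fun].
HB.instance Definition _ := [Choice of away by <:].
HB.instance Definition _ := GRing.SubChoice_isSubComPzRing.Build
  away_stalks away_pred away away_subring.

Lemma away_ext (s t : away) : (forall q, away_fun s q = away_fun t q) -> s = t.
Proof. by move=> st; apply: val_inj; exact: functional_extensionality_dep. Qed.

Fact away_frac_subproof a n :
  (fun q => frac a (@f_den q n)) \in away_pred.
Proof. by apply/asboolP; exists a, n => q; exists (@f_den q n). Qed.

Definition away_frac a n : away := Away (away_frac_subproof a n).

Lemma away_fracP (b : away) : exists a n, b = away_frac a n.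
Proof.
have /asboolP[a [n bE]] := away_funP b; exists a, n; apply: away_ext => q.
by have [h ->] := bE q; exact: frac_irr.
Qed.

Definition away_map0 (a : A) : away := away_frac a 0.

Let away_map0B : zmod_morphism away_map0.
Proof.
move=> a b; apply: away_ext => q.
rewrite -[RHS]/(frac a (@f_den q 0) - frac b (@f_den q 0)) fracB.
by apply: frac_eq_mul; rewrite expr0 !mulr1.
Qed.

Let away_map0M : monoid_morphism away_map0.
Proof.
split=> [|a b]; apply: away_ext => q.
  by rewrite -[RHS]/(1 : localization _) -(fracss (@f_den q 0)); congr frac;
    rewrite expr0.
rewrite -[RHS]/(frac a (@f_den q 0) * frac b (@f_den q 0)) fracM.
by apply: frac_eq_mul; rewrite expr0 !mulr1.
Qed.

Definition away_map : {rmorphism A -> away} :=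
  rmorphism_of away_map0B away_map0M.

Lemma away_maps_iso : maps_iso (Spec_map away_map) (opens_setT _) (basic f).
Proof.
have fracMf (c a : A) n (q : set_type (basic f)) :
    frac c (@f_den q 0) * frac a (@f_den q n) = frac (c * a) (@f_den q n).
  by rewrite fracM; apply: frac_eq_mul; rewrite expr0 mul1r.
apply: Spec_map_maps_iso.
- exists (away_frac 1 1); apply: away_ext => q.
  rewrite -[LHS]/(frac f (@f_den q 0) * frac 1 (@f_den q 1)) fracMf mulr1.
  rewrite -[RHS]/(1 : localization _) -(fracss (@f_den q 1)); congr frac.
- move=> b; have [a [n ->]] := away_fracP b; exists n, a.
  rewrite -rmorphXn; apply: away_ext => q.
  rewrite -[RHS]/(frac (f ^+ n) (@f_den q 0) * frac a (@f_den q n)) fracMf.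
  by apply: frac_eq_mul; rewrite expr0 mulr1 mulrC.
- move=> p a pf; pose q : set_type (basic f) :=
  SigSub (mem_set (pf : basic f p)).
  move=> /(congr1 (fun s : away => away_fun s q)).
  move=> /frac_eqP[u pu]; rewrite mulr1 mul0r mulr0 => e.
  by exists u.
Qed.

End Away.

Section ProductSpectra.
Variables (I : finType) (B : I -> comPzRingType).

Definition factor_proj_fun (i : I) (x : prod_ring B) : B i := x i.

Let factor_proj_funB i : zmod_morphism (@factor_proj_fun i). Proof. by []. Qed.
Let factor_proj_funM i : monoid_morphism (@factor_proj_fun i). Proof. by [].
  Qed.

Definition factor_proj (i : I) : {rmorphism prod_ring B -> B i} :=
  rmorphism_of (@factor_proj_funB i) (@factor_proj_funM i).

Definition single i (b : B i) : prod_ring B := dfwith (fun j => 0 : B j) i b.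

Lemma single_same i (b : B i) : single b i = b.
Proof. exact: dfwith_in. Qed.

Lemma single_diff i j (b : B i) : i != j -> single b j = 0.
Proof. exact: dfwith_out. Qed.

Definition factor_open i : opens (Spec_space (prod_ring B)) :=
  basic (single (1 : B i)).

Lemma factor_maps_iso i : maps_iso (Spec_map (factor_proj i)) (opens_setT _)
  (factor_open i).
Proof.
have pe : factor_proj i (single (1 : B i)) = 1 by exact: single_same.
apply: Spec_map_maps_iso.
- by exists 1; rewrite pe mulr1.
- by move=> b; exists 0%N, (single b); rewrite expr0 mul1r; exact: single_same.
move=> p a pi ai; exists (single (1 : B i)) => //.
apply: functional_extensionality_dep => j.
rewrite -[LHS]/(single (1 : B i) j * a j).
have [ij|ij] := eqVneq i j; last by rewrite single_diff // mul0r.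
by subst j; rewrite -[a i]/(factor_proj i a) ai mulr0.
Qed.

(** The idempotents of different factors have product 0. *)
Lemma factor_disjoint i j p : factor_open i p -> factor_open j p -> i = j.
Proof.
move=> pi pj; apply/eqP; apply/negPn/negP => ij.
have : (p : spec _) (single (1 : B i) * single (1 : B j)).
  suff -> : single (1 : B i) * single (1 : B j) = 0 by exact: prime0.
  apply: functional_extensionality_dep => k.
  rewrite -[LHS]/(single (1 : B i) k * single (1 : B j) k).
  have [ik|ik] := eqVneq i k; last by rewrite single_diff // mul0r.
  by subst k; rewrite (@single_diff j i) ?mulr0 // eq_sym.
by case/primeM.
Qed.

(** The idempotents of the factors sum to 1. *)
Lemma factor_cover p : exists i, factor_open i p.
Proof.
apply: contrapT => h.
have ep i : (p : spec _) (single (1 : B i)).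
  by apply: contrapT => pi; apply: h; exists i.
apply: (@prime1 _ p); have -> : 1 = \sum_i single (1 : B i).
  apply: functional_extensionality_dep => j.
  rewrite -[RHS]/(factor_proj j _) raddf_sum /= (bigD1 j) //= big1 ?addr0.
    by rewrite [RHS]single_same.
  by move=> i ij; exact: single_diff.
by elim/big_ind: _ => //; [exact: prime0|move=> x y; exact: primeD].
Qed.

End ProductSpectra.

(** * Schemes *)

Section Scheme.
Variable X : scheme.

(** An affine chart can be shrunk to a basic open set, which is again affine. *)
Lemma affine_neighbourhood (x : X) (O : set X) : open O -> O x ->
  exists (A : comPzRingType) (f : rs_mor (Spec_space A) X) (U : opens X),
    [/\ opens_set U x, U `<=` O & maps_iso f (opens_setT _) U].
Proof.
move=> oO Ox; have [A [f [U [Ux isof]]]] := sch_locally_affine x.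
have [p _ px] := maps_iso_surj isof Ux.
have /spec_openP[E OE] : open (f @^-1` O).
  by move/continuousP : (@rs_continuous _ _ f); exact.
have : (f @^-1` O) p by rewrite /= px.
rewrite OE => /existsNP[a /not_implyP[Ea pa]].
have aO : basic a `<=` f @^-1` O by rewrite OE => q qa /(_ a Ea).
pose V := Opens (maps_iso_open isof (opens_open (basic a)) (@subsetT _ _)).
exists (away a), (rs_comp f (Spec_map (away_map a))), V; split.
- by exists p.
- by move=> _ [q /aO fq <-].
- exact: (maps_iso_comp (away_maps_iso a) isof).
Qed.

Lemma scheme_kolmogorov : kolmogorov_space X.
Proof.
move=> x y; have [A [f [U [Ux isof]]]] := sch_locally_affine x.
have [Uy|Uy] := pselect (U y); last first.
  by exists U; left; split; apply/mem_set => //; apply: open_nbhs_nbhs;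
    split => //; exact: opens_open.
have [p _ <-] := maps_iso_surj isof Ux; have [q _ <-] := maps_iso_surj isof Uy.
have sep (r s : spec A) : ~ (r `<=` s) -> exists2 V : set X,
  open V & V (f s) /\ ~ V (f r).
  move=> /existsNP[a /not_implyP[ra sa]]; exists (f @` basic a).
    by apply: (maps_iso_open isof); [exact: (opens_open (basic a))|].
  split; first by exists s.
  by move=> [t ta /(maps_iso_inj isof Logic.I Logic.I) tr]; apply: ta;
    rewrite tr.
move=> pq; have [qp|/sep[V oV [Vp Vq]]] := pselect (q `<=` p).
  have [pq'|/sep[V oV [Vp Vq]]] := pselect (p `<=` q).
    by case/eqP: pq; congr (f _); apply: spec_inj; apply/seteqP.
  exists V; right; split; apply/mem_set => //.
  exact: open_nbhs_nbhs.
exists V; left; split; apply/mem_set => //.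
exact: open_nbhs_nbhs.
Qed.

End Scheme.

Section SumOfSpectra.
Variables (I : choiceType) (A : I -> comPzRingType).

Let sum_locally_affine (x : rs_sum (fun i => Spec_space (A i))) :
  exists (R : comPzRingType) (f : rs_mor (Spec_space R) (rs_sum (fun i =>
    Spec_space (A i))))
    (U : opens (rs_sum (fun i => Spec_space (A i)))),
  opens_set U x /\ maps_iso f (opens_setT _) U.
Proof.
exists (A (projT1 x)), (@rs_inj _ (fun i => Spec_space (A i)) (projT1 x)).
by exists (summand _ (projT1 x)); split;
  [exact/in_summand|exact: rs_inj_maps_iso].
Qed.

Definition sum_of_spectra : scheme := Scheme sum_locally_affine.

End SumOfSpectra.

(** * Sections of local isomorphisms *)

(** The sum of affine neighbourhoods that miss [A] or [B], one at each point,
    maps onto [X]. The summands hit by a section cut [X] into two clopen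
    parts. *)
Lemma separation_from_sections (X : scheme) :
  (forall (U : scheme) (f : scheme_mor U X),
     set_surj [set: U] [set: X] f -> local_isomorphism f ->
     exists g : scheme_mor X U, is_section f g) ->
  clopen_separation X.
Proof.
move=> sections A B cA cB AB.
have nbhd (x : X) : {d : {R : comPzRingType & (rs_mor (Spec_space R) X * opens
  X)%type} |
    [/\ opens_set (projT2 d).2 x,
        (projT2 d).2 `<=` ~` A \/ (projT2 d).2 `<=` ~` B &
        maps_iso (projT2 d).1 (opens_setT _) (projT2 d).2]}.
  apply: cid; have [O [oO Ox OAB]] : exists O : set X,
      [/\ open O, O x & O `<=` ~` A \/ O `<=` ~` B].
    have [Ax|Ax] := pselect (A x); last first.
      by exists (~` A); split; [exact: closed_openC| |left].
    exists (~` B); split; [exact: closed_openC| |by right].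
    by move=> Bx; have : (A `&` B) x by []; rewrite AB.
  have [R [f [U [Ux UO isof]]]] := affine_neighbourhood oO Ox.
  exists (existT _ R (f, U)); split=> //=.
  by case: OAB => h; [left|right]; exact: subset_trans h.
pose R x := projT1 (sval (nbhd x)).
pose f x : rs_mor (Spec_space (R x)) X := (projT2 (sval (nbhd x))).1.
pose U x : opens X := (projT2 (sval (nbhd x))).2.
have Ux x : U x x by case: (svalP (nbhd x)).
have UAB x : U x `<=` ~` A \/ U x `<=` ~` B by case: (svalP (nbhd x)).
have isof x : maps_iso (f x) (opens_setT _) (U x) by case: (svalP (nbhd x)).
pose C := @sum_of_spectra X R.
pose h : rs_mor C X := @rs_copair X (fun x => Spec_space (R x)) X f.
have isoh x : maps_iso h (summand _ x) (U x) by exact: (rs_copair_maps_iso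
  (isof x)).
have loch : forall y : C, exists W V, opens_set W y /\ maps_iso h W V.
  by move=> y; exists (summand _ (projT1 y)), (U (projT1 y)); split => //;
    exact/in_summand.
have [x _|g [gK _]] := sections C (SchemeMor (local_on_stalks_of_maps_iso
  loch)) _ loch.
  by have [y _ yx] := maps_iso_surj (isoh x) (Ux x); exists y.
pose S (P : set X) := g @^-1` (\bigcup_(x in P) summand (fun x =>
  Spec_space (R x)) x).
have oS P : open (S P).
  have /continuousP := @rs_continuous _ _ g; apply; apply: bigcup_open => x _.
  exact: opens_open.
have SE P x : S P x <-> P (projT1 (g x)).
  split=> [[y Py /in_summand ->] //|Pg]; exists (projT1 (g x)) => //;
    exact/in_summand.
have Ug x : U (projT1 (g x)) x.
  rewrite -{2}[x]gK; apply: (maps_iso_fun (isoh _)); exact/in_summand.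
pose P := [set x | U x `<=` ~` A].
exists (S (~` P)); split.
- split=> //; rewrite -openC; have -> : ~` S (~` P) = S P; last exact: oS.
  apply/seteqP; split=> x; last by move=> /SE Px /SE.
  by move=> nS; apply/SE; apply: contrapT => nP; apply: nS; exact/SE.
- by move=> x Ax; apply/SE => UA; exact: (UA x (Ug x) Ax).
- apply/disjoints_subset => x /SE nP Bx; have [//|UB] := UAB (projT1 (g x)).
  exact: (UB x (Ug x) Bx).
Qed.

(** Label the points by a clopen partition subordinate to the open sets over
    which [f] has local inverses. The parts of [U] that the chosen local
    inverses hit form an open set, which [f] maps isomorphically onto [X]. *)
Lemma sections_from_separation (X : scheme) : quasicompact X ->
  clopen_separation X -> forall (U : scheme) (f : scheme_mor U X),
  set_surj [set: U] [set: X] f -> local_isomorphism f ->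
  exists g : scheme_mor X U, is_section f g.
Proof.
move=> X_qc sepX U f surjf locf.
have /choice[d dP] (x : X) : exists d : opens U * opens X,
    opens_set d.2 x /\ maps_iso f d.1 d.2.
  have [y _ yx] := surjf x Logic.I; have [W [V [Wy isof]]] := locf y.
  by exists (W, V); split=> //=; rewrite -yx; exact: (maps_iso_fun isof).
have [|x|s [c [oc cP]]] := clopen_labelling (U := fun x =>
  opens_set (d x).2) X_qc sepX.
- by move=> x; exact: opens_open.
- by exists x; have [] := dP x.
pose Q x : opens X := Opens (oc x).
have Qd x : Q x `<=` (d x).2 by move=> z <-; have [] := cP z.
pose W x := opens_setI (d x).1 (rs_preimage f (Q x)).
have isoW x : maps_iso f (W x) (Q x).
  by have [_ isof] := dP x; exact: (maps_iso_restrict isof).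
have oW : open (\bigcup_x W x) by apply: bigcup_open => x _; exact: opens_open.
have isof : maps_iso f (Opens oW) (opens_setT X).
  apply: (maps_iso_glue isoW) => //.
    by apply/seteqP; split=> // x _; exists (c x).
  move=> y y' [x _ Wy] [x' _ Wy'] e.
  have xx' : x = x'.
    by case: Wy Wy' => _ /= <- [_ /= <-]; rewrite e.
  by subst x'; exact: (maps_iso_inj (isoW x)).
have loci : local_on_stalks (rs_inv isof).
  apply: local_on_stalks_of_maps_iso => x; exists (opens_setT X), (Opens oW).
  by split=> //; exact: rs_inv_maps_iso.
by exists (SchemeMor loci); exact: rs_inv_section.
Qed.

(** * Affineness *)

(** The members of a finite clopen partition lying in affine open sets are
    affine, and a finite sum of spectra is the spectrum of the product. *)
Lemma affine_from_separation (X : scheme) :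
  quasicompact X -> clopen_separation X -> affine X.
Proof.
move=> X_qc sepX.
have chart0 (x : X) : {d : {R : comPzRingType & (rs_mor (Spec_space R) X *
  opens X)%type} |
    opens_set (projT2 d).2 x /\ maps_iso (projT2 d).1 (opens_setT _) (projT2
      d).2}.
  apply: cid; have [R [f [U [Ux isof]]]] := sch_locally_affine x.
  by exists (existT _ R (f, U)).
have [|x|s [c [oc cP]]] :=
    clopen_labelling (U := fun x =>
      opens_set (projT2 (sval (chart0 x))).2) X_qc sepX.
- by move=> x; exact: opens_open.
- by exists x; have [] := svalP (chart0 x).
pose I : finType := seq_sub s; pose Q (i : I) : opens X := Opens (oc (ssval i)).
have cQ i : closed (Q i).
  rewrite -openC; have -> : ~` Q i = \bigcup_(x in ~` [set ssval i]) (c @^-1`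
    [set x]).
    apply/seteqP; split=> [x cx|x [z zi cz] e]; first by exists (c x).
    by apply: zi; rewrite -cz.
  by apply: bigcup_open => x _; exact: oc.
have chartQ (i : I) : {d : {R : comPzRingType & rs_mor (Spec_space R) X} |
    maps_iso (projT2 d) (opens_setT _) (Q i)}.
  apply: cid; pose R := projT1 (sval (chart0 (ssval i))).
  pose f : rs_mor (Spec_space R) X := (projT2 (sval (chart0 (ssval i)))).1.
  pose U : opens X := (projT2 (sval (chart0 (ssval i)))).2.
  have isof : maps_iso f (opens_setT _) U by case: (svalP (chart0 (ssval i))).
  have QU : Q i `<=` U by move=> x /= cx; have [_] := cP x; rewrite cx.
  have cf : clopen (f @^-1` Q i).
    split; first exact: (opens_open (rs_preimage f (Q i))).
    rewrite -openC preimage_setC.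
    by have /continuousP := @rs_continuous _ _ f; apply; exact: closed_openC.
  have [b bE] := clopen_basic (spec_chart R) cf.
  exists (existT (fun R : comPzRingType =>
    rs_mor (Spec_space R) X) (away b) (rs_comp f (Spec_map (away_map b)))).
  apply: (maps_iso_comp (away_maps_iso b) isof) => //.
  rewrite -[RHS]/(f @` (~` [set p | (spec_chart R p : set R) b])) -bE.
  apply/seteqP; split=> [x Qx|_ [p Qp <-] //].
  by have [p _ px] := maps_iso_surj isof (QU x Qx); exists p => //=; rewrite px.
pose R i := projT1 (sval (chartQ i)).
pose h i : rs_mor (Spec_space (R i)) X := projT2 (sval (chartQ i)).
pose C := rs_sum (fun i => Spec_space (R i)).
have isoX : maps_iso (rs_copair h) (opens_setT C) (opens_setT X).
  apply: (rs_copair_iso (Q := Q)) => [i|i j x ci cj|x _].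
    exact: (svalP (chartQ i)).
    by apply: val_inj; exact: etrans (esym ci) cj.
  by have [cs _] := cP x; exists (SeqSub cs).
pose k i := Spec_map (@factor_proj I R i).
have isoS : maps_iso (rs_copair k) (opens_setT C) (opens_setT _).
  apply: (rs_copair_iso (Q := fun i => @factor_open I R i)) => [i|i j p|p _].
  - exact: factor_maps_iso.
  - exact: factor_disjoint.
  - by have [i] := factor_cover p; exists i.
exists (prod_ring R), (rs_comp (rs_copair h) (rs_inv isoS)).
apply: (maps_iso_comp (rs_inv_maps_iso isoS) isoX) => //.
by apply/seteqP; split=> // x _;
  have [y _ <-] := maps_iso_surj isoX (Logic.I : setT x); exists y.
Qed.

Lemma affine_chart (X : ringed_space) (A : comPzRingType)
    (f : rs_mor (Spec_space A) X) :
  maps_iso f (opens_setT _) (opens_setT X) ->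
  exists rho : spectral_chart X A, forall p, rho (f p) = p.
Proof.
move=> isof.
have fK p : rs_inv_fun isof (f p) = p by exact: rs_inv_funE.
have Kf x : f (rs_inv_fun isof x) = x by exact: rs_inv_funK.
have closedP (Z : set X) :
    closed Z <-> exists E : set A, Z = [set x | E `<=` rs_inv_fun isof x].
  split=> [cZ|[E ->]].
    have /spec_closedP[E EZ] : closed (f @^-1` Z).
      rewrite -openC preimage_setC.
      by have /continuousP := @rs_continuous _ _ f; apply; exact: closed_openC.
    exists E; apply/seteqP; split=> x.
      by rewrite -{1}[x]Kf => Zx; have : (f @^-1` Z) (rs_inv_fun isof x) by [];
        rewrite EZ.
    move=> Ex; have Zx : (f @^-1` Z) (rs_inv_fun isof x) by rewrite EZ.
    by move: Zx; rewrite /= Kf.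
  have -> : [set x | E `<=` rs_inv_fun isof x] = rs_inv_fun isof @^-1` [set p |
    E `<=` p] by [].
  rewrite -openC preimage_setC.
  have /continuousP := @inv_continuous _ _ _ _ isof; apply; apply: closed_openC.
  by apply/spec_closedP; exists E.
have inj : injective (rs_inv_fun isof) by exact: (can_inj Kf).
have surj p : exists x, rs_inv_fun isof x = p by exists (f p).
by exists (SpectralChart inj surj closedP).
Qed.

(** * Sums of idempotents and units *)

Lemma germ_unit_open (X : ringed_space) (V : opens X) (s : rs_sec X V) :
  open [set x | germ_unit x s].
Proof.
have -> : [set x | germ_unit x s] = \bigcup_(W in [set W : opens X |
    exists h : W `<=` V, ring_unit (rs_res X h s)]) (W : set X).
  apply/seteqP; split=> [x [W [h [Wx u]]]|x [W [h u] Wx]];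
    first by exists W => //; exists h.
  by exists W, h.
by apply: bigcup_open => W _; exact: opens_open.
Qed.

Lemma germ_unit_eq (X : ringed_space) (x : X) (V V' W : opens X)
    (h : W `<=` V) (h' : W `<=` V') (s : rs_sec X V) (t : rs_sec X V') :
  W x -> rs_res X h s = rs_res X h' t -> germ_unit x s -> germ_unit x t.
Proof.
move=> Wx e [O [OV [Ox [y sy]]]].
pose N := opens_setI O W.
have NO : N `<=` O by move=> z [].
have NW : N `<=` W by move=> z [].
exists N, (subset_trans NW h'); split; first by split.
exists (rs_res X NO y).
rewrite -(rs_res_comp h' NW) -e (rs_res_comp h NW (subset_trans NO OV)).
by rewrite -(rs_res_comp OV NO) -rmorphM sy rmorph1.
Qed.

(** If the germ is a unit then so is its image in the local ring at [p]. *)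
Lemma germ_unit_chart (X : ringed_space) (A : comPzRingType)
    (f : rs_mor (Spec_space A) X) p (V : opens X) (s : rs_sec X V)
    (O : opens (Spec_space A)) (h : O `<=` f @^-1` V) (hp : p \in opens_set O)
    a t (ht : denominators p t) :
  germ_unit (f p) s -> (pull f h s : spec_sec O) (SigSub hp) = frac a ht -> ~ p
    a.
Proof.
move=> [W [WV [Wp [y sy]]]] e pa.
pose N := opens_setI O (rs_preimage f W).
have NW : N `<=` f @^-1` W by move=> q [].
have NO : N `<=` O by move=> q [].
have hN : p \in opens_set N by apply/mem_set; split=> //; exact: set_mem.
have : (pull f NW (rs_res X WV s * y) : spec_sec N) (SigSub hN) = 1.
  by rewrite sy rmorph1.
rewrite rmorphM (pull_res _ _ (subset_trans NO h)) -(res_pull h NO).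
pose z : localization p := (pull f NW y : spec_sec N) (SigSub hN).
have sO : (rs_res (Spec_space A) NO (pull f h s) : spec_sec N) (SigSub hN) =
    (pull f h s : spec_sec O) (SigSub hp) by 
  exact (@spec_sec_irr A O (pull f h s) p
    (mem_set (NO _ (set_valP (SigSub hN : set_type N)))) hp).
rewrite -[X in X = 1]/((rs_res (Spec_space A) NO (pull f h s) : spec_sec N)
  (SigSub hN) * z).
rewrite sO e; have [c [d [hd ->]]] := fracP z.
rewrite fracM -[1]/(frac 1 (@denominators1 _ p)) => /frac_eqP[u pu].
rewrite mulr1 mul1r => uE.
have : p (u * (t * d)) by rewrite -uE; apply: primeMr; exact: primeMl.
by move=> /primeM[//|/primeM[/ht|/hd]].
Qed.

Lemma spec_germ_unit (A : comPzRingType) (U V : opens (Spec_space A))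
    (s : spec_sec U) p a t : U p -> V p -> ~ p a ->
  (forall r : set_type U, opens_set V (set_val r) ->
    exists h : denominators (set_val r) t, s r = frac a h) ->
  germ_unit (X := Spec_space A) p s.
Proof.
move=> Up Vp pa sE.
pose W := opens_setI U (opens_setI V (basic a)).
have WU : W `<=` U by move=> q [].
have da (r : set_type W) : denominators (set_val r) a.
  by case: (set_valP r) => _ [_].
pose y0 : spec_stalks W := fun r => frac t (@da r).
have yreg : y0 \in regular (U := W).
  by apply/asboolP => q; exists W, t, a; split; [exact: set_valP|move=> r Wr;
    exists (@da r)].
exists W, WU; split; first by [].
exists (SpecSec yreg); apply: spec_sec_ext => r.
have [h e] := sE (Defs.incl WU r) (set_valP r).2.1.
rewrite -[LHS]/(s (Defs.incl WU r) * y0 r) e /y0 fracM.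
rewrite -[RHS]/(1 : localization _) -(fracss (denominatorsM h (@da r))).
by apply: frac_eq_mul; rewrite [a * t]mulrC.
Qed.

Section SchemeUnits.
Variable X : scheme.

(** The stalks are local rings. *)
Lemma germ_unit_or (x : X) (V : opens X) (s : rs_sec X V) : V x ->
  germ_unit x s \/ germ_unit x (s - 1).
Proof.
move=> Vx; have [A [f [U [Ux isof]]]] := sch_locally_affine x.
have [p _ px] := maps_iso_surj isof Ux; subst x.
have locf : local_on_stalks f.
  by apply: local_on_stalks_of_maps_iso => q; exists (opens_setT _), U.
have Vp : rs_preimage f V p by [].
pose t : spec_sec (rs_preimage f V) := rs_comap f V s.
have /asboolP/(_ (SigSub (mem_set Vp)))[W [a [g [Wp tE]]]] :=
  spec_sec_regular t.
have [pa|pa] := pselect ((p : spec A) a); last first.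
  by left; apply: locf => //;
    exact (@spec_germ_unit A (rs_preimage f V) W t p a g Vp Wp pa tE).
right; apply: locf => //; rewrite rmorphB rmorph1.
have [gp _] := tE (SigSub (mem_set Vp)) Wp.
apply: (@spec_germ_unit _ _ W _ p (a - g) g) => //.
  by move=> pag; apply: gp; rewrite -[g](subKr a); exact: primeB.
move=> r Wr; have [h e] := tE r Wr; exists h.
transitivity (t r - 1) => //; rewrite e -(fracss h) fracB.
by apply: frac_eq_mul; ring.
Qed.

(** The stalks are not zero. *)
Lemma germ_unit0 (x : X) (V : opens X) : ~ germ_unit x (0 : rs_sec X V).
Proof.
have [A [f [U [Ux isof]]]] := sch_locally_affine x.
have [p _ px] := maps_iso_surj isof Ux; subst x => u.
have [W [h [Wp _]]] := u.
have Vp : p \in opens_set (rs_preimage f V) by apply/mem_set; exact: h.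
have hV : rs_preimage f V `<=` f @^-1` V by [].
apply: (@germ_unit_chart X A f p V 0 _ hV Vp 0 1 (@denominators1 _ p) u).
  by rewrite rmorph0.
exact: prime0.
Qed.

(** In a stalk, which is a local ring, the idempotent [e] of [r = e + u] is 0 or
    1. It is not 0 if [r] is not a unit there, and not 1 if [r - 1] is not. *)
Lemma separation_from_clean : affine X ->
  (forall r : global_sections X, exists e u : global_sections X,
    [/\ e * e = e, ring_unit u & r = e + u]) ->
  clopen_separation X.
Proof.
move=> [A [f isof]] clean F G cF cG FG.
have [rho rhof] := affine_chart isof.
have [a [b [Fa Gb ab]]] := closed_disjoint_comaximal rho cF cG FG.
pose T := opens_setT (Spec_space A).
have hT : T `<=` f @^-1` opens_setT X by [].
pose c0 : spec_stalks T := fun q => frac a (@denominators1 _ (set_val q)).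
have creg : c0 \in regular (U := T).
  by apply/asboolP => q; exists T, a, 1; split=> // r _;
    exists (@denominators1 _ _).
have [r rE] := maps_iso_pull_surj isof hT (SpecSec creg) (@subset_refl _ _)
  (esym (setTI _)).
have rF x : F x -> ~ germ_unit x r.
  have [p _ <-] := maps_iso_surj isof (Logic.I : setT x).
  move=> Fp /(germ_unit_chart (h := hT) (hp := mem_set (Logic.I : T p))) h.
  apply: (h a 1 (@denominators1 _ p)); first by rewrite rE.
  by have := Fa _ Fp; rewrite rhof.
have rG x : G x -> ~ germ_unit x (r - 1).
  have [p _ <-] := maps_iso_surj isof (Logic.I : setT x).
  move=> Gp /(germ_unit_chart (h := hT) (hp := mem_set (Logic.I : T p))) h.
  apply: (h (- b) 1 (@denominators1 _ p)).
    rewrite rmorphB rmorph1 rE.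
    rewrite -[LHS]/(frac a (@denominators1 _ p) - frac 1 (@denominators1 _ p))
      fracB.
    by apply: frac_eq_mul; rewrite -ab; ring.
  by apply: primeN; have := Gb _ Gp; rewrite rhof.
have [e [u [ee uu re]]] := clean r.
have De x : germ_unit x e -> ~ germ_unit x (e - 1).
  move=> [W [h [Wx [y ey]]]] [W' [h' [W'x [z ez]]]].
  pose N := opens_setI W W'.
  have NW : N `<=` W by move=> ? [].
  have NW' : N `<=` W' by move=> ? [].
  have NT : N `<=` opens_setT X by [].
  have e1 : rs_res X NT e * rs_res X NW y = 1.
    by rewrite -(rs_res_comp h NW) -rmorphM ey rmorph1.
  have z1 : (rs_res X NT e - 1) * rs_res X NW' z = 1.
    have -> : rs_res X NT e - 1 = rs_res X NW' (rs_res X h' (e - 1)).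
      by rewrite (rs_res_comp _ _ NT) rmorphB rmorph1.
    by rewrite -rmorphM ez rmorph1.
  apply: (@germ_unit0 x N); exists N, (@subset_refl _ _); split=> //; exists 1.
  have E : rs_res X NT e * rs_res X NT e = rs_res X NT e by rewrite -rmorphM ee.
  rewrite rmorph0 mul0r -[RHS](mulr1 1) -{1}e1 -z1.
  set E1 := rs_res X NT e in E *; set Y := rs_res X NW y;
    set Z := rs_res X NW' z.
  by transitivity ((E1 * E1 - E1) * Y * Z); [rewrite E subrr !mul0r|ring].
have germ_u x : germ_unit x u.
  by exists (opens_setT X), (@subset_refl _ _); split=> //; rewrite rs_res_id.
exists [set x | germ_unit x e]; split.
- split; first exact: germ_unit_open.
  rewrite -openC; have -> : ~` [set x | germ_unit x e] = [set x | germ_unit x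
    (e - 1)].
    apply/seteqP; split=> x /=;
      first by have [] := germ_unit_or e (Logic.I : opens_setT X x).
    by move=> h /De.
  exact: germ_unit_open.
- move=> x Fx; have [//|[W [h [Wx [z ez]]]]] :=
  germ_unit_or e (Logic.I : opens_setT X x).
  case: (rF x Fx); apply: (germ_unit_eq (h := h) (h' := h) (s := u)) => //.
  rewrite re rmorphD; suff -> : rs_res X h e = 0 by rewrite add0r.
  rewrite -[LHS]mulr1 -ez mulrA -rmorphM mulrBr ee mulr1 subrr rmorph0.
  exact: mul0r.
- apply/disjoints_subset => x [W [h [Wx [y ey]]]] Gx.
  apply: (rG x Gx); apply: (germ_unit_eq (h := h) (h' := h) (s := u)) => //.
  suff e1 : rs_res X h e = 1 by rewrite re rmorphB rmorphD e1 rmorph1; ring.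
  by rewrite -[LHS]mulr1 -[X in _ * X = _]ey mulrA -rmorphM ee ey.
Qed.

(** The idempotent is 1 on a clopen set containing the points where [r] is not a
    unit and 0 on its complement, which contains those where [r - 1] is not. *)
Lemma clean_from_separation : clopen_separation X ->
  forall r : global_sections X, exists e u : global_sections X,
    [/\ e * e = e, ring_unit u & r = e + u].
Proof.
move=> sepX r; pose T := opens_setT X.
have [|||W [[oW cW] FW WG]] :=
  sepX (~` [set x | germ_unit x r]) (~` [set x | germ_unit x (r - 1)]).
- by apply: open_closedC; exact: germ_unit_open.
- by apply: open_closedC; exact: germ_unit_open.
- apply/disjoints_subset => x nr nr1.
  by have [] := germ_unit_or r (Logic.I : T x).
pose P (b : bool) : opens X := if b then Opens oW else Opens (closed_openC cW).
have PT b : P b `<=` T by [].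
have cov : T `<=` \bigcup_b P b.
  by move=> x _; have [Wx|Wx] := pselect (W x); [exists true|exists false].
have [|e eP] := sec_glue PT (s := fun b => if b then 1 else 0) cov.
  move=> b b' O Ob Ob'.
  have [bb'|bb'] := eqVneq b b'; first by subst b'; exact: res_irr.
  apply: sec_eq_empty => x Ox; case: b b' bb' Ob Ob' => -[] //= _ Ob Ob'.
    by case: (Ob' x Ox); exact: Ob.
  by case: (Ob x Ox); exact: Ob'.
exists e, (r - e); split; last by rewrite addrC subrK.
  apply: (sec_eq (WU := PT)) => // b; rewrite rmorphM eP.
  by case: b; rewrite ?mulr1 ?mul0r.
apply: ring_unit_local => x _; have [Wx|Wx] := pselect (W x).
  have ux : germ_unit x (r - 1).
    apply: contrapT => nx; have : (W `&` ~` [set x | germ_unit x (r - 1)]) x by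
      [].
    by rewrite WG.
  apply: (germ_unit_eq (h := PT true) (h' := PT true) _ _ ux) => //.
  by rewrite !rmorphB eP rmorph1.
have ux : germ_unit x r by apply: contrapT => nx; apply: Wx; exact: FW.
apply: (germ_unit_eq (h := PT false) (h' := PT false) _ _ ux) => //.
by rewrite !rmorphB eP subr0.
Qed.

End SchemeUnits.

(** * Abelian sheaves *)

Definition additive_of (A B : zmodType) (f : A -> B) (fB : zmod_morphism f) :
    {additive A -> B} :=
  HB.pack f (GRing.isZmodMorphism.Build A B f fB).

Section AbSheaf.
Variables (T : topologicalType) (F : ab_sheaf T).
Implicit Types (U V W O : opens T).

Lemma ab_res_irr U V (h h' : V `<=` U) s : ab_res F h s = ab_res F h' s.
Proof. by rewrite (Prop_irrelevance h h'). Qed.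

Lemma ab_sec_eq U (I : Type) (W : I -> opens T) (WU : forall i,
  W i `<=` U) s t :
  U `<=` \bigcup_i W i ->
  (forall i, ab_res F (WU i) s = ab_res F (WU i) t) -> s = t.
Proof.
move=> cov st.
have [|v [_ vuniq]] := ab_is_sheaf WU (s := fun i => ab_res F (WU i) s) cov.
  by move=> i j O Oi Oj; rewrite !(ab_res_comp _ _ (subset_trans Oi (WU i))).
by rewrite -(vuniq s) // -(vuniq t) // => i; rewrite st.
Qed.

Lemma ab_sec_eq_local U s t :
  (forall x, U x -> exists V (h : V `<=` U),
    V x /\ ab_res F h s = ab_res F h t) ->
  s = t.
Proof.
move=> loc.
have /choice[W WP] (x : set_type U) : exists V, exists h : V `<=` U,
    V (set_val x) /\ ab_res F h s = ab_res F h t by apply: loc; exact: set_valP.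
have WU x : W x `<=` U by have [h _] := WP x.
apply: (ab_sec_eq (WU := WU)) => [x Ux|x].
  exists (SigSub (mem_set Ux)) => //.
  by have [_ [Wx _]] := WP (SigSub (mem_set Ux)); exact: Wx.
by have [h [_ e]] := WP x; rewrite !(ab_res_irr (WU x) h).
Qed.

Lemma ab_sec_glue U (I : Type) (W : I -> opens T) (WU : forall i, W i `<=` U)
    (s : forall i, F (W i)) :
  U `<=` \bigcup_i W i ->
  (forall i j O (Oi : O `<=` W i) (Oj : O `<=` W j),
     ab_res F Oi (s i) = ab_res F Oj (s j)) ->
  exists t, forall i, ab_res F (WU i) t = s i.
Proof. by move=> cov /(ab_is_sheaf WU cov)[t [tP _]]; exists t. Qed.

Lemma ab_sec_eq_empty U (s t : F U) : U `<=` set0 -> s = t.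
Proof. by move=> U0; apply: ab_sec_eq_local => x /U0. Qed.

End AbSheaf.

Section Exactness.
Variables (T : topologicalType) (F G H : ab_sheaf T).
Variables (f : ab_mor F G) (g : ab_mor G H).
Hypothesis fg : ab_exact f g.

(** When [f] is a monomorphism, local preimages are unique, hence glue. *)
Lemma mono_exact_lift (U : opens T) (s : G U) :
  ab_mono f -> g U s = 0 -> exists t, f U t = s.
Proof.
move=> fmono gs.
have loc (x : set_type U) : {d : {V : opens T & F V} |
    exists h : projT1 d `<=` U, projT1 d (set_val x) /\
      f _ (projT2 d) = ab_res G h s}.
  apply: cid; have [V [VU [t [Vx e]]]] := fg.2 U s gs _ (set_valP x).
  by exists (existT _ V t), VU.
pose W x : opens T := projT1 (sval (loc x)).
pose t x : F (W x) := projT2 (sval (loc x)).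
have WU x : W x `<=` U by case: (svalP (loc x)).
have tE x : f _ (t x) = ab_res G (WU x) s.
  by case: (svalP (loc x)) => h [_ e]; rewrite (ab_res_irr (WU x) h).
have cov : U `<=` \bigcup_x W x.
  move=> x Ux; exists (SigSub (mem_set Ux)) => //.
  by case: (svalP (loc (SigSub (mem_set Ux)))) => h [].
have [|v vP] := ab_sec_glue WU (s := t) cov.
  move=> i j O Oi Oj; apply: fmono; rewrite !ab_nat !tE.
  by rewrite !(ab_res_comp _ _ (subset_trans Oi (WU i))).
exists v; apply: (ab_sec_eq (WU := WU)) => // x.
by rewrite -ab_nat vP tE.
Qed.

(** Local lifts over the members of a clopen partition glue, because there are
    no overlaps. *)
Lemma separation_exact_lift (s : G (opens_setT T)) :
  quasicompact T -> clopen_separation T -> g _ s = 0 -> exists t, f _ t = s.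
Proof.
move=> T_qc sepT gs; pose U := opens_setT T.
have loc (x : T) : {d : {V : opens T & F V} |
    exists h : projT1 d `<=` U, projT1 d x /\
      f _ (projT2 d) = ab_res G h s}.
  apply: cid; have [V [VU [t [Vx e]]]] := fg.2 U s gs x Logic.I.
  by exists (existT _ V t), VU.
pose W x : opens T := projT1 (sval (loc x)).
pose t x : F (W x) := projT2 (sval (loc x)).
have WU x : W x `<=` U by case: (svalP (loc x)).
have tE x : f _ (t x) = ab_res G (WU x) s.
  by case: (svalP (loc x)) => h [_ e]; rewrite (ab_res_irr (WU x) h).
have [x|x|s0 [c [oc cP]]] := clopen_labelling (U := fun x =>
  opens_set (W x)) T_qc sepT.
- exact: opens_open.
- by exists x; case: (svalP (loc x)) => h [].
pose P x : opens T := Opens (oc x).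
have PW x : P x `<=` W x by move=> y <-; have [] := cP y.
have PU x : P x `<=` U by [].
have cov : U `<=` \bigcup_x P x by move=> x _; exists (c x).
have [|v vP] := ab_sec_glue PU (s := fun x => ab_res F (PW x) (t x)) cov.
  move=> x y O Ox Oy; have [xy|xy] := pselect (x = y).
    by subst y; exact: ab_res_irr.
  apply: ab_sec_eq_empty => z Oz; apply: xy.
  exact: etrans (esym (Ox z Oz)) (Oy z Oz).
exists v; apply: (ab_sec_eq (WU := PU)) => // x.
by rewrite -ab_nat vP ab_nat tE (ab_res_comp _ _ (PU x)).
Qed.

End Exactness.

(** * Sheaves of functions *)

(** For [K = T] this is the sheaf of all functions; in general it is a product of
    skyscraper sheaves, one for each [k]. *)
Section FunSheaf.
Variables (T : topologicalType) (K : Type) (pi : K -> T) (D : zmodType).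
Implicit Types (U V W : opens T).

Definition fun_sec U : zmodType := {k : K | U (pi k)} -> D.

Definition fun_res0 U V (h : V `<=` U) (s : fun_sec U) : fun_sec V :=
  fun k => s (exist _ (sval k) (h _ (svalP k))).

Let fun_res0B U V (h : V `<=` U) : zmod_morphism (@fun_res0 U V h).
Proof. by []. Qed.

Definition fun_res U V (h : V `<=` U) : {additive fun_sec U -> fun_sec V} :=
  additive_of (@fun_res0B U V h).

Lemma fun_sec_irr U (s : fun_sec U) k (h h' : U (pi k)) :
  s (exist _ k h) = s (exist _ k h').
Proof. by rewrite (Prop_irrelevance h h'). Qed.

Fact fun_res_id U (h : U `<=` U) s : fun_res h s = s.
Proof. by apply: funext => -[k hk]; exact (fun_sec_irr s _ _). Qed.

Fact fun_res_comp U V W (VU : V `<=` U) (WV : W `<=` V) (WU : W `<=` U) s :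
  fun_res WV (fun_res VU s) = fun_res WU s.
Proof. by apply: funext => -[k hk]; exact (fun_sec_irr s _ _). Qed.

Fact fun_is_sheaf : is_sheaf (fun U V h => @fun_res U V h).
Proof.
move=> U I W WU s cov compat.
have agree i j k (hi : W i (pi k)) (hj : W j (pi k)) :
    s i (exist _ k hi) = s j (exist _ k hj).
  pose O := opens_setI (W i) (W j).
  have Oi : O `<=` W i by move=> x [].
  have Oj : O `<=` W j by move=> x [].
  have := congr1 (fun r : fun_sec O =>
    r (exist _ k (conj hi hj))) (compat i j O Oi Oj).
  rewrite /= /fun_res0 /= => e.
  exact: etrans (fun_sec_irr _ _ _) (etrans e (fun_sec_irr _ _ _)).
have ch (k : {k : K | U (pi k)}) : {i | W i (pi (sval k))}.
  by apply: cid; have [i _ Wk] := cov _ (svalP k); exists i.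
exists (fun k => s (sval (ch k)) (exist _ (sval k) (svalP (ch k)))); split.
  by move=> i; apply: funext => -[k hk]; exact: agree.
move=> t tP; apply: funext => -[k hk] /=.
set i := sval _; have Wk : W i (pi k) := svalP (ch (exist _ k hk)).
rewrite (fun_sec_irr _ _ Wk) -tP; exact (fun_sec_irr t _ _).
Qed.

Definition fun_sheaf : ab_sheaf T :=
  AbSheaf fun_res_id fun_res_comp fun_is_sheaf.

End FunSheaf.

(** * Locally constant functions vanishing on a closed set *)

Section LocallyConstant.
Variables (T : topologicalType) (Z : set T).
Implicit Types (U V W : opens T).

Let all_functions := fun_sheaf (@id T) int.

Definition lc_pred U : {pred all_functions U} := fun s => `[< forall x, U x ->
  exists V, V x /\ exists n, forall y (Uy : U y), V y ->
    s (exist _ y Uy) = n /\ (Z y -> n = 0) >].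

Fact lc_zmod U : zmod_closed (@lc_pred U).
Proof.
split; first by apply/asboolP => x Ux; exists U; split=> //; exists 0.
move=> s t /asboolP sP /asboolP tP; apply/asboolP => x Ux.
have [V [Vx [n nP]]] := sP x Ux; have [W [Wx [m mP]]] := tP x Ux.
exists (opens_setI V W); split=> //; exists (n - m) => y Uy [Vy Wy].
have [sn n0] := nP y Uy Vy; have [tm m0] := mP y Uy Wy.
split; first by rewrite -sn -tm.
by move=> Zy; rewrite n0 // m0.
Qed.

Record lc_sec U := LcSec {
  lc_fun :> all_functions U;
  lc_funP : lc_fun \in @lc_pred U
}.

HB.instance Definition _ U := [isSub for @lc_fun U].
HB.instance Definition _ U := [Choice of lc_sec U by <:].
HB.instance Definition _ U := GRing.SubChoice_isSubZmodule.Build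
  (all_functions U) (@lc_pred U) (lc_sec U) (@lc_zmod U).

Fact lc_res_subproof U V (h : V `<=` U) (s : lc_sec U) :
  ab_res all_functions h (lc_fun s) \in @lc_pred V.
Proof.
apply/asboolP => x Vx; have /asboolP/(_ x (h x Vx))[W [Wx [n nP]]] := lc_funP s.
by exists W; split=> //; exists n => y Vy Wy; exact: nP.
Qed.

Definition lc_res0 U V (h : V `<=` U) (s : lc_sec U) : lc_sec V :=
  LcSec (lc_res_subproof h s).

Let lc_res0B U V (h : V `<=` U) : zmod_morphism (@lc_res0 U V h).
Proof. by move=> s t; exact: val_inj. Qed.

Definition lc_res U V (h : V `<=` U) : {additive lc_sec U -> lc_sec V} :=
  additive_of (@lc_res0B U V h).

Fact lc_res_id U (h : U `<=` U) s : lc_res h s = s.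
Proof. by apply: val_inj; exact: (ab_res_id (a := all_functions)). Qed.

Fact lc_res_comp U V W (VU : V `<=` U) (WV : W `<=` V) (WU : W `<=` U) s :
  lc_res WV (lc_res VU s) = lc_res WU s.
Proof. by apply: val_inj; exact: (ab_res_comp (a := all_functions)). Qed.

Fact lc_is_sheaf : is_sheaf (fun U V h => @lc_res U V h).
Proof.
move=> U I W WU s cov compat.
have [|t [tP tuniq]] := ab_is_sheaf (a := all_functions) WU
    (s := fun i => lc_fun (s i)) cov.
  by move=> i j O Oi Oj; exact (congr1 (@lc_fun O) (compat i j O Oi Oj)).
have tlc : t \in @lc_pred U.
  apply/asboolP => x Ux; have [i _ Wx] := cov x Ux.
  have /asboolP/(_ x Wx)[V [Vx [n nP]]] := lc_funP (s i).
  exists (opens_setI V (W i)); split=> //; exists n => y Uy [Vy Wy].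
  have [<- n0] := nP y Wy Vy; split=> //.
  by rewrite -tP /= /fun_res0 /=; exact: (fun_sec_irr t).
exists (LcSec tlc); split=> [i|t' t'P]; apply: val_inj; first exact: tP.
by apply: tuniq => i; rewrite -t'P.
Qed.

Definition lc_sheaf : ab_sheaf T :=
  @AbSheaf T (fun U => lc_sec U : zmodType) lc_res lc_res_id lc_res_comp
    lc_is_sheaf.

Let lc_inclB U : zmod_morphism (@lc_fun U). Proof. by []. Qed.

Definition lc_incl : ab_mor lc_sheaf all_functions :=
  @AbMor T lc_sheaf all_functions (fun U => additive_of (@lc_inclB U))
    (fun U V h s => erefl).

Lemma lc_incl_mono : ab_mono lc_incl.
Proof. by move=> U; exact: val_inj. Qed.

Lemma lc_fun_open U (s : lc_sec U) (P : set int) :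
  open [set x | exists h : U x, P (lc_fun s (exist _ x h))].
Proof.
have /asboolP sP := lc_funP s.
rewrite openE => x [Ux Px].
have [V [Vx [n nP]]] := sP x Ux.
rewrite /interior nbhsE; exists (opens_setI U V).
  by split; [exact: opens_open|].
move=> y [Uy Vy]; exists Uy.
by have [-> _] := nP y Uy Vy; have [<- _] := nP x Ux Vx.
Qed.

End LocallyConstant.

(** Disjoint closed sets [A] and [B] define a torsor under the sheaf of locally
    constant functions vanishing on both: the functions that are 1 on [A] and 0
    on [B]. It has sections over the complements of [A] and of [B], which differ
    by 1, and a global section exists since the class of this cocycle
    vanishes. *)
Lemma separation_from_cohomology (T : topologicalType) :
  (forall F : ab_sheaf T, cohomology_zero F 1) -> clopen_separation T.
Proof.
move=> H1 A B cA cB AB.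
pose F := lc_sheaf (A `|` B); pose G := fun_sheaf (@id T) int.
pose X := opens_setT T.
pose U : opens T := Opens (closed_openC cA);
  pose V : opens T := Opens (closed_openC cB).
pose N := opens_setI U V.
have NU : N `<=` U by move=> x [].
have NV : N `<=` V by move=> x [].
have UX : U `<=` X by []. have VX : V `<=` X by []. have NX : N `<=` X by [].
have [J HJ] := H1 F.
have [psi psiP] := @ir_injective _ _ J 0 F G (lc_incl _) (ir_aug J)
  (@lc_incl_mono _ _).
have one_lc : ((fun=> 1) : G N) \in @lc_pred T (A `|` B) N.
  apply/asboolP => x Nx; exists N; split=> //; exists 1 => y Ny _; split=> //.
  by case: Ny => nA nB [].
pose c : F N := LcSec one_lc.
pose a := psi U (fun=> 1); pose d := ir_d J.
have aN : ab_res (J 0) NU a = ir_aug J N c by rewrite -psiP -ab_nat.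
have dd n (W : opens T) s : d n.+1 W (d n W s) = 0.
  by have [h _] := ir_exact J n; exact: h.
have daN : ab_res (J 1) NU (d 0 U a) = 0.
  by rewrite -ab_nat aN; have [h _] := ir_aug_exact J; exact: h.
(* [d a] vanishes on the overlap [N], hence extends by zero to a global cocycle,
   which is a coboundary. *)
pose W b := if b then U else V.
have WX b : W b `<=` X by [].
have cov : X `<=` \bigcup_b W b.
  move=> x _; have [Ax|Ax] := pselect (A x); last by exists true.
  by exists false => // Bx; have : (A `&` B) x by []; rewrite AB.
have [|e eP] := ab_sec_glue WX (F := J 1)
    (s := fun b => if b return J 1 (W b) then d 0 U a else 0) cov.
  move=> b b' O Ob Ob'; have [bb'|] := eqVneq b b'; first by subst b';
    exact: ab_res_irr.
  case: b b' Ob Ob' => -[] //= Ob Ob' _.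
    have ON : O `<=` N by move=> x Ox; split; [exact: Ob|exact: Ob'].
    by rewrite -(ab_res_comp NU ON) daN !raddf0.
  have ON : O `<=` N by move=> x Ox; split; [exact: Ob'|exact: Ob].
  by rewrite -(ab_res_comp NU ON Ob') daN !raddf0.
have [|t tE] := HJ e.
  apply: (ab_sec_eq (WU := WX)) => // b; rewrite -ab_nat eP raddf0.
  by case: b; [exact: dd|rewrite raddf0].
have [|gU gUE] := mono_exact_lift (ir_aug_exact J) (s := a - ab_res (J 0) UX t)
    (@ir_aug_mono _ _ J).
  by rewrite raddfB /= ab_nat tE (ab_res_irr UX (WX true)) (eP true) subrr.
have [|gV gVE] := mono_exact_lift (ir_aug_exact J) (s := - ab_res (J 0) VX t)
    (@ir_aug_mono _ _ J).
  by rewrite raddfN /= ab_nat tE (ab_res_irr VX (WX false)) (eP false) oppr0.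
have gE : ab_res F NU gU - ab_res F NV gV = c.
  apply: (@ir_aug_mono _ _ J);
    rewrite raddfB /= !ab_nat gUE gVE !raddfB !raddfN /=.
  by rewrite !(ab_res_comp _ _ NX) opprK subrK -aN.
have gEx x (Ux : U x) (Vx : V x) :
    lc_fun gU (exist _ x Ux) = 1 + lc_fun gV (exist _ x Vx).
  have /(congr1 (@lc_incl T (A `|` B) N)) := gE; rewrite raddfB => e1.
  have {e1} := congr1 (fun s : G N => s (exist _ x (conj Ux Vx))) e1.
  rewrite addrfctE opprfctE.
  have -> : lc_incl (A `|` B) N (ab_res F NU gU) (exist _ x (conj Ux Vx)) =
    lc_fun gU (exist _ x Ux).
    exact (fun_sec_irr (lc_fun gU) _ _).
  have -> : lc_incl (A `|` B) N (ab_res F NV gV) (exist _ x (conj Ux Vx)) =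
    lc_fun gV (exist _ x Vx).
    exact (fun_sec_irr (lc_fun gV) _ _).
  by move=> e2; rewrite -[1]/(lc_incl (A `|` B) N c (exist _ x (conj Ux Vx)))
    -e2 subrK.
have gU0 x (Ux : U x) : B x -> lc_fun gU (exist _ x Ux) = 0.
  move=> Bx; have /asboolP/(_ x Ux)[O [Ox [n nP]]] := lc_funP gU.
  by have [-> n0] := nP x Ux Ox; apply: n0; right.
have gV0 x (Vx : V x) : A x -> lc_fun gV (exist _ x Vx) = 0.
  move=> Ax; have /asboolP/(_ x Vx)[O [Ox [n nP]]] := lc_funP gV.
  by have [-> n0] := nP x Vx Ox; apply: n0; left.
pose S (P Q : set int) :=
  [set x | exists h : U x, P (lc_fun gU (exist _ x h))] `|`
  [set x | exists h : V x, Q (lc_fun gV (exist _ x h))].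
have oS P Q : open (S P Q) by apply: openU; exact: lc_fun_open.
pose W1 := S [set 1] [set 0].
have W1C : ~` W1 = S (~` [set 1]) (~` [set 0]).
  apply/seteqP; split=> x.
    move=> nW; have [[] _ Wx] := cov x Logic.I.
      by left; exists Wx => g1; apply: nW; left; exists Wx.
    by right; exists Wx => g0; apply: nW; right; exists Wx.
  move=> [[Ux /= g1]|[Vx /= g0]] [[Ux' /= h1]|[Vx' /= h0]].
  - by apply: g1; rewrite (Prop_irrelevance Ux Ux').
  - by apply: g1; rewrite (gEx x Ux Vx') h0 addr0.
  - by apply: g0; apply: (@addrI _ 1); rewrite -(gEx x Ux' Vx) h1 addr0.
  - by apply: g0; rewrite (Prop_irrelevance Vx Vx').
exists W1; split.
- by split; [exact: oS|rewrite -openC W1C; exact: oS].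
- move=> x Ax; right; have Vx : V x by move=> Bx; have : (A `&` B) x by [];
  rewrite AB.
  by exists Vx; exact: gV0.
- apply/disjoints_subset => x W1x Bx; case: W1x => -[hx /= g];
  last exact (hx Bx).
  by move: g; rewrite gU0.
Qed.

(** * Characters of abelian groups *)

Definition is_subgroup (A : zmodType) (S : set A) :=
  S 0 /\ forall x y, S x -> S y -> S (x - y).

Lemma subgroupN (A : zmodType) (S : set A) x : is_subgroup S -> S x -> S (- x).
Proof. by move=> [S0 SB] Sx; rewrite -[- x]add0r; exact: SB. Qed.

Lemma subgroupD (A : zmodType) (S : set A) x y :
  is_subgroup S -> S x -> S y -> S (x + y).
Proof.
by move=> sS Sx Sy; rewrite -[y]opprK; apply: sS.2 => //; exact: subgroupN.
Qed.

Lemma subgroupMz (A : zmodType) (S : set A) x (k : int) :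
  is_subgroup S -> S x -> S (x *~ k).
Proof.
move=> sS Sx; have SMn n : S (x *+ n).
  by elim: n => [|n IH]; [rewrite mulr0n; exact: sS.1|rewrite mulrS;
    exact: subgroupD].
by case: k => n; [exact: SMn|apply: subgroupN => //; exact: (SMn n.+1)].
Qed.

Lemma int_subgroup (S : set int) : is_subgroup S ->
  exists n : nat, forall k, S k <-> exists q, k = q * n%:Z.
Proof.
move=> sS.
have [[m m0 Sm]|nS] := pselect (exists2 m : nat, (0 < m)%N & S m%:Z).
  have exm : exists m : nat, `[< (0 < m)%N /\ S m%:Z >] by exists m;
    apply/asboolP.
  case: (ex_minnP exm) => n /asboolP[n0 Sn] nmin; exists n => k; split;
    last first.
    by move=> [q ->]; rewrite mulrC -mulrzz; exact: subgroupMz.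
  move=> Sk; exists (k %/ n)%Z; apply/eqP; rewrite -subr_eq0.
  have Er : k - (k %/ n)%Z * n = (k %% n)%Z by rewrite {1}(divz_eq k n) addrC
    addKr.
  have Sr : S (k %% n)%Z.
    by rewrite -Er; apply: sS.2 => //; rewrite mulrC -mulrzz; exact: subgroupMz.
  have nz : n%:Z != 0 by rewrite -lt0n in n0 *.
  have := modz_ge0 k nz; have := ltz_pmod k (n0 : (0 < n%:Z)%R).
  rewrite Er; case: (k %% n)%Z Sr => // r Sr rn _.
  apply: contraT => r0; have /nmin : `[< (0 < r)%N /\ S r%:Z >].
    by apply/asboolP; split=> //; rewrite lt0n.
  by move: rn; rewrite ltz_nat ltnNge => /negP.
exists 0%N => k; split=> [Sk|[q ->]]; last by rewrite mulr0; exact: sS.1.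
exists 0; rewrite mul0r; case: k Sk => -[|n] Sn //; case: nS.
  by exists n.+1.
by exists 1%N => //; rewrite NegzE in Sn; rewrite -[_%:Z]opprK;
  exact: subgroupN.
exists n.+2 => //; rewrite NegzE in Sn; rewrite -[_%:Z]opprK; exact: subgroupN.
Qed.

Lemma pairMz (A D : zmodType) (u : A * D) (k : int) :
  u *~ k = (u.1 *~ k, u.2 *~ k).
Proof.
rewrite [LHS]surjective_pairing.
by congr (_, _); [exact: (raddfMz fst)|exact: (raddfMz snd)].
Qed.

Section Extension.
Variables (A D : zmodType).
Hypothesis D_divisible : forall (d : D) n, (0 < n)%N -> exists d', d' *+ n = d.

(** Homomorphisms defined on a subgroup are represented by their graphs, to
    which Zorn's lemma for unions of sets applies. *)
Definition is_partial_hom (M : set (A * D)) :=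
  is_subgroup M /\ forall d, M (0, d) -> d = 0.

Lemma partial_hom_fun M a d d' :
  is_partial_hom M -> M (a, d) -> M (a, d') -> d = d'.
Proof.
move=> [[_ MB] M0] ad ad'; apply/eqP; rewrite -subr_eq0; apply/eqP/M0.
by have := MB _ _ ad ad'; rewrite (_ : _ - _ = (0, d - d')) // -[0](subrr a).
Qed.

(** The multiples of [a] on which the homomorphism is defined are those of some
    [a *+ n]; its value there can be divided by [n], and gives one at [a]. *)
Lemma partial_hom_step (M : set (A * D)) (a : A) : is_partial_hom M ->
  exists M', [/\ is_partial_hom M', M `<=` M' & exists d, M' (a, d)].
Proof.
move=> homM; have [sM M0] := homM.
pose S : set int := [set k | exists e, M (a *~ k, e)].
have sS : is_subgroup S.
  split; first by exists 0; rewrite mulr0z; exact: sM.1.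
  move=> k l [d kd] [e le]; exists (d - e).
  by have := sM.2 _ _ kd le; rewrite mulrzBr.
have [n nP] := int_subgroup sS.
have [e0 Me0] : S n by apply/nP; exists 1; rewrite mul1r.
have [d dE] : exists d, d *+ n = e0.
  case: (posnP n) => [n0|]; last exact: D_divisible.
  exists 0; rewrite n0 mulr0n; apply/esym/M0.
  by move: Me0; rewrite n0 mulr0z.
exists [set v | exists u k, M u /\ v = (u.1 + a *~ k, u.2 + d *~ k)]; split.
- split; first split.
  + by exists (0, 0), 0; split; [exact: sM.1|rewrite !mulr0z !addr0].
  + move=> _ _ [u [k [Mu ->]]] [v [l [Mv ->]]].
    exists (u - v), (k - l); split; first exact: sM.2.
    by rewrite !mulrzBr /=; congr (_, _); rewrite /= opprD addrACA.
  + move=> e [[b c] [k [Mbc []]]] /= /esym bk ->.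
    have bE : b = a *~ (- k) by rewrite mulrNz; apply/eqP; rewrite -addr_eq0 bk.
    have /nP[q kq] : S (- k) by exists c; rewrite -bE.
    have Mq : M (a *~ (- k), d *~ (- k)).
      rewrite kq mulrC !mulrzA.
      by have := subgroupMz q sM Me0; rewrite pairMz -dE.
    rewrite bE in Mbc; rewrite (partial_hom_fun homM Mbc Mq).
    by rewrite mulrNz addNr.
- by move=> [b c] Mbc; exists (b, c), 0; split => //; rewrite !mulr0z !addr0.
- by exists d, (0, 0), 1; split; [exact: sM.1|rewrite !mulr1z !add0r].
Qed.

Lemma hom_extension (M0 : set (A * D)) : is_partial_hom M0 ->
  exists phi : {additive A -> D}, forall u, M0 u -> phi u.1 = u.2.
Proof.
move=> homM0.
have [|J [homJ Jmax]] := @Zorn_bigcup _ [set J : set (A * D) | is_partial_hom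
  (M0 `|` J)].
  move=> F FP totF; have [[M00 M0B] M0f] := homM0.
  have subF J : F J -> M0 `|` J `<=` M0 `|` \bigcup_(K in F) K.
    by move=> FJ x [|]; [left|right; exists J].
  have subB J K x y : F J -> F K -> J x -> K y -> (M0 `|` \bigcup_(K in F) K)
    (x - y).
    move=> FJ FK Jx Ky; have [JK|KJ] := totF _ _ FJ FK.
      by apply: (subF K FK); have [[_ h] _] := FP K FK; apply: h; right => //;
        exact: JK.
    by apply: (subF J FJ); have [[_ h] _] := FP J FJ; apply: h; right => //;
      exact: KJ.
  split; first split.
  - by left.
  - move=> x y [Mx|[J FJ Jx]] [My|[K FK Ky]].
    + by left; exact: M0B.
    + by apply: (subF K FK); have [[_ h] _] := FP K FK; apply: h; [left|right].
    + by apply: (subF J FJ); have [[_ h] _] := FP J FJ; apply: h; [right|left].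
    + exact: subB FJ FK Jx Ky.
  - move=> d [/M0f //|[J FJ Jd]]; have [_ h] := FP J FJ; by apply: h; right.
have total a : exists d, (M0 `|` J) (a, d).
  have [M' [homM' MM' [d M'd]]] := partial_hom_step a homJ.
  exists d; apply: contrapT => nd; apply: (Jmax M').
    split; first by move=> u Ju; apply: MM'; right.
    by move=> M'J; apply: nd; right; exact: M'J.
  rewrite /=; suff -> : M0 `|` M' = M' by [].
  by apply/seteqP; split=> [u []// M0u|u]; [apply: MM'; left|right].
have /choice[phi phiP] := total.
have phiB : zmod_morphism phi.
  move=> a b; apply: (partial_hom_fun homJ (phiP (a - b))).
  by have [[_ h] _] := homJ; exact: h (phiP a) (phiP b).
exists (additive_of phiB) => -[a d] M0u /=.
by apply: (partial_hom_fun homJ (phiP a)); left.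
Qed.

Hypothesis D_torsion : forall n : nat, n != 1%N -> exists2 d : D,
  d != 0 & d *+ n = 0.

(** Modulo [B], the element [x] generates a cyclic group, which has a character
    that is nonzero at [x]; it extends because [D] is divisible. *)
Lemma hom_separation (B : set A) (x : A) : is_subgroup B -> ~ B x ->
  exists2 phi : {additive A -> D}, forall b, B b -> phi b = 0 & phi x != 0.
Proof.
move=> sB Bx; pose S : set int := [set k | B (x *~ k)].
have sS : is_subgroup S.
  split; first by rewrite /S /= mulr0z; exact: sB.1.
  by move=> k l Sk Sl; rewrite /S /= mulrzBr; exact: sB.2.
have [n nP] := int_subgroup sS.
have n1 : n != 1%N.
  apply/eqP => n1; apply: Bx; rewrite -[x]mulr1z; apply/nP.
  by exists 1; rewrite n1 mul1r.
have [d d0 dn] := D_torsion n1.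
have [|phi phiP] := @hom_extension [set v | exists b k, B b /\ v = (b + x *~ k,
  d *~ k)].
  split; first split.
  - by exists 0, 0; split; [exact: sB.1|rewrite !mulr0z addr0].
  - move=> _ _ [b [k [Bb ->]]] [c [l [Bc ->]]].
    exists (b - c), (k - l); split; first exact: sB.2.
    by rewrite !mulrzBr; congr (_, _); rewrite /= opprD addrACA.
  - move=> e [b [k [Bb []]]] /esym bk ->.
    have /nP[q ->] : S k.
      rewrite /S /= (_ : x *~ k = - b); first exact: subgroupN.
      by apply: (@addrI _ b); rewrite bk subrr.
    by rewrite mulrC mulrzA -[_ *~ Posz n]/(d *+ n) dn mul0rz.
exists phi.
  move=> b Bb; apply: (phiP (b, 0)); exists b, 0; split => //.
  by rewrite !mulr0z addr0.
rewrite (_ : phi x = d) //; apply: (phiP (x, d)); exists 0, 1.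
by split; [exact: sB.1|rewrite !mulr1z add0r].
Qed.

End Extension.

(** * The divisible group [Q/Z] *)

Section RatModInt.
Import Num.Theory.

Definition rat_int : {pred rat} := fun q => q \in Num.int.

Fact rat_int_zmod_closed : zmod_closed rat_int.
Proof. by split=> [|x y]; [exact: rpred0|exact: rpredB]. Qed.

HB.instance Definition _ :=
  GRing.isZmodClosed.Build rat rat_int rat_int_zmod_closed.

Definition rat_mod_int : zmodType := Quotient.quot (rat_int : zmodClosed rat).

Definition rat_mod_int_pi (q : rat) : rat_mod_int :=
  \pi_(Quotient.quot (rat_int : zmodClosed rat)) q.

Lemma rat_mod_int_piB : zmod_morphism rat_mod_int_pi.
Proof. exact: raddfB. Qed.

HB.instance Definition _ :=
  GRing.isZmodMorphism.Build rat rat_mod_int rat_mod_int_pi rat_mod_int_piB.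

Lemma rat_mod_int_pi_eq0 q : (rat_mod_int_pi q == 0) = (q \in Num.int).
Proof.
rewrite -[RHS]/(q \in rat_int) -[in RHS](subr0 q) Quotient.idealrBE.
by rewrite -[X in _ == X](raddf0 rat_mod_int_pi).
Qed.

Lemma rat_mod_int_divisible (d : rat_mod_int) n : (0 < n)%N ->
  exists d', d' *+ n = d.
Proof.
move=> n0; exists (rat_mod_int_pi (repr d / n%:R)).
rewrite -raddfMn -[(_ / _) *+ n]mulr_natr divfK; first exact: reprK.
by rewrite pnatr_eq0 -lt0n.
Qed.

Lemma rat_mod_int_torsion n : n != 1%N ->
  exists2 d : rat_mod_int, d != 0 & d *+ n = 0.
Proof.
have inv_int m : (m > 1)%N -> (m%:R^-1 : rat) \notin Num.int.
  move=> m1; apply/negP => /intrP[z zm].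
  have : (z * m%:Z == 1)%R.
    rewrite -(eqr_int rat) intrM -zm mulVf //.
    by rewrite pnatr_eq0 -lt0n; exact: ltnW.
  move=> /eqP/(congr1 absz); rewrite abszM => /eqP.
  by rewrite muln_eq1 => /andP[_ /eqP] /=; case: m m1 {zm} => [|[]].
have [-> _|n0 n1] := posnP n.
  by exists (rat_mod_int_pi 2%:R^-1); rewrite ?rat_mod_int_pi_eq0 ?inv_int.
exists (rat_mod_int_pi n%:R^-1).
  by rewrite rat_mod_int_pi_eq0 inv_int // ltn_neqAle eq_sym n1.
apply/eqP; rewrite -raddfMn -[_^-1 *+ n]mulr_natr mulVf ?rat_mod_int_pi_eq0
  ?rpred1 //.
by rewrite pnatr_eq0 -lt0n.
Qed.

End RatModInt.

(** * Germs *)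

Section ZmodProduct.
Variables (I : Type) (M : I -> zmodType).

Definition zprod : Type := forall i, M i.
HB.instance Definition _ := Choice.on zprod.

Lemma zprod_ext (f g : zprod) : (forall i, f i = g i) -> f = g.
Proof. exact: functional_extensionality_dep. Qed.

Let zero : zprod := fun=> 0.
Let opp (f : zprod) : zprod := fun i => - f i.
Let add (f g : zprod) : zprod := fun i => f i + g i.

Fact zprod_addA : associative add.
Proof. by move=> f g h; apply: zprod_ext => i; exact: addrA. Qed.
Fact zprod_addC : commutative add.
Proof. by move=> f g; apply: zprod_ext => i; exact: addrC. Qed.
Fact zprod_add0 : left_id zero add.
Proof. by move=> f; apply: zprod_ext => i; exact: add0r. Qed.
Fact zprod_addN : left_inverse zero opp add.
Proof. by move=> f; apply: zprod_ext => i; exact: addNr. Qed.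

HB.instance Definition _ := GRing.isZmodule.Build zprod
  zprod_addA zprod_addC zprod_add0 zprod_addN.

End ZmodProduct.

(** Families of sections over all open sets, modulo those that vanish on all
    small neighbourhoods of [x]: a group that contains the stalk at [x]. It can
    replace the stalk, because characters of a subgroup extend, and it is a
    quotient of a product, so that no direct limit is involved. *)
Section Germs.
Variables (T : topologicalType) (F : ab_sheaf T) (x : T).
Implicit Types (U V W : opens T).

Definition eventually_zero : {pred zprod (fun U => F U)} := fun s =>
  `[< exists V0 : opens T, V0 x /\ forall V, V `<=` V0 -> V x -> s V = 0 >].

Fact eventually_zero_zmod_closed : zmod_closed eventually_zero.
Proof.
split; first by apply/asboolP; exists (opens_setT T).
move=> s t /asboolP[V [Vx sV]] /asboolP[W [Wx tW]]; apply/asboolP.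
exists (opens_setI V W); split=> // N NVW Nx.
rewrite -[LHS]/(s N - t N) sV ?tW ?subrr //.
  by move=> y /NVW[].
by move=> y /NVW[].
Qed.

HB.instance Definition _ := GRing.isZmodClosed.Build (zprod (fun U => F U))
  eventually_zero eventually_zero_zmod_closed.

Definition germs : zmodType :=
  Quotient.quot (eventually_zero : zmodClosed (zprod (fun U => F U))).

Definition extend U (s : F U) : zprod (fun U => F U) := fun V =>
  match pselect (V `<=` U) with left h => ab_res F h s | right _ => 0 end.

Lemma extendE U (s : F U) V (h : V `<=` U) : extend s V = ab_res F h s.
Proof.
by rewrite /extend; case: pselect => // h'; exact: ab_res_irr.
Qed.

Definition germ U (s : F U) : germs :=
  \pi_(Quotient.quot (eventually_zero : zmodClosed (zprod (fun U =>
    F U)))) (extend s).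

Lemma germ_eq0 U (s : F U) : U x -> germ s = 0 <->
  exists V (h : V `<=` U), V x /\ ab_res F h s = 0.
Proof.
move=> Ux.
have -> : germ s = 0 <-> extend s \in eventually_zero.
  rewrite -[extend s]subr0 Quotient.idealrBE -[X in _ <-> is_true (_ ==
    X)]/(\pi 0).
  rewrite raddf0; split=> [|/eqP]; last by [].
  by move=> /eqP.
split=> [/asboolP[V [Vx sV]]|[V [h [Vx sV]]]].
  exists (opens_setI V U), (@subIsetr _ _ _); split=> //.
  by rewrite -extendE sV // => y [].
apply/asboolP; exists V; split=> // W WV Wx.
by rewrite (extendE _ (subset_trans WV h)) -(ab_res_comp h WV) sV raddf0.
Qed.

Lemma germB U : zmod_morphism (@germ U).
Proof.
move=> s t; rewrite /germ -raddfB; congr (\pi _); apply: zprod_ext => V.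
rewrite -[RHS]/(extend s V - extend t V) /extend.
by case: pselect => h; [exact: raddfB|rewrite subr0].
Qed.

HB.instance Definition _ U :=
  GRing.isZmodMorphism.Build (F U) germs (@germ U) (@germB U).

Lemma germ_res U V (h : V `<=` U) s : V x -> germ (ab_res F h s) = germ s.
Proof.
move=> Vx; apply/eqP; rewrite /germ -Quotient.idealrBE; apply/asboolP.
exists V; split=> // W WV Wx.
rewrite -[LHS]/(extend (ab_res F h s) W - extend s W).
by rewrite (extendE _ WV) (extendE _ (subset_trans WV h)) (ab_res_comp _ _
  (subset_trans WV h)) subrr.
Qed.

End Germs.

(** * Enough injectives and injective resolutions *)

(** A morphism to a sheaf of functions is a family of homomorphisms defined on
    the stalks, one for each [k], and each of them extends along the
    injection of stalks. *)
Lemma fun_sheaf_injective (T : topologicalType) (K : Type) (pi : K -> T) :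
  ab_injective (fun_sheaf pi rat_mod_int).
Proof.
move=> F G i f imono; pose J := fun_sheaf pi rat_mod_int.
have ext (k : K) : {chi : {additive germs G (pi k) -> rat_mod_int} |
    forall (U : opens T) (hk : U (pi k)) (s : F U),
      chi (germ (pi k) (i U s)) = (f U s : fun_sec pi rat_mod_int U) (exist _ k
        hk)}.
  apply: cid.
  have [|chi chiP] := hom_extension rat_mod_int_divisible
    (M0 := [set v | exists (U : opens T) (hk : U (pi k)) (s : F U),
      v = (germ (pi k) (i U s),
        (f U s : fun_sec pi rat_mod_int U) (exist _ k hk))]).
    split; first split.
    - by exists (opens_setT T), Logic.I, 0; rewrite !raddf0.
    - move=> _ _ [U [Uk [s ->]]] [V [Vk [t ->]]].
      pose N := opens_setI U V; have NU : N `<=` U by move=> y [].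
      have NV : N `<=` V by move=> y [].
      have Nk : N (pi k) by split.
      exists N, Nk, (ab_res F NU s - ab_res F NV t).
      rewrite !raddfB /= !ab_nat !germ_res //.
      congr (_, _).
      rewrite addrfctE opprfctE.
      by congr (_ - _); exact: fun_sec_irr.
    - move=> d [U [Uk [s [/esym/(germ_eq0 _ Uk)[V [VU [Vk]]]]]]].
      rewrite -ab_nat -(raddf0 (i V)) => /imono sV ->.
      have : ab_res J VU (f U s) = 0 by rewrite -ab_nat sV raddf0.
      move=> /(congr1 (fun r : fun_sec pi rat_mod_int V =>
        r (exist _ k Vk))) e0.
      exact (etrans (fun_sec_irr (f U s) _ _) e0).
  exists chi => U hk s.
  refine (chiP (germ (pi k) (i U s),
    (f U s : fun_sec pi rat_mod_int U) (exist _ k hk)) _).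
  by exists U, hk, s.
pose g0 (U : opens T) (s : G U) : J U := fun k =>
  sval (ext (sval k)) (germ (pi (sval k)) s).
have g0B U : zmod_morphism (@g0 U).
  by move=> s t; apply: funext => -[k hk]; rewrite /g0 raddfB raddfB.
have g0nat (U V : opens T) (h : V `<=` U) s : additive_of (@g0B V) (ab_res G h
  s) = ab_res J h (additive_of (@g0B U) s).
  by apply: funext => -[k hk]; rewrite /= /g0 /= germ_res.
exists (AbMor (ab_app := fun U => additive_of (@g0B U)) g0nat) => U s.
apply: funext => -[k hk]; exact: (svalP (ext k)).
Qed.

Section Cokernel.
Variables (T : topologicalType) (F G : ab_sheaf T) (f : ab_mor F G).

Definition cokernel_characters : Type :=
  {x : T & {phi : {additive germs G x -> rat_mod_int} |
  forall (U : opens T) (s : F U), U x -> phi (germ x (f U s)) = 0}}.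

Definition coker_obj : ab_sheaf T :=
  fun_sheaf (fun k : cokernel_characters => projT1 k) rat_mod_int.

Definition coker_app0 (U : opens T) (s : G U) : coker_obj U :=
  fun k => sval (projT2 (sval k)) (germ (projT1 (sval k)) s).

Let coker_app0B U : zmod_morphism (@coker_app0 U).
Proof. by move=> s t; apply: funext => k;
  rewrite /coker_app0 raddfB raddfB. Qed.

Fact coker_nat (U V : opens T) (h : V `<=` U) s :
  additive_of (@coker_app0B V) (ab_res G h s) =
  ab_res coker_obj h (additive_of (@coker_app0B U) s).
Proof.
by apply: funext => -[k hk]; rewrite /= /coker_app0 /= germ_res.
Qed.

Definition coker_mor : ab_mor G coker_obj :=
  AbMor (ab_app := fun U => additive_of (@coker_app0B U)) coker_nat.

(** A section all of whose characters vanish has germs in the image, because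
    characters separate a subgroup from the elements outside it. *)
Lemma coker_exact : ab_exact f coker_mor.
Proof.
split=> U s; first by apply: funext => -[[x [phi phi0]] Ux];
  exact (phi0 U s Ux).
move=> gs x Ux; pose B : set (germs G x) :=
  [set b | exists (V : opens T) (t : F V),
  V x /\ b = germ x (f V t)].
have sB : is_subgroup B.
  split; first by exists (opens_setT T), 0; rewrite !raddf0.
  move=> _ _ [V [t [Vx ->]]] [W [r [Wx ->]]].
  pose N := opens_setI V W; have NV : N `<=` V by move=> y [].
  have NW : N `<=` W by move=> y [].
  exists N, (ab_res F NV t - ab_res F NW r); split; first by split.
  by rewrite raddfB /= !ab_nat raddfB /= !germ_res.
have [V [t [Vx st]]] : B (germ x s).
  apply: contrapT => /(hom_separation rat_mod_int_divisible rat_mod_int_torsion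
    sB).
  move=> [phi phiB /eqP]; apply.
  have phi0 (V : opens T) (t : F V) : V x -> phi (germ x (f V t)) = 0.
    by move=> Vx; apply: phiB; exists V, t.
  pose k : cokernel_characters := existT _ x (exist _ phi phi0).
  exact: (congr1 (fun r : coker_obj U => r (exist _ k Ux)) gs).
pose N := opens_setI U V; have NU : N `<=` U by move=> y [].
have NV : N `<=` V by move=> y [].
have Nx : N x by split.
have : germ x (ab_res G NU s - ab_res G NV (f V t)) = 0.
  by rewrite raddfB /= !germ_res // st subrr.
move=> /(germ_eq0 _ Nx)[W [WN [Wx]]].
rewrite raddfB /= (ab_res_comp _ _ (subset_trans WN NU)) (ab_res_comp _ _
  (subset_trans WN NV)).
move=> /eqP; rewrite subr_eq0 => /eqP e.
exists W, (subset_trans WN NU), (ab_res F (subset_trans WN NV) t); split=> //.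
by rewrite ab_nat e.
Qed.

End Cokernel.

Section Resolution.
Variables (T : topologicalType) (F : ab_sheaf T).

Let zero_app U : zmod_morphism (fun _ : F U => 0 : F U).
Proof. by move=> s t; rewrite subr0. Qed.

Definition zero_mor : ab_mor F F :=
  @AbMor T F F (fun U => additive_of (@zero_app U))
    (fun U V h s => esym (raddf0 (ab_res F h))).

(** The source of an arrow of the resolution is by computation the target of the
    previous one, so that the differentials compose without transport. *)
Definition arrow := {F : ab_sheaf T & {G : ab_sheaf T & ab_mor F G}}.
Definition target (a : arrow) : ab_sheaf T := projT1 (projT2 a).
Definition arrow_mor (a : arrow) : ab_mor (projT1 a) (target a) :=
  projT2 (projT2 a).
Definition next (a : arrow) : arrow :=
  existT _ (target a) (existT _ _ (coker_mor (arrow_mor a))).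

Fixpoint resolution_arrow n : arrow :=
  if n is m.+1 then next (resolution_arrow m)
  else existT _ F (existT _ _ (coker_mor zero_mor)).

Lemma zero_coker_mono : ab_mono (coker_mor zero_mor).
Proof.
move=> U s t st; apply/eqP; rewrite -subr_eq0; apply/eqP.
have [_ ex] := coker_exact zero_mor.
apply: ab_sec_eq_local => x Ux;
  have [|V [VU [r [Vx e]]]] := ex U (s - t) _ x Ux.
  by rewrite raddfB st subrr.
by exists V, VU; split => //; rewrite -e raddf0.
Qed.

Definition injective_resolution_of : injective_resolution F.
Proof.
refine (@InjRes T F (fun n => target (resolution_arrow n)) _
  (coker_mor zero_mor) (fun n => arrow_mor (resolution_arrow n.+1))
  zero_coker_mono _ _).
- by case=> [|n]; exact: fun_sheaf_injective.
- exact: coker_exact.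
- by move=> n; exact: coker_exact.
Defined.

End Resolution.

Lemma cohomology_zero_from_separation (T : topologicalType) (F : ab_sheaf T) p :
  quasicompact T -> clopen_separation T -> (1 <= p)%N -> cohomology_zero F p.
Proof.
move=> T_qc sepT; case: p => // p _; exists (injective_resolution_of F) => s ds.
exact: (separation_exact_lift (ir_exact (injective_resolution_of F) p)).
Qed.

(** * The equivalence *)

Theorem theorem4p1 (X : scheme) (X_qc : quasicompact X) :
  [<-> forall (F : ab_sheaf X) (p : nat), (1 <= p)%N -> cohomology_zero F p;
       forall (U : scheme) (f : scheme_mor U X),
         set_surj [set: U] [set: X] f -> local_isomorphism f ->
         exists g : scheme_mor X U, is_section f g;
       affine X /\
         forall x : X, local_space (set_type (connected_component [set: X] x));
       [/\ affine X,
           forall C : set X, irreducible_component C ->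
             local_space (set_type C) &
           at_most_zero_dimensional (set_type (closed_points X))];
       affine X /\
         forall r : global_sections X, exists e u : global_sections X,
           [/\ e * e = e, ring_unit u & r = e + u]].
Proof.
have X_T0 := @scheme_kolmogorov X.
tfae.
- move=> H; apply: sections_from_separation => //.
  by apply: separation_from_cohomology => F; exact: H.
- move=> /separation_from_sections sepX.
  split; first exact: affine_from_separation.
  by move=> x; exact: separation_local_component.
- move=> [affX locX]; have [A [f isof]] := affX.
  have [rho _] := affine_chart isof.
  have sepX : clopen_separation X.
    by apply: separation_from_local_components => // F G;
      exact: (chart_fatten rho).
  split=> //; last exact: separation_zero_dimensional.
  by move=> C; exact: separation_local_irreducible.
- move=> [affX locX zdX]; have [A [f isof]] := affX.
  have [rho _] := affine_chart isof.
  split=> //; apply: clean_from_separation.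
  by apply: separation_from_local_irreducibles => // Z y;
    exact: (chart_generizations rho).
- move=> [affX cleanX] F p p1; apply: cohomology_zero_from_separation => //.
  exact: separation_from_clean.
Qed.
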